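(* Let $g\ge 1$, let $\mathbb{X}^2=\mathbb{E}^2$ if $g=1$ and $\mathbb{X}^2=\mathbb{H}^2$ if $g\ge 2$, and let $W_\infty$ be an alternating periodic weave in $\mathbb{X}^2\times I$. Let $D_W$ be a weaving motif of $W_\infty$ on a surface $S_g$ of genus $g$ that is minimal (i.e. a motif for a minimal lattice $\Lambda_{\min}$ of $W_\infty$), reduced and alternating. Then $D_W$ is a minimum diagram of $W_\infty$: its number of crossings equals the crossing number $C(W_\infty)$.
   Context: Let $I=[-1,1]$. For $g\ge1$, $S_g$ is the closed orientable surface of genus $g$ ($S_1=T^2$), $\mathbb{X}^2=\mathbb{E}^2$ if $g=1$ and $\mathbb{X}^2=\mathbb{H}^2$ if $g\ge2$. $S_g=\mathbb{X}^2/\Lambda$ where $\Lambda$ is a lattice: for $g=1$, $\Lambda=\Lambda(u,v)=\{xu+yv: x,y\in\mathbb{Z}\}$ for a basis $u,v$ of $\mathbb{E}^2$; for $g\ge2$, a discrete group generated by translations of $\mathbb{H}^2$ with quotient $S_g$. The covering map $\mathbb{X}^2\to S_g$ extends to $\mathbb{X}^2\times I\to S_g\times I$. Threads. An essential (non-null-homotopic) closed curve component of a link in $S_g\times I$ lifts to infinite open curves called threads; a thread is unknotted if its projection to $\mathbb{X}^2$ has no self-crossing. For $g=1$, two components (or their lifts) are parallel, i.e. belong to the same set of threads, if they are homotopic to the same $(p,q)$-torus knot. For $g\ge 2$, the projection of the lifted link to $\mathbb{H}^2$ is required to be isotopic to a quadrivalent kaleidoscopic tiling (obtained by repeatedly reflecting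 a convex hyperbolic polygon $P$ with $n\ge3$ edges in its sides); if $n$ is odd each edge of $P$ gets a different direction, if $n$ is even opposite edges of $P$ get the same direction, reflections transport directions, and threads belong to the same set iff they have the same direction. Periodic weaves. Let $W\subset S_g\times I$ be a link all of whose components are essential closed curves lifting to unknotted threads (for $g=1$: each component is homotopic to a $(p_i,q_i)$-torus knot with $p_i,q_i$ coprime), and whose components belong to at least two distinct sets of threads. The lift $W_\infty$ of $W$ to $\mathbb{X}^2\times I$ is a periodic weave, the diagram $D_W$ of $W$ on $S_g$ is a weaving motif, and the lift $D_\infty$ of $D_W$ to $\mathbb{X}^2$ is a weaving diagram. For a fixed lattice, motifs represent the same weave when they are related by finitely many Reidemeister moves $R_1,R_2,R_3$, isotopies of $S_g$ and Dehn twists of $S_g$. Minimal lattice. For lattices of the same weave, write $\Lambda\subseteq\Lambda'$ when a unit cell of $\Lambda'$ is tiled by unit cells of $\Lambda$ (e.g. $u'=k_uu$, $v'=k_vv$ with $k_u,k_v$ positive integers). A minimal lattice $\Lambda_{\min}$ of $W_\infty$ is a periodic lattice with $\Lambda_{\min}\subseteq\Lambda$ for every periodic lattice $\Lambda$ of $W_\infty$. A motif is minimal if it is a motif for $\Lambda_{\min}$. Alternating. A motif (or diagram) is alternating if crossings alternate between over and under along each component; a periodic weave is alternating if it admits an alternating motif. Reduced. A motif is reduced if its lift to $\mathbb{X}^2$ has no nugatory crossing, where a crossing is nugatory if two of the four local regions at it are part of the same region of the infinite diagram. Crossing number. $C(W_\infty)$ is the minimum of the numbers of crossings of all weaving motifs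 of $W_\infty$ for a minimal lattice $\Lambda_{\min}$. A motif of $W_\infty$ with exactly $C(W_\infty)$ crossings is called minimum. *)

(* Defs.v *)
From mathcomp Require Import all_boot all_order all_algebra.
From mathcomp Require Import all_classical all_reals all_analysis.

Set Implicit Arguments.
Unset Strict Implicit.
Unset Printing Implicit Defensive.

Import Order.TTheory GRing.Theory Num.Theory.
Import numFieldNormedType.Exports.

Local Open Scope classical_set_scope.
Local Open Scope ring_scope.

(* LINK DIAGRAMS ON ORIENTED SURFACES
   A diagram is the 4-valent graph of its crossings, as a combinatorial map on
   its darts: a dart is an edge together with one of its two ends, i.e. an edge
   leaving a crossing.  [nx] is the next dart counterclockwise around the
   crossing, [ed] is the other end of the edge.  [d] and [nx (nx d)] lie on the
   same strand at their crossing, and [over d] says that it is the upper one.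

   All the diagrams below have discs as regions, so the embedding in the surface
   is determined by this data up to orientation-preserving homeomorphism.
   Indeed every component of a link lifting to a weave is essential, and these
   components fill the surface (torus knots of two distinct slopes if g = 1, the
   closed geodesics of a tiling by compact polygons if g >= 2); this holds for
   every link homotopic to it.  In particular no component is free of
   crossings. *)
Record diagram (T : Type) := Diagram {
  nx : T -> T;
  ed : T -> T;
  over : T -> bool;
  nx4 : forall d, nx (nx (nx (nx d))) = d;
  nx2_neq : forall d, nx (nx d) <> d;
  ed_invol : forall d, ed (ed d) = d;
  ed_neq : forall d, ed d <> d;
  over_nx : forall d, over (nx d) = ~~ over d }.

Section DiagramTheory.
Variables (T : Type) (M : diagram T).

Definition same_crossing (d e : T) : Prop := exists i, iter i (nx M) d = e.

(* Follow the edge of [d], cross the strand met there, and leave. *)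
Definition straight (d : T) : T := nx M (nx M (ed M d)).

(* Next dart along the boundary of the region on the left of [d]: [fc] is
   [nx^-1 \o ed].  The corner between [d] and [nx d] lies in that region. *)
Definition fc (d : T) : T := nx M (nx M (nx M (ed M d))).

Definition same_region (d e : T) : Prop := exists k, iter k fc d = e.

Definition nugatory (d : T) : Prop :=
  exists i j, [/\ (i < j < 4)%N & same_region (iter i (nx M) d) (iter j (nx M) d)].

Definition alternating_diagram : Prop := forall d, over M (ed M d) = ~~ over M d.

(* [walk d s e]: the edge path [s] leads from the crossing of [d] to that of [e]. *)
Fixpoint walk (d : T) (s : seq T) (e : T) : Prop :=
  if s is a :: s' then same_crossing d a /\ walk (ed M a) s' e
  else same_crossing d e.

(* Homotopy, with fixed ends, of edge paths in the closed surface obtained by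
   gluing a disc along each finite boundary cycle. *)
Inductive homotopic (d e : T) : seq T -> seq T -> Prop :=
| Homotopic_refl s : homotopic d e s s
| Homotopic_sym s t : homotopic d e s t -> homotopic d e t s
| Homotopic_trans s t u :
    homotopic d e s t -> homotopic d e t u -> homotopic d e s u
| Homotopic_backtrack s t a : walk d (s ++ a :: ed M a :: t) e ->
    homotopic d e (s ++ t) (s ++ a :: ed M a :: t)
| Homotopic_region s t a n : (0 < n)%N -> iter n fc a = a ->
    walk d (s ++ traject fc a n ++ t) e ->
    homotopic d e (s ++ t) (s ++ traject fc a n ++ t).

End DiagramTheory.

Definition morphism T U (M : diagram T) (N : diagram U) (f : T -> U) : Prop :=
  [/\ forall d, f (nx M d) = nx N (f d), forall d, f (ed M d) = ed N (f d)
    & forall d, over N (f d) = over M d].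

(* [M] is the lift of the diagram [N] to the universal cover of its surface:
   crossings and edges are never branched, hence the condition on regions. *)
Definition universal_cover T U (M : diagram T) (N : diagram U) (p : T -> U) : Prop :=
  [/\ morphism M N p,
      forall e, exists d, p d = e,
      forall d k, iter k (fc N) (p d) = p d -> iter k (fc M) d = d,
      forall d e, exists s, walk M d s e
    & forall d s, walk M d s d -> homotopic M d d s [::]].

(* FINITE DIAGRAMS, i.e. diagrams of links in a thickened closed surface *)

Record motif := Motif { mdart :> finType; mdiag :> diagram mdart }.

Definition crossings (D : motif) : nat := fcard (nx D) predT.

Definition reduced (D : motif) : Prop :=
  exists (U : Type) (M : diagram U) (p : U -> D),
    universal_cover M D p /\ forall d, ~ nugatory M d.

(* No component of the link bounds a disc: [orbit (straight D) d] is the closed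
   edge path running once along the component of [d]. *)
Definition essential (D : motif) : Prop :=
  forall d : D, ~ homotopic D d d (orbit (straight D) d) [::].

(* [D] is drawn, with discs as regions, on the closed surface of genus [g]:
   V - E + F = 2 - 2 g. *)
Definition on_surface (g : nat) (D : motif) : Prop :=
  [/\ (0 < #|D|)%N,
      forall d e : D, connect (fun a b => (b == nx D a) || (b == ed D a)) d e
    & (fcard (nx D) predT + fcard (fc D) predT + 2 * g =
       fcard (ed D) predT + 2)%N].

Definition isomorphic (D D' : motif) : Prop :=
  exists2 f : D -> D', bijective f & morphism D D' f.

(* [D] is obtained from [D'] by erasing the crossings with darts in [S], the
   strands through them being kept and running straight on.  No component has
   all its crossings erased. *)
Definition erased (D D' : motif) (S : D' -> Prop) : Prop :=
  exists i : D -> D',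
    [/\ injective i /\ (forall z, (exists c, i c = z) <-> ~ S z),
        forall c, i (nx D c) = nx D' (i c),
        forall c, over D' (i c) = over D c,
        forall c, exists k,
          let follow j := iter j (fun z => ed D' (nx D' (nx D' z))) (ed D' (i c)) in
          follow k = i (ed D c) /\ (forall j, (j < k)%N -> S (follow j))
      & forall z, S z -> exists k, ~ S (iter k (straight D') z)].

(* The kink of [D'] at the crossing of [x] bounds a monogon, which lies in the
   corner between [x] and [nx x]. *)
Definition R1 (D D' : motif) : Prop :=
  exists2 x : D', ed D' x = nx D' x & erased D (same_crossing D' x).

(* The bigon of [D'] has sides [x]-[y] and [nx^-1 x]-[nx y]. *)
Definition R2 (D D' : motif) : Prop :=
  exists x y : D',
    [/\ ~ same_crossing D' x y, ed D' x = y,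
        ed D' (nx D' (nx D' (nx D' x))) = nx D' y, over D' y = over D' x
      & erased D (fun z => same_crossing D' x z \/ same_crossing D' y z)].

(* [I] lists the six darts on the sides of a triangle.  On each of the three
   strands, the order of the two crossings is exchanged: the edge coming from
   outside to one of them is reattached, by [slide], to the other one, on the
   side that used to face the triangle; the two darts opposite to the ends of a
   former side become the ends of the new side. *)
Definition slide (D : motif) (I : seq D) (c : D) : D :=
  if c \in I then nx D (nx D c)
  else if nx D (nx D c) \in I then ed D (nx D (nx D c)) else c.

(* A triangle can be moved unless each strand is over at exactly one of its two
   ends, i.e. unless [over] is constant on the boundary cycle. *)
Definition R3 (D D' : motif) : Prop :=
  exists (t : D) (h : D -> D'),
    let t1 := fc D t in
    let t2 := fc D t1 in
    let I := [:: t; t1; t2; ed D t; ed D t1; ed D t2] in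
    [/\ fc D t2 = t,
        [/\ ~ same_crossing D t t1, ~ same_crossing D t1 t2 & ~ same_crossing D t2 t],
        ~ (over D t = over D t1 /\ over D t1 = over D t2),
        bijective h
      & [/\ forall c, h (nx D c) = nx D' (h c), forall c, over D' (h c) = over D c
          & forall c, ed D' (h (slide I c)) = h (slide I (ed D c))]].

(* Diagrams on S_g representing the same weave for a fixed lattice.  An
   isomorphism of diagrams is an orientation-preserving homeomorphism of S_g,
   that is, up to isotopy, a product of Dehn twists. *)
Inductive same_weave (g : nat) : motif -> motif -> Prop :=
| Same_homeo D D' : on_surface g D -> on_surface g D' ->
    isomorphic D D' -> same_weave g D D'
| Same_R1 D D' : on_surface g D -> on_surface g D' -> R1 D D' -> same_weave g D D'
| Same_R2 D D' : on_surface g D -> on_surface g D' -> R2 D D' -> same_weave g D D'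
| Same_R3 D D' : on_surface g D -> on_surface g D' -> R3 D D' -> same_weave g D D'
| Same_sym D D' : same_weave g D D' -> same_weave g D' D
| Same_trans D D' D'' :
    same_weave g D D' -> same_weave g D' D'' -> same_weave g D D''.

(* THE PLANES E^2 AND H^2 AND THEIR LATTICES *)

Inductive geometry := Euclidean | Hyperbolic.

Definition geometry_of (g : nat) : geometry :=
  if g == 1%N then Euclidean else Hyperbolic.

Section Plane.
Variable R : realType.

Definition point : Type := (R * R)%type.

(* The upper half-plane model for H^2. *)
Definition plane (X : geometry) : set point :=
  if X is Euclidean then setT else [set z | 0 < z.2].

Definition det2 (u v : point) : R := u.1 * v.2 - u.2 * v.1.

Definition shift_by (w z : point) : point := z + w.

(* z |-> (a z + b) / (c z + d), for A = [a b; c d] of determinant 1 *)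
Definition mobius (A : 'M[R]_2) (z : point) : point :=
  let a := A ord0 ord0 in let b := A ord0 ord_max in
  let c := A ord_max ord0 in let d := A ord_max ord_max in
  let n := (c * z.1 + d) ^+ 2 + (c * z.2) ^+ 2 in
  (((a * z.1 + b) * (c * z.1 + d) + a * c * z.2 ^+ 2) / n, z.2 / n).

(* A translation of H^2 (along a geodesic) is a hyperbolic element. *)
Definition translation_mx (A : 'M[R]_2) : Prop := \det A = 1 /\ 2 < `|\tr A|.

Inductive generated (S : set 'M[R]_2) : set 'M[R]_2 :=
| Generated_one : generated S 1%:M
| Generated_in A : S A -> generated S A
| Generated_mul A B : generated S A -> generated S B -> generated S (A *m B)
| Generated_inv A : generated S A -> generated S (invmx A).

Definition discrete_mx (G : set 'M[R]_2) : Prop :=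
  exists2 e : R, 0 < e &
    forall A, G A -> (forall i j, `|A i j - 1%:M i j| < e) -> A = 1%:M.

Definition euclidean_lattice (u v : point) : set (point -> point) :=
  [set f | exists a b : int, f = shift_by (u *~ a + v *~ b)].

Definition lattice (X : geometry) (L : set (point -> point)) : Prop :=
  match X with
  | Euclidean => exists u v, det2 u v <> 0 /\ L = euclidean_lattice u v
  | Hyperbolic => exists S : set 'M[R]_2,
      let G := generated S in
      [/\ forall A, S A -> translation_mx A,
          discrete_mx G,
          (* the quotient is a closed surface *)
          forall A z, G A -> plane Hyperbolic z -> mobius A z = z ->
            A = 1%:M \/ A = - 1%:M,
          exists K : set point, [/\ compact K, K `<=` plane Hyperbolic &
            forall z, plane Hyperbolic z -> exists2 A, G A & K (mobius A z)]
        & L = mobius @` G]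
  end.

(* LINKS IN X^2 x I
   A link in X^2 x [-1, 1] in regular position, together with its diagram in X^2:
   [arc d] parametrizes by [0, 1] the part of the link over the edge of [d],
   starting at the crossing of [d]. *)
Record lifted_link (X : geometry) := LiftedLink {
  wdart : Type;
  wdiag :> diagram wdart;
  arc : wdart -> R -> point * R;
  arc_slab : forall d t, 0 <= t <= 1 ->
    plane X (arc d t).1 /\ -1 <= (arc d t).2 <= 1;
  arc_continuous : forall d, {within `[0, 1], continuous (arc d)};
  arc_ed : forall d t, 0 <= t <= 1 -> arc (ed wdiag d) t = arc d (1 - t);
  arc_strand : forall d, arc (nx wdiag (nx wdiag d)) 0 = arc d 0;
  arc_crossing : forall d, (arc (nx wdiag d) 0).1 = (arc d 0).1;
  arc_over : forall d, over wdiag d -> (arc (nx wdiag d) 0).2 < (arc d 0).2;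
  (* distinct edges and crossings do not meet in the projection *)
  arc_edge_inj : forall d e s t, 0 < s < 1 -> 0 <= t <= 1 ->
    (arc d s).1 = (arc e t).1 -> (e = d /\ t = s) \/ (e = ed wdiag d /\ t = 1 - s);
  arc_crossing_inj : forall d e,
    (arc d 0).1 = (arc e 0).1 -> same_crossing wdiag d e;
  (* strands cross transversally, and [nx] turns counterclockwise *)
  arc_tangent : exists v : wdart -> point, forall d,
    [/\ (fun t : R => t^-1 *: ((arc d t).1 - (arc d 0).1 : R^o * R^o))
          @ 0^'+ --> (v d : R^o * R^o),
        exists2 c : R, 0 < c &
          v (nx wdiag (nx wdiag d)) = (- (c * (v d).1), - (c * (v d).2))
      & 0 < det2 (v d) (v (nx wdiag d))] }.

Definition carrier X (W : lifted_link X) : set (point * R) :=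
  [set q | exists (d : wdart W) (t : R), 0 <= t <= 1 /\ q = arc d t].

Definition slab_map (f : point -> point) (q : point * R) : point * R := (f q.1, q.2).

Definition periodic_lattice X (W : lifted_link X) (L : set (point -> point)) : Prop :=
  lattice X L /\ forall f, L f -> slab_map f @` carrier W = carrier W.

Definition carries X (W : lifted_link X) (f : point -> point) (d e : wdart W) : Prop :=
  slab_map f @` (arc d @` `[0, 1]) = arc e @` `[0, 1] /\
  slab_map f (arc d 0) = arc e 0.

(* [D] is the diagram, on the surface X^2 / L, of the link W / L. *)
Definition quotient X (W : lifted_link X) (L : set (point -> point))
    (D : motif) (p : wdart W -> D) : Prop :=
  universal_cover W D p /\
  forall d e, p d = p e <-> exists2 f, L f & carries f d e.

(* [D] is a weaving motif of W for the lattice [L], on the surface X^2 / L of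
   genus [g]. *)
Definition motif_for X (W : lifted_link X) (L : set (point -> point))
    (g : nat) (D : motif) : Prop :=
  [/\ (0 < g)%N, geometry_of g = X, periodic_lattice W L &
      exists (D0 : motif) (p : wdart W -> D0),
        [/\ quotient L p, on_surface g D0 & same_weave g D0 D]].

(* WEAVES *)

Definition unknotted_threads X (W : lifted_link X) : Prop :=
  forall (d : wdart W) k, (0 < k)%N -> ~ same_crossing W d (iter k (straight W) d).

(* The component of [d], run once in the direction of [d], is the class
   a u + b v of the fundamental group of the torus: it is homotopic to the
   (a, b)-torus knot. *)
Definition torus_class X (W : lifted_link X) (D : motif) (p : wdart W -> D)
    (u v : point) (d : wdart W) (a b : int) : Prop :=
  carries (shift_by (u *~ a + v *~ b)) d
    (iter (order (straight D) (p d)) (straight W) d).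

(* Links are not oriented, so (a, b) and (-a, -b) are the same torus knot. *)
Definition parallel X (W : lifted_link X) (D : motif) (p : wdart W -> D)
    (u v : point) (d e : wdart W) : Prop :=
  exists a b, torus_class p u v d a b /\
    (torus_class p u v e a b \/ torus_class p u v e (- a) (- b)).

(* The quadrivalent tiling of H^2 obtained by repeatedly reflecting in its sides
   a polygon P with n sides, numbered counterclockwise: [side d] is the side of P
   to which the edge of [d] folds, and [direct d] tells whether the tile on the
   left of [d] is a direct or a mirror image of P. *)
Definition kaleidoscopic T (M : diagram T) (n : nat) (side : T -> nat)
    (direct : T -> bool) : Prop :=
  [/\ (3 <= n)%N,
      forall d, (side d < n)%N,
      forall d, iter n (fc M) d = d,
      forall d, side (ed M d) = side d /\ direct (ed M d) = ~~ direct d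
    & forall d, direct (fc M d) = direct d /\
        side (fc M d) = (if direct d then ((side d).+1 %% n)%N
                         else ((side d + n).-1 %% n)%N)].

(* The direction of side i of P: all different for n odd, shared by opposite
   sides for n even. *)
Definition direction (n i : nat) : nat := if odd n then i else (i %% n./2)%N.

Definition periodic_weave X (W : lifted_link X) : Prop :=
  exists (L : set (point -> point)) (D : motif) (p : wdart W -> D) (g : nat),
    [/\ [/\ (0 < g)%N, geometry_of g = X, periodic_lattice W L,
            quotient L p & on_surface g D],
        essential D,
        unknotted_threads W
      & match X with
        | Euclidean => exists u v,
            [/\ det2 u v <> 0, L = euclidean_lattice u v,
                forall d, exists a b, coprimez a b /\ torus_class p u v d a b
              & exists d e, ~ parallel p u v d e]
        | Hyperbolic => exists n side direct,
            kaleidoscopic W n side direct /\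
            exists d e, direction n (side d) <> direction n (side e)
        end].

Definition alternating_weave X (W : lifted_link X) : Prop :=
  exists L g D, motif_for W L g D /\ alternating_diagram D.

(* A unit cell of [L'] is tiled by unit cells of [L] when the translations in
   [L'] belong to [L]. *)
Definition minimal_lattice X (W : lifted_link X) (L : set (point -> point)) : Prop :=
  periodic_lattice W L /\ forall L', periodic_lattice W L' -> L' `<=` L.

Definition minimal_motif X (W : lifted_link X) (g : nat) (D : motif) : Prop :=
  exists2 L, minimal_lattice W L & motif_for W L g D.

(* C(W): the least number of crossings of a motif for a minimal lattice (0 if
   there is no such motif). *)
Definition crossing_number X (W : lifted_link X) : nat :=
  xget 0%N [set n | (exists g D, minimal_motif W g D /\ crossings D = n) /\
                    forall g D, minimal_motif W g D -> (n <= crossings D)%N].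

End Plane.

(* Main.v *)
(* The state sum of the Kauffman bracket is restricted to the states all of whose
   circles are null-homotopic in the surface.  A local change only affects the
   circles up to homotopy, so that, with y = A^2 and up to a factor (+ or -) y^k,
   this bracket is invariant under the three moves.  The number of crossings is
   then bounded by the span of the bracket as in the proofs of Kauffman, Murasugi
   and Thistlethwaite.

   The circles are never drawn: a state is null-homotopic when every flat
   connection (with values in any group) admits a horizontal section along its
   circles, and the circles are counted by the sections with values in Z/2.

   For a reduced alternating diagram with c crossings and F regions, the two
   extreme states bound the regions.  They are the only ones to contribute to the
   extreme coefficients: a null-homotopic state with as many circles as possible,
   at one crossing from an extreme one, would show that a region of the universal
   cover meets itself at this crossing, which would be nugatory.
   So the span is at least c + F.  For any diagram with c' crossings and F'
   regions, linear algebra over Z/2 gives n + n' <= a + F' for the numbers n, n' of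
   circles of two null-homotopic states agreeing at a crossings, and the span is
   at most c' + F'.  On a surface of given genus, F - c = F' - c', hence
   c <= c'. *)
Require Import Defs.
From HB Require Import structures.
From mathcomp Require Import all_boot all_order all_algebra all_fingroup.
From mathcomp Require Import boolp ring zify.
From mathcomp Require classical_sets.
From mathcomp Require Import all_reals.
Import Order.TTheory GRing.Theory Num.Theory.
Import Defs.

Set Implicit Arguments.
Unset Strict Implicit.
Unset Printing Implicit Defensive.

(** * Smoothings and flat connections *)

(** Arbitrary groups are allowed because the two halves of the argument use different ones. The
    upper bound on the span only uses values in Z/2, but whether a region of the universal cover
    meets itself is a matter of homotopy: it is detected by the monodromy of the cover, in the group
    of permutations of a possibly infinite fibre. A connection lives on the dual graph, with the
    crossings as 2-cells, and so does not depend on the smoothing; the circles enter only through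
    the equations of a horizontal section. A local move then amounts to solving a few equations in a
    group: the same computation compares null-homotopy, over all groups, and the number of circles,
    over Z/2. The only non-local point is the second move, where frames in two regions must be
    adjusted independently. These regions are distinct because both diagrams have the same genus.
    The normalization is A^c times the Kauffman bracket, for c crossings: only powers of y = A^2
    remain, and a circle has the value -(y + 1/y). *)

Section DiagramBasics.
Variables (T : Type) (M : diagram T).

Lemma nx_inj : injective (nx M).
Proof. by move=> d e de; rewrite -(nx4 M d) de nx4. Qed.

Lemma ed_inj : injective (ed M).
Proof. exact: (can_inj (ed_invol M)). Qed.

Lemma nx_fc d : nx M (fc M d) = ed M d.
Proof. by rewrite /fc nx4. Qed.

Lemma fc_ed d : fc M (ed M d) = nx M (nx M (nx M d)).
Proof. by rewrite /fc ed_invol. Qed.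

Lemma fc_inj : injective (@fc T M).
Proof. by move=> d e /(congr1 (nx M)); rewrite !nx_fc => /ed_inj. Qed.

Lemma fc_ed_nx d : fc M (ed M (nx M d)) = d.
Proof. by rewrite fc_ed nx4. Qed.

Definition smoothing (s : T -> bool) := forall d, s (nx M d) = ~~ s d.

Lemma smoothing2 s d : smoothing s -> s (nx M (nx M d)) = s d.
Proof. by move=> sP; rewrite !sP negbK. Qed.

Lemma smoothing3 s d : smoothing s -> s (nx M (nx M (nx M d))) = ~~ s d.
Proof. by move=> sP; rewrite !sP negbK. Qed.

End DiagramBasics.

Section Connections.
Local Open Scope group_scope.
Variables (T : Type) (M : diagram T).

(* A flat connection, with values on the edges of the dual graph: [psi d] is the
   transport to the region on the left of [d] from the region on its right. *)
Definition connection (G : groupType) (psi : T -> G) : Prop :=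
  (forall d, psi (ed M d) = (psi d)^-1) /\
  (forall d, psi (nx M (nx M (nx M d))) * psi (nx M (nx M d)) * psi (nx M d)
             * psi d = 1).

(* A smoothing [s] joins [d] to [nx d] when [s d].  A horizontal section is
   given along the circles of the smoothing; [xi d] is its value on the left of
   [d], which is transported to the right of [d], i.e. to the left of [ed d]. *)
Definition horizontal (G : groupType) (s : T -> bool) (psi xi : T -> G) : Prop :=
  (forall d, xi d = psi d * xi (ed M d)) /\
  (forall d, s d -> xi (nx M d) = psi (nx M d) * xi d).

(* All the circles of the smoothing [s] are null-homotopic. *)
Definition flat (s : T -> bool) : Prop :=
  forall (G : groupType) (psi : T -> G), connection psi ->
    exists xi, horizontal s psi xi.

Lemma connection1 (G : groupType) : connection (fun=> 1 : G).
Proof. by split=> d; rewrite ?invg1 ?mulg1. Qed.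

Lemma connection_cycle (G : groupType) (psi : T -> G) d :
  psi (nx M (nx M (nx M d))) * psi (nx M (nx M d)) * psi (nx M d) * psi d = 1 ->
  psi (nx M (nx M (nx M (nx M d)))) * psi (nx M (nx M (nx M d)))
    * psi (nx M (nx M d)) * psi (nx M d) = 1.
Proof.
rewrite nx4 => /eqP; rewrite mulg_eq1 => /eqP H.
by rewrite -2!(mulgA (psi d)) H mulgV.
Qed.

Lemma connection_same_crossing (G : groupType) (psi : T -> G) d e :
  same_crossing M d e ->
  psi (nx M (nx M (nx M d))) * psi (nx M (nx M d)) * psi (nx M d) * psi d = 1 ->
  psi (nx M (nx M (nx M e))) * psi (nx M (nx M e)) * psi (nx M e) * psi e = 1.
Proof.
case=> i <- H; elim: i => //= i /connection_cycle.
by [].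
Qed.

Lemma eq_horizontal (G : groupType) s t (psi xi : T -> G) :
  s =1 t -> horizontal s psi xi -> horizontal t psi xi.
Proof. by move=> st [H1 H2]; split=> // d td; apply: H2; rewrite st. Qed.

End Connections.

(** * Circles of a smoothing *)

(** An invariant function is a free choice of one value on each component. Cardinals of sets of
    functions thus stand for numbers of circles and of regions throughout. *)
Lemma card_invariants (T A : finType) (e : rel T) : connect_sym e ->
  #|[set f : {ffun T -> A} | [forall x, forall y, e x y ==> (f x == f y)]]|
  = #|A| ^ n_comp e T.
Proof.
move=> sym_e; pose U := {x | roots e x}.
have -> : n_comp e T = #|{: U}|.
  by rewrite card_sig; apply: eq_card => x; rewrite !inE andbT.
pose h (g : {ffun U -> A}) := [ffun x => g (exist (roots e) _ (roots_root sym_e x))].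
have h_inj : injective h.
  move=> g1 g2 /ffunP eq_h; apply/ffunP=> -[x rx].
  have := eq_h x; rewrite !ffunE.
  have -> : exist (roots e) _ (roots_root sym_e x) = exist (roots e) x rx by
    apply: val_inj; apply/eqP.
  by [].
rewrite -card_ffun -(card_imset _ h_inj); apply: eq_card => f.
rewrite inE; apply/forallP/imsetP => [fP | [g _ -> x]].
  have fc x y : connect e x y -> f x = f y.
    case/connectP=> p; elim: p x => [|z p IHp] x /=; first by move=> _ ->.
    by case/andP=> exz /IHp/[apply] <-; apply/eqP/(implyP (forallP (fP x) z)).
  exists [ffun u : U => f (val u)] => //; apply/ffunP=> x; rewrite !ffunE /=.
  exact/fc/connect_root.
apply/forallP=> y; apply/implyP=> exy; rewrite !ffunE; apply/eqP; congr (g _).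
apply: val_inj => /=; exact: (fingraph.rootP sym_e (connect1 exy)).
Qed.

Lemma card_finvariants (T : finType) (h : T -> T) : injective h ->
  #|[set f : {ffun T -> 'F_2} | [forall x, f (h x) == f x]]| = 2 ^ fcard h T.
Proof.
move=> h_inj; have card2 : #|'F_2| = 2 by rewrite card_Fp.
have := card_invariants 'F_2 (fconnect_sym h_inj); rewrite card2 => <-.
apply: eq_card => f; rewrite !inE; apply/forallP/forallP => fP x; last first.
  by rewrite eq_sym; apply: (implyP (forallP (fP x) (h x))) => /=.
by apply/forallP=> z; apply/implyP=> /eqP <-; rewrite eq_sym.
Qed.

Lemma F2_cases (a : 'F_2) : a = 0%R \/ a = 1%R.
Proof. by case: a => [[|[|m]]] // lt_m; [left | right]; apply: val_inj. Qed.

Lemma F2_opp (a : 'F_2) : (- a)%R = a.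
Proof. by case: (F2_cases a) => ->; apply: val_inj. Qed.

Lemma F2_diff (a b : 'F_2) : a = b \/ a = (b + 1)%R.
Proof.
have [ab|ab] := F2_cases (a - b)%R; [left | right].
  by apply/eqP; rewrite -subr_eq0 ab.
by rewrite -ab addrC subrK.
Qed.

Section HalfCards.
Local Open Scope ring_scope.
Variables (T : finType) (A B : {set {ffun T -> 'F_2}}).

(** The part of [A] outside [B] lies in a single translate of [B]. This plays the role of one linear
    condition lowering the dimension by at most one. *)
Lemma leq_card_half :
  (forall f g, f \in A -> f \notin B -> g \in A -> g \notin B -> f - g \in B) ->
  (#|A| <= 2 * #|B|)%N.
Proof.
move=> AB; case: (boolP (A \subset B)) => [/subset_leq_card/leq_trans->//|].
  by rewrite leq_pmull.
case/subsetPn=> g gA gB.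
have /subset_leq_card : A \subset B :|: ((fun h : {ffun T -> 'F_2} => h + g) @: B).
  apply/fintype.subsetP=> f fA; rewrite inE.
  case: (boolP (f \in B)) => //= fB; apply/imsetP.
  by exists (f - g); [exact: AB | rewrite subrK].
move/leq_trans; apply; rewrite mul2n -addnn.
by rewrite (leq_trans (leq_card_setU _ _)) // leq_add2l leq_imset_card.
Qed.

Lemma card_half g : B \subset A ->
  (forall f, f \in A -> f \notin B -> f - g \in B) ->
  (forall f, f \in B -> f + g \in A :\: B) -> #|A| = (2 * #|B|)%N.
Proof.
move=> BA AB BAB; have -> : A = B :|: ((fun h : {ffun T -> 'F_2} => h + g) @: B).
  apply/setP=> f; rewrite inE; apply/idP/orP => [fA | [|/imsetP[h hB ->]]].
  - case: (boolP (f \in B)) => fB; [by left | right]; apply/imsetP.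
    by exists (f - g); [exact: AB | rewrite subrK].
  - exact: (fintype.subsetP BA).
  - by have := BAB h hB; rewrite inE => /andP[].
rewrite cardsU (card_imset _ (addIr g)) (_ : _ :&: _ = set0) ?cards0 ?subn0.
  by rewrite mul2n addnn.
apply/setP=> f; rewrite !inE; apply/negP=> /andP[fB /imsetP[h hB ef]].
by have := BAB h hB; rewrite inE -ef fB.
Qed.

End HalfCards.

Section Circles.
Variables (T : finType) (M : diagram T).
Implicit Types (s : {ffun T -> bool}) (x d : T).

Definition star x : {set T} :=
  [set z in [:: x; nx M x; nx M (nx M x); nx M (nx M (nx M x))]].

Lemma nx_neq d : nx M d != d.
Proof. by apply/eqP=> /(congr1 (over M)); rewrite over_nx; case: (over M d). Qed.

Lemma nx3_neq d : nx M (nx M (nx M d)) != d.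
Proof.
apply/eqP=> /(congr1 (over M)); rewrite !over_nx negbK; by case: (over M d).
Qed.

Lemma star_uniq x : uniq [:: x; nx M x; nx M (nx M x); nx M (nx M (nx M x))].
Proof.
have n2 d : (nx M (nx M d) == d) = false by apply/eqP/nx2_neq.
have n1 d : (nx M d == d) = false by apply/negbTE/nx_neq.
have n3 d : (nx M (nx M (nx M d)) == d) = false by apply/negbTE/nx3_neq.
rewrite /= !inE !(eq_sym x) !n1 n2 n3 (eq_sym _ (nx M (nx M x))) n1.
by rewrite (eq_sym _ (nx M (nx M (nx M x)))) n2 (eq_sym _ (nx M (nx M (nx M x)))) n1.
Qed.

Lemma card_star x : #|star x| = 4.
Proof. by rewrite cardsE (card_uniqP (star_uniq x)). Qed.

Lemma starE x z :
  (z \in star x) = [|| z == x, z == nx M x, z == nx M (nx M x) | z == nx M (nx M (nx M x))].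
Proof. by rewrite !inE. Qed.

Lemma star_id x : x \in star x.
Proof. by rewrite starE eqxx. Qed.

Lemma star_nx x z : (nx M z \in star x) = (z \in star x).
Proof.
apply/idP/idP; last first.
  by rewrite !starE => /or4P[]/eqP->; rewrite ?nx4 eqxx ?orbT.
by rewrite !starE -{1}(nx4 M x) !(inj_eq (@nx_inj _ M)) orbC -!orbA => /or4P[]/eqP->;
  rewrite eqxx ?orbT.
Qed.

Lemma star_nxl x : star (nx M x) = star x.
Proof. by apply/setP=> z; rewrite !starE nx4; do 4!case: eqP. Qed.

Lemma starP x z : reflect (same_crossing M x z) (z \in star x).
Proof.
apply: (iffP idP) => [|[i <-]]; last by elim: i => [|i] /=; rewrite ?star_id ?star_nx.
by rewrite starE => /or4P[]/eqP->; [exists 0 | exists 1 | exists 2 | exists 3].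
Qed.

Lemma order_nx x : fingraph.order (nx M) x = 4.
Proof.
have := @order_cycle _ (nx M) [:: x; nx M x; nx M (nx M x); nx M (nx M (nx M x))].
by move=> ->; rewrite ?star_uniq ?inE //= ?nx4 !eqxx.
Qed.

Lemma card_crossings (a : {pred T}) : fclosed (nx M) a -> fcard (nx M) a * 4 = #|a|.
Proof.
move=> ca; rewrite (@fcard_order_set _ _ (@nx_inj _ M) 4) //.
by apply/fintype.subsetP=> x _; rewrite inE order_nx.
Qed.

Lemma card_edges : fcard (ed M) T * 2 = #|T|.
Proof.
rewrite (@fcard_order_set _ _ (@ed_inj _ M) 2) //.
apply/fintype.subsetP=> x _; rewrite inE.
have /eqP/negbTE ne := @ed_neq _ M x.
have := @order_cycle _ (ed M) [:: x; ed M x].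
by move=> ->; rewrite ?inE /= ?ed_invol ?eqxx ?inE //= eq_sym ne.
Qed.

Definition flip x s : {ffun T -> bool} := [ffun d => (d \in star x) (+) s d].

Lemma flipE x s d : flip x s d = (d \in star x) (+) s d.
Proof. by rewrite ffunE. Qed.

Lemma flip_smoothing x s : smoothing M s -> smoothing M (flip x s).
Proof. by move=> sP d; rewrite !flipE star_nx sP addbN. Qed.

Lemma flipK x : involutive (flip x).
Proof. by move=> s; apply/ffunP=> d; rewrite !flipE addbA addbb. Qed.

Definition joined s : rel T := fun d e =>
  [|| e == ed M d, s d && (e == nx M d) | s e && (d == nx M e)].

Definition circles s := n_comp (joined s) T.

(** A coloring is also the chain mod 2 formed by the circles of colour 1; it is in this guise that
    it is later paired with cocycles. *)
Definition colorings s : {set {ffun T -> 'F_2}} :=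
  [set f : {ffun T -> 'F_2} | [forall d, (f d == f (ed M d)) && (s d ==> (f (nx M d) == f d))]].

Lemma coloringsP s (f : {ffun T -> 'F_2}) :
  reflect ((forall d, f d = f (ed M d)) /\ (forall d, s d -> f (nx M d) = f d))
          (f \in colorings s).
Proof.
rewrite inE; apply: (iffP forallP) => [fP | [f1 f2] d].
  by split=> d => [|sd]; have /andP[/eqP-> /implyP f2] := fP d => //; apply/eqP/f2.
by rewrite -f1 eqxx; apply/implyP=> /f2->.
Qed.

Lemma col_horizontal s (f : {ffun T -> 'F_2}) :
  reflect (horizontal M s (fun=> 1%g : 'F_2) f) (f \in colorings s).
Proof.
apply: (iffP (coloringsP s f)) => -[f1 f2]; split=> d; first by rewrite mul1g.
- by move/f2->; rewrite mul1g.
- by rewrite {1}f1 mul1g.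
- by move/f2; rewrite mul1g.
Qed.

Lemma joined_sym s : connect_sym (joined s).
Proof.
apply: sym_connect_sym => d e; rewrite /joined; congr (_ || _); last by rewrite orbC.
by apply/eqP/eqP=> ->; rewrite ed_invol.
Qed.

Lemma card_col s : #|colorings s| = 2 ^ circles s.
Proof.
have card2 : #|'F_2| = 2 by rewrite card_Fp.
have := card_invariants 'F_2 (joined_sym s); rewrite card2 => <-.
apply: eq_card => f; apply/coloringsP/idP => [[f1 f2] | ].
  rewrite inE; apply/forallP=> d; apply/forallP=> e; apply/implyP.
  by case/or3P=> [/eqP->|/andP[sd /eqP->]|/andP[se /eqP->]]; rewrite -?f1 ?f2.
rewrite inE => /forallP fP; split=> [d|d sd]; apply/eqP.
  by apply: (implyP (forallP (fP d) (ed M d))); rewrite /joined eqxx.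
rewrite eq_sym; apply: (implyP (forallP (fP d) (nx M d))).
by rewrite /joined sd eqxx orbT.
Qed.

End Circles.

Arguments coloringsP {T M s f}.
Arguments col_horizontal {T M s f}.

(** * Changing the smoothing at one crossing *)

Section Flips.
Local Open Scope group_scope.
Variables (T : finType) (M : diagram T).
Implicit Types (s : {ffun T -> bool}) (x d : T).

Definition join (G : groupType) (psi xi : T -> G) d :=
  xi (nx M d) = psi (nx M d) * xi d.

(** The transport around a crossing is trivial, so three of the four equations around it compose to
    the fourth. *)
Lemma join3 (G : groupType) (psi xi : T -> G) d : connection M psi ->
  join psi xi d -> join psi xi (nx M d) -> join psi xi (nx M (nx M d)) ->
  join psi xi (nx M (nx M (nx M d))).
Proof.
move=> [_ /(_ d)]; rewrite /join nx4 => H J0 J1 J2; rewrite J2 J1 J0 !mulgA.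
by have := connection_cycle H; rewrite nx4 => ->; rewrite mul1g.
Qed.

(* The circles in [C] are disjoint from the others, so that a section can be
   multiplied on them by a constant. *)
Lemma horizontal_twist (G : groupType) s (C : pred T) (psi xi : T -> G) (k : G) :
  (forall d, C (ed M d) = C d) -> (forall d, s d -> C (nx M d) = C d) ->
  horizontal M s psi xi ->
  horizontal M s psi (fun d => if C d then xi d * k else xi d).
Proof.
move=> C1 C2 [H1 H2]; split=> d => [|sd]; rewrite ?C1 ?C2 //.
  by case: ifP => _; rewrite {1}H1 ?mulgA.
by case: ifP => _; rewrite H2 ?mulgA.
Qed.

(** The flipped smoothing asks for two equations at the crossing: one is the hypothesis [join], the
    other follows from it and the two equations of [s] by [join3]. *)
Lemma horizontal_flip (G : groupType) s x (psi xi : T -> G) :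
  connection M psi -> smoothing M s -> s x -> horizontal M s psi xi ->
  join psi xi (nx M x) -> horizontal M (flip M x s) psi xi.
Proof.
move=> cpsi sP sx [H1 H2] J; split=> // d; rewrite flipE.
case: (boolP (d \in star M x)) => [|_ /H2//]; rewrite starE.
have J3 : join psi xi (nx M (nx M (nx M x))).
  by apply: join3 => //; [exact: H2 | apply: H2; rewrite smoothing2].
by case/or4P=> /eqP->; rewrite ?smoothing2 ?sx.
Qed.

Lemma horizontal_flip_joined (G : groupType) s x (psi xi : T -> G) :
  connection M psi -> smoothing M s -> s x -> horizontal M (flip M x s) psi xi ->
  join psi xi x -> horizontal M s psi xi.
Proof.
move=> cpsi sP sx H J.
(* The dart preceding [x] is joined to [x] by the flipped smoothing, so [horizontal_flip] applies
   with the two smoothings exchanged. *)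
have [d0 Hd] : exists d, d = nx M (nx M (nx M x)) by eexists.
have ex : nx M d0 = x by rewrite Hd nx4.
have e0 : d0 \in star M x by rewrite Hd starE eqxx !orbT.
have f0 : flip M x s d0 by rewrite flipE e0 Hd smoothing3 // sx.
have := @horizontal_flip G (flip M x s) d0 psi xi cpsi (flip_smoothing x sP) f0 H.
rewrite ex => /(_ J); apply: eq_horizontal => d; rewrite !flipE addbA.
suff -> : star M d0 = star M x by rewrite addbb.
apply/setP=> z; rewrite Hd !starE !nx4; do 4!case: eqP => //.
Qed.

Section Separated.
Variables (s : {ffun T -> bool}) (x : T) (C : pred T).
Hypotheses (sP : smoothing M s) (sx : s x).
Hypotheses (C1 : forall d, C (ed M d) = C d) (C2 : forall d, s d -> C (nx M d) = C d).
Hypotheses (Cx : C x) (Cnx : ~~ C (nx M (nx M x))).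

(** The two arcs at [x] lie on different circles, which the flip merges. The section on the circles
    in [C] may be multiplied on the right by a constant, and [k] is the one that makes the equation
    at [nx M x] hold. *)
Lemma flat_flip_separated : flat M s -> flat M (flip M x s).
Proof.
move=> fs G psi cpsi; have [xi Hxi] := fs G psi cpsi.
pose k := (psi (nx M (nx M x)) * xi (nx M x))^-1 * xi (nx M (nx M x)).
exists (fun d => if C d then xi d * k else xi d).
apply: horizontal_flip => //; first exact: horizontal_twist.
by rewrite /join (negbTE Cnx) C2 // Cx mulgA /k mulVKg.
Qed.

(* A circle through [x] whose equation follows from those of the flipped
   smoothing is split off by the smoothing [s]. *)
Hypothesis loop : forall (G : groupType) (psi xi : T -> G), connection M psi ->
  horizontal M (flip M x s) psi xi -> join psi xi x.

Lemma flat_flip_loop : flat M s <-> flat M (flip M x s).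
Proof.
split=> [|fs G psi cpsi]; first exact: flat_flip_separated.
have [xi Hxi] := fs G psi cpsi; exists xi.
exact: (horizontal_flip_joined cpsi sP sx Hxi (loop cpsi Hxi)).
Qed.

(** Adding the indicator [g] of [C] exchanges the colorings of [s] that agree on the two arcs at [x]
    with those that do not; the former are the colorings of the flipped smoothing. *)
Lemma circles_flip_loop : circles M s = (circles M (flip M x s)).+1.
Proof.
apply/eqP; rewrite -(eqn_exp2l _ _ (isT : 1 < 2)) expnS -!card_col; apply/eqP.
pose g : {ffun T -> 'F_2} := [ffun d => (C d)%:R%R].
have loop2 (f : {ffun T -> 'F_2}) : f \in colorings M (flip M x s) -> f (nx M x) = f x.
  move/col_horizontal => /(loop (connection1 _ _)).
  by rewrite /join mul1g.
apply: (@card_half _ _ _ g) => [|f fs ff|f].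
- apply/fintype.subsetP=> f ff; apply/col_horizontal.
  move/col_horizontal: (ff) => H.
  by apply: (horizontal_flip_joined _ sP sx H (loop _ H)); apply: connection1.
- have [f1 f2] := coloringsP fs.
  have fgs : (f - g)%R \in colorings M s.
    by apply/coloringsP; split=> [d|d sd]; rewrite !ffunE ?C1 ?C2 -?f1 ?f2.
  apply/col_horizontal; apply: horizontal_flip (elimT col_horizontal fgs) _ => //.
    exact: connection1.
  rewrite /join mul1g !ffunE (negbTE Cnx) C2 // Cx.
  have [fe|//] := F2_diff (f (nx M (nx M x))) (f (nx M x)); last first.
    by move=> ->; rewrite oppr0 addr0 F2_opp.
  case/negP: ff; apply/col_horizontal/horizontal_flip=> //; first exact: connection1.
    exact/col_horizontal.
  by rewrite /join mul1g.
move=> ff; have [f1 f2] := coloringsP ff.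
have fs : f \in colorings M s.
  move/col_horizontal: (ff) => H; apply/col_horizontal.
  by apply: (horizontal_flip_joined _ sP sx H (loop _ H)); apply: connection1.
have [f3 f4] := coloringsP fs.
rewrite inE; apply/andP; split; last first.
  by apply/coloringsP; split=> [d|d sd]; rewrite !ffunE ?C1 ?C2 -?f3 ?f4.
apply/negP=> /coloringsP[_ /(_ (nx M x))]; rewrite flipE star_nx star_id sP sx => /(_ isT).
rewrite !ffunE (negbTE Cnx) C2 // Cx f2 ?flipE ?star_nx ?star_id ?sP ?sx //.
by move/eqP; rewrite addr0 -subr_eq0 opprD addrA subrr sub0r oppr_eq0 oner_eq0.
Qed.

End Separated.

Lemma col_flip s x (f : {ffun T -> 'F_2}) : smoothing M s -> s x -> f \in colorings M s ->
  (f \in colorings M (flip M x s)) = (f (nx M (nx M x)) == f x).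
Proof.
move=> sP sx fs; have [f1 f2] := coloringsP fs; apply/idP/eqP => [/coloringsP[_ H]|e].
  by rewrite H ?f2 // flipE star_nx star_id sP sx.
apply/col_horizontal/horizontal_flip => //; first exact: connection1.
  exact/col_horizontal.
by rewrite /join mul1g e f2.
Qed.

Lemma card_col_common s x : smoothing M s -> s x ->
  #|colorings M s| <= 2 * #|colorings M s :&: colorings M (flip M x s)|.
Proof.
move=> sP sx; apply: leq_card_half => f g fs; rewrite inE fs (col_flip sP sx fs) => /= nf.
move=> gs; rewrite inE gs (col_flip sP sx gs) => /= ng.
have fgs : (f - g)%R \in colorings M s.
  have [f1 f2] := coloringsP fs; have [g1 g2] := coloringsP gs.
  by apply/coloringsP; split=> [d|d sd]; rewrite !ffunE -?f1 -?g1 ?f2 ?g2.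
rewrite inE fgs (col_flip sP sx fgs) !ffunE.
have [/eqP|->] := F2_diff (f (nx M (nx M x))) (f x); first by rewrite (negbTE nf).
have [/eqP|->] := F2_diff (g (nx M (nx M x))) (g x); first by rewrite (negbTE ng).
by rewrite opprD addrACA subrr addr0 eqxx.
Qed.

Lemma smoothing_true s x : smoothing M s ->
  exists2 y, s y & star M y = star M x.
Proof.
move=> sP; case: (boolP (s x)) => sx; first by exists x.
exists (nx M x); first by rewrite sP.
exact: star_nxl.
Qed.

Lemma flip_star s x y : star M x = star M y -> flip M x s = flip M y s.
Proof. by move=> e; apply/ffunP=> d; rewrite !flipE e. Qed.

Lemma circles_flip s x : smoothing M s -> circles M (flip M x s) <= (circles M s).+1.
Proof.
move=> sP; set t := flip M x s; have tP : smoothing M t by apply: flip_smoothing.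
have [y ty ey] := smoothing_true x tP.
have es : s = flip M y t by rewrite (flip_star _ ey) flipK.
rewrite -(leq_exp2l _ _ (isT : 1 < 2)) expnS -!card_col.
rewrite (leq_trans (card_col_common tP ty)) // leq_mul2l -es.
by rewrite subset_leq_card ?orbT ?subsetIr.
Qed.

(** The flipped smoothing has more colorings than [s], so one of them violates an equation of [s] at
    [x]: it gives different colours to the two new arcs. *)
Lemma circles_flip_max s x : smoothing M s -> s x ->
  circles M (flip M x s) = (circles M s).+1 ->
  exists2 f, f \in colorings M (flip M x s) & f (nx M (nx M x)) != f x.
Proof.
move=> sP sx /(congr1 (expn 2)); rewrite expnS -!card_col => H.
case: (boolP (colorings M (flip M x s) \subset colorings M s)).
  move/subset_leq_card; rewrite H leqNgt ltn_Pmull // card_col expn_gt0 //.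
case/subsetPn=> f ff; have tP := flip_smoothing x sP.
have tx : flip M x s (nx M x) by rewrite flipE star_nx star_id sP sx.
have ex := star_nxl M x.
have [_ f2] := coloringsP ff.
have := col_flip tP tx ff; rewrite (flip_star _ ex) flipK => -> nf; exists f => //.
have e1 : f (nx M (nx M x)) = f (nx M x) by apply: f2.
have e2 : f x = f (nx M (nx M (nx M x))).
  by have := f2 (nx M (nx M (nx M x))); rewrite nx4; apply; rewrite smoothing3 // flipE star_id sx.
by rewrite e1 e2 eq_sym.
Qed.

End Flips.

(** * Erasing crossings *)

(* The crossings of [M'] erased in [M] form a tangle: an [outer] dart leaves it,
   an [inner] one is an end of one of its edges.  The strand of the outer dart
   [z] crosses the tangle and leaves it at [through z]. *)
Section Erasure.
Local Open Scope group_scope.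
Variables (T T' : finType) (M : diagram T) (M' : diagram T') (i : T -> T').
Variables (outer inner : pred T').

Definition through z := nx M' (nx M' (ed M' (nx M' (nx M' z)))).

Hypotheses (i_inj : injective i)
  (i_kept : forall z, (exists c, i c = z) <-> ~~ (outer z || inner z))
  (i_nx : forall c, i (nx M c) = nx M' (i c))
  (i_path : forall c, exists k,
     let follow j := iter j (fun z => ed M' (nx M' (nx M' z))) (ed M' (i c)) in
     follow k = i (ed M c) /\
     (forall j, (j < k)%N -> outer (follow j) || inner (follow j)))
  (i_exit : forall z, outer z || inner z ->
     exists k, ~~ (outer (iter k (straight M') z) || inner (iter k (straight M') z)))
  (outer_nx2 : forall z, outer z -> inner (nx M' (nx M' z)))
  (inner_nx2 : forall z, inner z -> outer (nx M' (nx M' z)))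
  (inner_ed : forall z, inner z -> inner (ed M' z))
  (outerN : forall z, outer z -> ~~ inner z).

(* The first dart kept in [M] met when leaving along the edge of [z]. *)
Inductive first z c : Prop :=
| First_kept : ed M' z = i c -> first z c
| First_through : outer (ed M' z) -> first (through (ed M' z)) c -> first z c.

Lemma kept c : ~~ (outer (i c) || inner (i c)).
Proof. by apply/i_kept; exists c. Qed.

Lemma not_outer_kept c : ~~ outer (i c).
Proof. by have := kept c; rewrite negb_or => /andP[]. Qed.

Lemma not_inner_kept c : ~~ inner (i c).
Proof. by have := kept c; rewrite negb_or => /andP[]. Qed.

Lemma outer_through z : outer z -> outer (through z).
Proof. by move=> oz; apply/inner_nx2/inner_ed/outer_nx2. Qed.

Lemma throughK z : through (through z) = z.
Proof. by rewrite /through nx4 ed_invol nx4. Qed.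

Lemma not_inner_ed z : ~~ inner z -> ~~ inner (ed M' z).
Proof. by apply: contra => /inner_ed; rewrite ed_invol. Qed.

Lemma first_fun z c c' : first z c -> first z c' -> c = c'.
Proof.
elim=> {}z {}c => [e|oz _ IH] [e'|oz' H]; last exact: IH.
- by apply: i_inj; rewrite -e.
- by move: oz'; rewrite e (negbTE (not_outer_kept c)).
- by move: oz; rewrite e' (negbTE (not_outer_kept c')).
Qed.

(** Each passage of the strand through the tangle takes exactly two steps, across a crossing to an
    inner edge and across a crossing out of it; the induction consumes the path two steps at a time.
    A path of length 1 would stop at an inner dart, which is not kept. *)
Lemma first_path c : first (i c) (ed M c).
Proof.
have [k []] := i_path c; have := not_inner_kept c; move: (i c) => z.
have [m] := ubnP k; elim: m z k => // m IHm z [|[|k]] lekm nz.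
- by move=> e _; apply: First_kept.
- move=> e /(_ 0 isT) /=; rewrite (negbTE (not_inner_ed nz)) orbF => oz.
  by case/negP: (not_inner_kept (ed M c)); rewrite -e; apply/inner_ed/outer_nx2.
move=> e H; have := H 0 isT; rewrite /= (negbTE (not_inner_ed nz)) orbF => oz.
apply: First_through => //; apply: (IHm _ k).
- by rewrite -ltnS ltnW.
- exact/outerN/outer_through.
- by rewrite -e !iterSr.
by move=> j ltjk; have := H j.+2 ltjk; rewrite !iterSr.
Qed.

(** The existence of an exit, which excludes that all crossings of a component are erased, bounds
    the number of passages through the tangle. *)
Lemma first_exists z : outer z -> exists c, first z c.
Proof.
move=> oz; have [k] : exists k, ~~ (outer (iter k (straight M') z) || inner (iter k (straight M') z)).
  by apply: i_exit; rewrite oz.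
have [m] := ubnP k; elim: m z k oz => // m IHm z [|[|k]] oz lekm.
- by rewrite /= oz.
- rewrite /= negb_or /straight => /andP[nio nii].
  have : ~~ (outer (ed M' z) || inner (ed M' z)).
    apply/negP=> /orP[/outer_nx2|/inner_nx2]; first by rewrite (negbTE nii).
    by rewrite (negbTE nio).
  by move/i_kept=> [c e]; exists c; apply: First_kept.
rewrite !iterSr => H; case: (boolP (outer (ed M' z) || inner (ed M' z))); last first.
  by move/i_kept=> [c e]; exists c; apply: First_kept.
rewrite (negbTE (not_inner_ed (outerN oz))) orbF => oez.
have ltkm : k < m by rewrite -ltnS ltnW.
have [c Hc] := IHm _ _ (outer_through oez) ltkm H.
by exists c; apply: First_through.
Qed.

(** Leaving the tangle along the same strand in the two opposite directions leads to the two ends of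
    one edge of [M]. *)
Lemma first_through_rev z c : outer z -> first z c -> first (through z) (ed M c).
Proof.
move=> oz H; elim: H oz => {}z {}c => [e oz|oez _ IH oz].
  case: (first_path c); rewrite -e ed_invol => // e'.
  by have := not_outer_kept (ed M c); rewrite -e' oz.
have := IH (outer_through oez); rewrite throughK; case; rewrite ed_invol // => e'.
by have := not_outer_kept (ed M c); rewrite -e' oz.
Qed.

Section Extension.
Variables (A : Type) (j : A -> A).
Hypothesis jK : involutive j.

(** [j] is the effect on the data of a dart of reversing its edge: inversion for a connection, [J]
    for a connection together with a section, the exchange of two sides for functions on regions,
    the identity for colorings. The rule propagates along the strand up to the first kept dart. *)
Lemma first_value (F : T' -> A) z c :
  (forall z, ~~ inner z -> F (ed M' z) = j (F z)) ->
  (forall z, outer z -> F (through z) = j (F z)) ->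
  first z c -> ~~ inner z -> F (i c) = j (F z).
Proof.
move=> F1 F2; elim=> {}z {}c => [<- /F1//|oz _ IH nz].
by rewrite IH ?F2 ?F1 ?jK //; apply/outerN/outer_through.
Qed.

Lemma restrict_ed (F : T' -> A) c :
  (forall z, ~~ inner z -> F (ed M' z) = j (F z)) ->
  (forall z, outer z -> F (through z) = j (F z)) ->
  F (i (ed M c)) = j (F (i c)).
Proof.
move=> F1 F2; apply: (first_value F1 F2 (first_path c)).
exact: not_inner_kept.
Qed.

Lemma extend_kept (F : T -> A) : (forall c, F (ed M c) = j (F c)) ->
  exists F' : T' -> A, [/\ forall c, F' (i c) = F c,
    forall z, ~~ inner z -> F' (ed M' z) = j (F' z)
    & forall z, outer z -> F' (through z) = j (F' z)].
Proof.
move=> FP.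
have first_ex z : ~~ inner z -> exists c, first z c.
  case: (boolP (outer z)) => [/first_exists//|noz niz].
  have /i_kept[c <-] : ~~ (outer z || inner z) by rewrite negb_or noz.
  by exists (ed M c); apply: first_path.
have /choice[F' F'P] (z : T') : exists a, ~~ inner z -> exists2 c, first z c & a = j (F c).
  case: (boolP (inner z)) => [/inner_nx2/first_exists[c _]|/first_ex[c Hc]].
    (* Inner darts are subject to no condition, and a kept dart supplies an element of [A]. *)
    by exists (F c).
  by exists (j (F c)) => _; exists c.
exists F'; split=> [c|z nz|z oz].
- have [c' Hc' ->] := F'P _ (not_inner_kept c).
  by rewrite (first_fun Hc' (first_path c)) FP jK.
- have nez := not_inner_ed nz.
  have [c Hc ->] := F'P _ nz; have [c' Hc' ->] := F'P _ nez; rewrite -[j (F c)]FP; congr (j (F _)).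
  case: (boolP (outer (ed M' z))) Hc' => [oz Hc'|noz Hc'].
    case: Hc => [e|_ Hc]; first by move: oz; rewrite e (negbTE (not_outer_kept c)).
    apply: first_fun Hc' _; rewrite -(throughK (ed M' z)).
    by apply: first_through_rev => //; apply: outer_through.
  have /i_kept[c0 e0] : ~~ (outer (ed M' z) || inner (ed M' z)).
    by rewrite negb_or noz.
  rewrite -e0 in Hc'; rewrite (first_fun Hc' (first_path c0)); congr (ed M _).
  by apply: first_fun Hc; apply: First_kept.
have nz := outerN oz; have ntz := outerN (outer_through oz).
have [c Hc ->] := F'P _ nz; have [c' Hc' ->] := F'P _ ntz.
by rewrite -[j (F c)]FP (first_fun Hc' (first_through_rev oz Hc)).
Qed.

End Extension.

(* Smoothings of [M'] which, up to homotopy, let the strands pass through the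
   erased crossings without meeting. *)
Variables (s : {ffun T -> bool}) (s' : {ffun T' -> bool}).
Hypothesis ss' : forall c, s c = s' (i c).

(** After the erasure, [z] and [through z] point to the two ends of one edge, so they must carry
    inverse values. *)
Definition through_connection (G : groupType) (psi : T' -> G) :=
  connection M' psi /\ forall z, outer z -> psi (through z) = (psi z)^-1.

Hypothesis gauge : forall (G : groupType) (psi : T' -> G), connection M' psi ->
  exists2 psi', through_connection psi' &
    (exists xi : T' -> G, horizontal M' s' psi' xi) ->
    exists xi : T' -> G, horizontal M' s' psi xi.
Hypothesis lift_connection : forall (G : groupType) (psi : T -> G) (F : T' -> G),
  connection M psi -> (forall c, F (i c) = psi c) ->
  (forall z, ~~ inner z -> F (ed M' z) = (F z)^-1) ->
  (forall z, outer z -> F (through z) = (F z)^-1) ->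
  exists2 psi', through_connection psi' & forall c, psi' (i c) = psi c.
Hypothesis pass : forall (G : groupType) (psi xi : T' -> G), through_connection psi ->
  horizontal M' s' psi xi -> forall z, outer z -> xi z = psi z * xi (through z).
Hypothesis fill : forall (G : groupType) (psi xi : T' -> G), through_connection psi ->
  (forall z, ~~ inner z -> xi z = psi z * xi (ed M' z)) ->
  (forall z, outer z -> xi z = psi z * xi (through z)) ->
  (forall c, s c -> xi (i (nx M c)) = psi (i (nx M c)) * xi (i c)) ->
  exists2 xi', horizontal M' s' psi xi' & forall c, xi' (i c) = xi (i c).
Hypothesis fill_inj : forall f g : {ffun T' -> 'F_2},
  f \in colorings M' s' -> g \in colorings M' s' ->
  (forall z, ~~ inner z -> f z = g z) -> f = g.

(** Turns the values of a connection and of a horizontal section at one end of an edge into those at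
    the other end. *)
Let J (G : groupType) (a : G * G) := (a.1^-1, a.1^-1 * a.2).

Lemma J_inv (G : groupType) : involutive (@J G).
Proof. by case=> a b; rewrite /J /= invgK mulVKg. Qed.

Lemma J_step (G : groupType) (psi xi : T' -> G) z w :
  psi w = (psi z)^-1 -> xi z = psi z * xi w ->
  (psi w, xi w) = J (psi z, xi z).
Proof. by move=> e1 e2; rewrite /J /= e1 e2 mulKg. Qed.

Lemma horizontal_restrict (G : groupType) (psi xi : T' -> G) :
  through_connection psi -> horizontal M' s' psi xi ->
  horizontal M s (psi \o i) (xi \o i).
Proof.
move=> [cpsi tpsi] H; have [H1 H2] := H; split=> /= [d|d sd]; last first.
  by rewrite i_nx H2 // -ss'.
have [] : (psi (i (ed M d)), xi (i (ed M d))) = J (psi (i d), xi (i d)).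
  apply: (@restrict_ed _ (@J G) (@J_inv G) (fun z => (psi z, xi z))) => [z _|z oz].
    by apply: J_step; [apply: cpsi.1 | apply: H1].
  by apply: J_step; [apply: tpsi | apply: pass].
by move=> _ ->; rewrite mulVKg.
Qed.

Lemma restrict_connection (G : groupType) (psi : T' -> G) :
  through_connection psi -> connection M (psi \o i).
Proof.
move=> [[c1 c2] tpsi]; split=> d /=; last by rewrite !i_nx c2.
by rewrite (@restrict_ed _ _ invgK psi) // => z _; apply: c1.
Qed.

Lemma horizontal_extend (G : groupType) (psi : T' -> G) (xi : T -> G) :
  through_connection psi -> horizontal M s (psi \o i) xi ->
  exists2 xi', horizontal M' s' psi xi' & forall c, xi' (i c) = xi c.
Proof.
move=> tpsi [H1 H2]; have [[c1 _] t1] := tpsi.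
have [cpsi1 _] := restrict_connection tpsi.
have [|F [F1 F2 F3]] := @extend_kept _ _ (@J_inv G) (fun c => (psi (i c), xi c)).
  by move=> c; rewrite /J /= -[psi _]/((psi \o i) _) cpsi1 (H1 c) /= mulKg.
have F0 z : ~~ inner z -> (F z).1 = psi z.
  move=> nz; have [c Hc] : exists c, first z c.
    case: (boolP (outer z)) => [/first_exists//|noz].
    have /i_kept[c <-] : ~~ (outer z || inner z) by rewrite negb_or noz.
    by exists (ed M c); apply: first_path.
  have e1 := first_value (@J_inv G) F2 F3 Hc nz.
  have := first_value invgK (fun z _ => c1 z) t1 Hc nz.
  by move: e1; rewrite F1 => -[-> _] /invg_inj.
have [z nz|z oz|c sc|xi' Hxi' e] := fill (xi := fun z => (F z).2) tpsi.
- by rewrite F2 // /J /= F0 // mulVKg.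
- by rewrite F3 // /J /= F0 ?mulVKg //; apply: outerN.
- by rewrite !F1 /= H2.
by exists xi' => // c; rewrite e F1.
Qed.

(** Connections on the two diagrams correspond once they are normalized on the strands by [gauge];
    sections then restrict thanks to [pass] and extend over the tangle by [fill]. *)
Lemma erased_flat : flat M' s' <-> flat M s.
Proof.
split=> fs G psi cpsi.
  have [c1 _] := cpsi.
  have [F [F1 F2 F3]] := extend_kept invgK c1.
  have [psi' tpsi' e] := lift_connection cpsi F1 F2 F3.
  have [xi Hxi] := fs G psi' tpsi'.1.
  have [h1 h2] := horizontal_restrict tpsi' Hxi.
  exists (xi \o i); split=> d; rewrite -e; first exact: h1.
  exact: h2.
have [psi' tpsi' back] := gauge cpsi; apply: back.
have [xi Hxi] := fs G _ (restrict_connection tpsi').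
by have [xi'] := horizontal_extend tpsi' Hxi; exists xi'.
Qed.

Lemma through_connection1 (G : groupType) : through_connection (fun=> 1 : G).
Proof. by split=> [|z _]; [apply: connection1 | rewrite invg1]. Qed.

Lemma erased_circles : circles M' s' = circles M s.
Proof.
apply/eqP; rewrite -(eqn_exp2l _ _ (isT : 1 < 2)%N) -!card_col; apply/eqP.
pose r (f : {ffun T' -> 'F_2}) := [ffun c => f (i c)].
have r_inj : {in colorings M' s' &, injective r}.
  move=> f g fs gs /ffunP fg; apply: (fill_inj fs gs) => z nz.
  have [c Hc] : exists c, first z c.
    case: (boolP (outer z)) => [/first_exists//|noz].
    have /i_kept[c <-] : ~~ (outer z || inner z) by rewrite negb_or noz.
    by exists (ed M c); apply: first_path.
  have val (h : {ffun T' -> 'F_2}) : h \in colorings M' s' -> h (i c) = h z.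
    move=> hs; have [h1 _] := coloringsP hs.
    apply: (@first_value _ (@id 'F_2) _ h z c) => // w ow.
    have := pass (through_connection1 _) (elimT col_horizontal hs) ow.
    by rewrite mul1g.
  by rewrite -(val f) // -(val g) //; have := fg c; rewrite !ffunE.
rewrite -(card_in_imset r_inj); apply: eq_card => f; apply/imsetP/idP.
  case=> g gs ->; have [h1 h2] := horizontal_restrict (through_connection1 _)
    (elimT col_horizontal gs).
  by apply/col_horizontal; split=> d; rewrite !ffunE; [apply: h1 | apply: h2].
move/col_horizontal => fs.
have [xi Hxi e] := horizontal_extend (through_connection1 _) fs.
exists [ffun z => xi z]; last by apply/ffunP=> c; rewrite !ffunE e.
have [h1 h2] := Hxi; apply/col_horizontal.
by split=> d; rewrite !ffunE; [apply: h1 | apply: h2].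
Qed.

End Erasure.

(** * The bracket *)

Section Bracket.
Local Open Scope ring_scope.
Variables (K : comNzRingType) (y y' : K).
Hypothesis yy' : y * y' = 1.

Section Sum.
Variables (T : finType) (M : diagram T).
Implicit Types (s : {ffun T -> bool}).

Definition smoothings : {set {ffun T -> bool}} :=
  [set s : {ffun T -> bool} | [forall d, s (nx M d) == ~~ s d]].

Lemma smoothingsP s : reflect (smoothing M s) (s \in smoothings).
Proof.
by rewrite inE; apply: (iffP forallP) => H d; [apply/eqP | apply/eqP]; apply: H.
Qed.

(* The number of A-smoothed crossings; a crossing has four darts. *)
Definition a_count s : nat := (#|[set d | s d == over M d]| %/ 4)%N.

Definition loop_value : K := - (y + y').

Definition weight s : K :=
  if `[< flat M s >] then y ^+ a_count s * loop_value ^+ circles M s else 0.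

(* The Kauffman bracket, in the variable y = A^2 and normalized, of which only
   the states without essential circle are kept. *)
Definition bracket : K := \sum_(s in smoothings) weight s.

Lemma a_count_flip s x : smoothing M s -> s x = over M x ->
  a_count s = (a_count (flip M x s)).+1.
Proof.
move=> sP sx; have S4 n : ((n %/ 4).+1 = (n + 4) %/ 4)%N by rewrite divnDr // addn1.
rewrite /a_count S4; congr (_ %/ 4)%N.
have sover z : z \in star M x -> s z == over M z.
  by rewrite starE => /or4P[]/eqP->; rewrite ?sP ?over_nx sx eqxx.
rewrite -(cardsID (star M x)) addnC -[in RHS](card_star M x); congr (_ + _)%N.
- apply: eq_card => z; rewrite !inE -starE flipE.
  case: (boolP (z \in star M x)) => //= /sover/eqP->.
  by case: (over M z).
by apply: eq_card => z; rewrite !inE -starE andbC; case: (boolP (z \in _)) => //= /sover.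
Qed.

Lemma a_count_flipN s x : smoothing M s -> s x = ~~ over M x ->
  a_count (flip M x s) = (a_count s).+1.
Proof.
move=> sP sx; rewrite -{2}(flipK M x s); apply: a_count_flip; first exact: flip_smoothing.
by rewrite flipE star_id sx /= negbK.
Qed.

Lemma flip_smoothings x s : (flip M x s \in smoothings) = (s \in smoothings).
Proof.
apply/smoothingsP/smoothingsP => [/(flip_smoothing x)|/flip_smoothing//].
by rewrite flipK.
Qed.

Lemma loop_valueE : y * loop_value = - (y ^+ 2 + 1).
Proof. by rewrite /loop_value mulrN mulrDr yy' expr2. Qed.

(** With d the value of a circle, the three weights are y^(b+1) d^(n+1), y^b d^n and y^(b+2) d^n,
    and their sum vanishes because y d = -(y^2 + 1). The condition on [p] and [q] says that [s] is
    the A-smoothing at exactly one of them, so that the two flips change the A-count in opposite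
    directions. *)
Lemma weight_flip_loops s p q : smoothing M s -> s p (+) s q = ~~ (over M p (+) over M q) ->
  (flat M s <-> flat M (flip M p s)) -> circles M s = (circles M (flip M p s)).+1 ->
  (flat M s <-> flat M (flip M q s)) -> circles M s = (circles M (flip M q s)).+1 ->
  weight s + weight (flip M p s) + weight (flip M q s) = 0.
Proof.
move=> sP neq fp cp fq cq.
have ecpq : circles M (flip M p s) = circles M (flip M q s).
  by apply: succn_inj; rewrite -cp -cq.
rewrite /weight -(asbool_equiv_eq fp) -(asbool_equiv_eq fq); case: asboolP => _; last by rewrite !addr0.
have key b n : y ^+ b.+1 * loop_value ^+ n.+1 + y ^+ b * loop_value ^+ n
  + y ^+ b.+2 * loop_value ^+ n = 0.
  have -> : y ^+ b.+1 * loop_value ^+ n.+1 = y ^+ b * loop_value ^+ n * (y * loop_value).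
    by rewrite !exprS; ring.
  by rewrite loop_valueE !exprS; ring.
rewrite -ecpq cp; case: (boolP (s p == over M p)) => [/eqP sp|sp].
  have sq : s q = ~~ over M q.
    by move: neq; rewrite sp; case: (over M p); case: (over M q); case: (s q).
  rewrite (a_count_flipN sP sq) (a_count_flip sP sp). exact: key.
have sp' : s p = ~~ over M p by move: sp; case: (s p); case: (over M p).
have sq : s q = over M q.
  by move: neq; rewrite sp'; case: (over M p); case: (over M q); case: (s q).
by rewrite (a_count_flipN sP sp') (a_count_flip sP sq) addrAC; apply: key.
Qed.

(* The sum over the smoothings satisfying [Q] reduces to those where neither [p]
   nor [q] closes a loop. *)
Lemma bracket_cancel (Q : pred {ffun T -> bool}) p q :
  q \notin star M p -> p \notin star M q ->
  (forall s, Q (flip M p s) = Q s) -> (forall s, Q (flip M q s) = Q s) ->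
  (forall s, smoothing M s -> Q s -> s p -> s q ->
     weight s + weight (flip M p s) + weight (flip M q s) = 0) ->
  bracket = \sum_(s in smoothings | Q s ==> ~~ s p && ~~ s q) weight s.
Proof.
move=> qp pq Qp Qq H; rewrite /bracket (bigID (fun s => Q s ==> ~~ s p && ~~ s q)) /=.
rewrite [X in _ + X](_ : _ = 0) ?addr0 //.
pose S (b c : bool) := \sum_(s in smoothings | Q s && ((s p == b) && (s q == c))) weight s.
have -> : \sum_(s in smoothings | ~~ (Q s ==> ~~ s p && ~~ s q)) weight s
    = S true true + (S false true + S true false).
  rewrite (bigID (fun s => s p && s q)) /=; congr (_ + _).
    by apply: eq_bigl => s; rewrite negb_imply; case: (Q s); case: (s p); case: (s q);
      rewrite ?andbT ?andbF.
  rewrite (bigID (fun s => s q)) /=; congr (_ + _); apply: eq_bigl => s; rewrite negb_imply;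
    by case: (Q s); case: (s p); case: (s q); rewrite ?andbT ?andbF.
have -> : S false true = \sum_(s in smoothings | Q s && ((s p == true) && (s q == true)))
    weight (flip M p s).
  rewrite /S (reindex_inj (inv_inj (flipK M p))) /=; apply: eq_bigl => s.
  by rewrite flip_smoothings Qp !flipE star_id (negbTE qp); case: (s p); case: (s q).
have -> : S true false = \sum_(s in smoothings | Q s && ((s p == true) && (s q == true)))
    weight (flip M q s).
  rewrite /S (reindex_inj (inv_inj (flipK M q))) /=; apply: eq_bigl => s.
  by rewrite flip_smoothings Qq !flipE star_id (negbTE pq); case: (s p); case: (s q).
rewrite addrA -!big_split big1 //= => s.
by case/andP=> /smoothingsP sP /and3P[Qs /eqP sp /eqP sq]; apply: H.
Qed.

End Sum.

(** * State sums with a prescribed pattern at the erased crossings *)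

Section ErasedSum.
Variables (T T' : finType) (M : diagram T) (M' : diagram T') (i : T -> T').
Hypotheses (i_inj : injective i) (i_nx : forall c, i (nx M c) = nx M' (i c))
  (i_over : forall c, over M' (i c) = over M c).
Variables (pat : T' -> bool) (Q : pred {ffun T' -> bool}).
Hypotheses (patP : forall z, z \notin codom i -> pat (nx M' z) = ~~ pat z)
  (QP : forall s : {ffun T' -> bool}, smoothing M' s -> Q s <-> forall z, z \notin codom i -> s z = pat z)
  (flatP : forall (s : {ffun T -> bool}) (s' : {ffun T' -> bool}), smoothing M' s' -> Q s' -> (forall c, s c = s' (i c)) ->
     flat M' s' <-> flat M s)
  (circlesP : forall (s : {ffun T -> bool}) (s' : {ffun T' -> bool}), smoothing M' s' -> Q s' -> (forall c, s c = s' (i c)) ->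
     circles M' s' = circles M s).
Variable a0 : nat.
Hypothesis a0P : #|[set z | (z \notin codom i) && (pat z == over M' z)]| = (4 * a0)%N.

Lemma notin_codom_nx z : z \notin codom i -> nx M' z \notin codom i.
Proof.
apply: contra => /codomP[c e]; apply/codomP; exists (nx M (nx M (nx M c))).
by rewrite !i_nx -e nx4.
Qed.

Lemma weight_erased (s : {ffun T -> bool}) (s' : {ffun T' -> bool}) : smoothing M' s' -> Q s' -> (forall c, s c = s' (i c)) ->
  weight M' s' = y ^+ a0 * weight M s.
Proof.
move=> s'P Qs' ss'; have /QP-/(_ s'P) e := Qs'.
rewrite /weight (asbool_equiv_eq (flatP s'P Qs' ss')) (circlesP s'P Qs' ss').
case: asboolP => _; last by rewrite mulr0.
rewrite mulrA -exprD; congr (_ ^+ _ * _).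
rewrite /a_count -(cardsID [set i c | c : T]) addnC.
have -> : [set d | s' d == over M' d] :\: [set i c | c : T]
  = [set z | (z \notin codom i) && (pat z == over M' z)].
  apply/setP=> z; rewrite !inE.
  have -> : (z \in [set i c | c : T]) = (z \in codom i).
    by apply/imsetP/codomP=> [[c _ ->]|[c ->]]; exists c.
  by case: (boolP (z \in codom i)) => //= /e->.
have -> : [set d | s' d == over M' d] :&: [set i c | c : T]
    = [set i c | c in [set d | s d == over M d]].
  apply/setP=> z; rewrite !inE; apply/andP/imsetP => [[e1 /imsetP[c _ ez]]|[c]].
    by exists c => //; rewrite inE ss' -i_over -ez.
  by rewrite inE => ec ->; rewrite -ss' i_over ec; split=> //; apply: imset_f.
by rewrite a0P mulnC card_imset // divnMDl.
Qed.

Lemma erased_sum : \sum_(s' in smoothings M' | Q s') weight M' s' = y ^+ a0 * bracket M.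
Proof.
pose r (s' : {ffun T' -> bool}) : {ffun T -> bool} := [ffun c => s' (i c)].
pose E (s : {ffun T -> bool}) : {ffun T' -> bool} :=
  [ffun z => if [pick c | i c == z] is Some c then s c else pat z].
have Ei s c : E s (i c) = s c.
  rewrite ffunE; case: pickP => [c' /eqP/i_inj->//|/(_ c)]; by rewrite eqxx.
have En s z : z \notin codom i -> E s z = pat z.
  move=> zi; rewrite ffunE; case: pickP => // c /eqP e.
  by rewrite -e codom_f in zi.
have rE s : r (E s) = s by apply/ffunP=> c; rewrite ffunE Ei.
have Er (s' : {ffun T' -> bool}) : smoothing M' s' -> Q s' -> E (r s') = s'.
  move=> s'P Qs'; apply/ffunP=> z; case: (boolP (z \in codom i)) => [/codomP[c ->]|zi].
    by rewrite Ei ffunE.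
  by rewrite En // ((QP s'P).1 Qs').
have smE s : (E s \in smoothings M') = (s \in smoothings M).
  apply/smoothingsP/smoothingsP => sP d; first by rewrite -!(Ei s) i_nx sP.
  case: (boolP (d \in codom i)) => [/codomP[c ->]|di]; first by rewrite -i_nx !Ei sP.
  by rewrite !En ?patP // notin_codom_nx.
have QE s : s \in smoothings M -> Q (E s).
  rewrite -smE => /smoothingsP/QP[_]; apply; exact: En.
rewrite (reindex_onto E r) => [|s' /andP[/smoothingsP s'P Qs']]; last exact: Er.
rewrite /bracket big_distrr /=; apply: eq_big => [s|s].
  by rewrite rE eqxx andbT smE andb_idr // => /QE.
case/andP=> /andP[/smoothingsP sP Qs] _; exact: weight_erased.
Qed.

End ErasedSum.

(** A monomial on either side stands for a power of [y] of arbitrary sign. *)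
Definition bracket_equiv (T T' : finType) (M : diagram T) (M' : diagram T') : Prop :=
  exists (b : bool) (j k : nat), y ^+ j * bracket M = (-1) ^+ b * (y ^+ k * bracket M').

Lemma bracket_equiv_sym (T T' : finType) (M : diagram T) (M' : diagram T') :
  bracket_equiv M M' -> bracket_equiv M' M.
Proof. by case=> b [j [k e]]; exists b, k, j; rewrite e signrMK. Qed.

Lemma bracket_equiv_trans (T1 T2 T3 : finType) (M1 : diagram T1) (M2 : diagram T2)
  (M3 : diagram T3) :
  bracket_equiv M1 M2 -> bracket_equiv M2 M3 -> bracket_equiv M1 M3.
Proof.
case=> b [j [k e]] [b' [j' [k' e']]]; exists (b (+) b'), (j + j')%N, (k + k')%N.
rewrite signr_addb 2!exprD.
have -> : y ^+ j * y ^+ j' * bracket M1 = y ^+ j' * (y ^+ j * bracket M1) by ring.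
rewrite e.
have -> : y ^+ j' * ((-1) ^+ b * (y ^+ k * bracket M2))
  = (-1) ^+ b * (y ^+ k * (y ^+ j' * bracket M2)) by ring.
by rewrite e'; ring.
Qed.

End Bracket.

Lemma erased_path (D D' : motif) (S : D' -> Prop) (outer inner : pred D') :
  (forall z, S z <-> outer z || inner z) -> erased D S ->
  exists i : D -> D',
    [/\ injective i /\ (forall z, (exists c, i c = z) <-> ~~ (outer z || inner z)),
      forall c, i (nx D c) = nx D' (i c),
      forall c, over D' (i c) = over D c,
      forall c, exists k,
        let follow j := iter j (fun z => ed D' (nx D' (nx D' z))) (ed D' (i c)) in
        follow k = i (ed D c) /\
        (forall j, (j < k)%N -> outer (follow j) || inner (follow j))
    & forall z, outer z || inner z ->
        exists k, ~~ (outer (iter k (straight D') z) || inner (iter k (straight D') z))].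
Proof.
move=> SP [i [[ii ik] inx iov ip ix]]; exists i; split=> // [|c|z /SP/ix[k nS]].
- split=> // z; split=> [/ik nS|nS]; first by apply/negP=> /SP.
  by apply/ik => /SP; apply/negP.
- by have [k [e H]] := ip c; exists k; split=> // j /H/SP.
by exists k; apply/negP=> /SP.
Qed.

Section ErasedBracket.
Local Open Scope group_scope.
Variables (K : comNzRingType) (y y' : K) (D D' : motif) (S : D' -> Prop).
Variables (outer inner : pred D').
Let gone z := outer z || inner z.
Hypotheses (SP : forall z, S z <-> gone z) (erD : erased D S).
Hypotheses (outer_nx2 : forall z, outer z -> inner (nx D' (nx D' z)))
  (inner_nx2 : forall z, inner z -> outer (nx D' (nx D' z)))
  (inner_ed : forall z, inner z -> inner (ed D' z))
  (outerN : forall z, outer z -> ~~ inner z).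
Variables (pat : D' -> bool) (Q : pred {ffun D' -> bool}) (a0 : nat).
Hypotheses (patP : forall z, gone z -> pat (nx D' z) = ~~ pat z)
  (QP : forall s : {ffun D' -> bool}, smoothing D' s ->
     Q s <-> forall z, gone z -> s z = pat z)
  (a0P : #|[set z | gone z && (pat z == over D' z)]| = (4 * a0)%N).
Hypothesis gauge : forall (G : groupType) (psi : D' -> G), connection D' psi ->
  exists2 psi', through_connection D' outer psi' &
    forall s, (exists xi : D' -> G, horizontal D' s psi' xi) ->
      exists xi : D' -> G, horizontal D' s psi xi.
Hypothesis lift_connection : forall (G : groupType) (F : D' -> G),
  (forall z, ~~ gone z -> F (nx D' (nx D' (nx D' z))) * F (nx D' (nx D' z))
                          * F (nx D' z) * F z = 1) ->
  (forall z, ~~ inner z -> F (ed D' z) = (F z)^-1) ->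
  (forall z, outer z -> F (through D' z) = (F z)^-1) ->
  exists2 psi', through_connection D' outer psi' & forall z, ~~ gone z -> psi' z = F z.
Hypothesis pass : forall (G : groupType) (psi xi : D' -> G) (s : {ffun D' -> bool}),
  smoothing D' s -> Q s -> through_connection D' outer psi -> horizontal D' s psi xi ->
  forall z, outer z -> xi z = psi z * xi (through D' z).
Hypothesis fill : forall (G : groupType) (psi xi : D' -> G) (s : {ffun D' -> bool}),
  smoothing D' s -> Q s -> through_connection D' outer psi ->
  (forall z, ~~ inner z -> xi z = psi z * xi (ed D' z)) ->
  (forall z, outer z -> xi z = psi z * xi (through D' z)) ->
  (forall z, ~~ gone z -> s z -> xi (nx D' z) = psi (nx D' z) * xi z) ->
  exists2 xi', horizontal D' s psi xi' & forall z, ~~ gone z -> xi' z = xi z.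
Hypothesis fill_inj : forall (s : {ffun D' -> bool}) (f g : {ffun D' -> 'F_2}),
  smoothing D' s -> Q s -> f \in colorings D' s -> g \in colorings D' s ->
  (forall z, ~~ inner z -> f z = g z) -> f = g.

Lemma erased_bracket :
  (\sum_(s in smoothings D' | Q s) weight y y' D' s = y ^+ a0 * bracket y y' D)%R.
Proof.
have [i [[i_inj ik] inx iov ip ix]] := erased_path SP erD.
have ci z : (z \notin codom i) = gone z.
  apply/idP/idP => [zi|/negP gz].
    by apply: contraT => /ik[c e]; rewrite -e codom_f in zi.
  by apply/negP=> /codomP[c e]; apply/gz/negP/ik; exists c.
have kc c : ~~ gone (i c) by rewrite -ci codom_f.
have kz z : ~~ gone z -> exists c, i c = z by move/ik.
have fillP (G : groupType) (psi xi : D' -> G) (s : {ffun D -> bool})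
  (s' : {ffun D' -> bool}) : smoothing D' s' -> Q s' -> (forall c, s c = s' (i c)) ->
  through_connection D' outer psi ->
  (forall z, ~~ inner z -> xi z = psi z * xi (ed D' z)) ->
  (forall z, outer z -> xi z = psi z * xi (through D' z)) ->
  (forall c, s c -> xi (i (nx D c)) = psi (i (nx D c)) * xi (i c)) ->
  exists2 xi', horizontal D' s' psi xi' & forall c, xi' (i c) = xi (i c).
  move=> s'P Qs' ss' cpsi h1 h2 h3.
  have [z /kz[c <-] sc|xi' Hxi' e] := fill s'P Qs' cpsi h1 h2.
    by rewrite -inx h3 // ss'.
  by exists xi' => // c; apply: e.
apply: (erased_sum y y' i_inj inx iov (pat := pat)) => [z|s sP|s s' s'P Qs' ss'|s s' s'P Qs' ss'|].
- by rewrite ci; apply: patP.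
- by split=> [/(QP sP) H z|H]; [rewrite ci; apply: H | apply/(QP sP) => z gz; apply: H; rewrite ci].
- apply: (erased_flat i_inj ik inx ip ix outer_nx2 inner_nx2 inner_ed outerN ss').
  + by move=> G psi /gauge[psi' tpsi' H]; exists psi' => //; apply: H.
  + move=> G psi F [_ c2] e F1 F2.
    have [|psi' tpsi' H] := lift_connection _ F1 F2.
      by move=> z /kz[c <-]; rewrite -!inx !e.
    by exists psi' => // c; rewrite H.
  + by move=> G psi xi; apply: pass.
  by move=> G psi xi; apply: fillP.
- apply: (erased_circles i_inj ik inx ip ix outer_nx2 inner_nx2 inner_ed outerN ss').
  + by move=> G psi xi; apply: pass.
  + by move=> G psi xi; apply: fillP.
  by move=> f g; apply: fill_inj.
by rewrite -a0P; apply: eq_card => z; rewrite !inE ci.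
Qed.

End ErasedBracket.

(** Being constant along [fc], [gam] is a change of frame in each region; sections are carried back
    by its inverse. *)
Lemma gauge_connection (T : Type) (M : diagram T) (G : groupType) (psi gam : T -> G) :
  (forall d, gam (fc M d) = gam d) -> connection M psi ->
  let psi' d := (gam d * psi d * (gam (ed M d))^-1)%g in
  connection M psi' /\
  forall s, (exists xi : T -> G, horizontal M s psi' xi) ->
    exists xi : T -> G, horizontal M s psi xi.
Proof.
move=> gfc [c1 c2] psi'.
have ged d : gam (ed M (nx M d)) = gam d by rewrite -gfc fc_ed_nx.
have ged0 d : gam (ed M d) = gam (nx M (nx M (nx M d))) by rewrite -[in LHS](nx4 M d) ged.
split.
  split=> d; rewrite /psi'.
    by rewrite ed_invol c1 !invMg invgK mulgA.
  rewrite !ged (ged0 d) !mulgA !mulgKV -!(mulgA (gam _)) c2 mul1g mulgV //.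
move=> s [xi [h1 h2]]; exists (fun d => (gam d)^-1 * xi d)%g; split=> [d|d /h2 e].
  by rewrite h1 /psi' !mulgA mulVg mul1g.
by rewrite e /psi' ged !mulgA mulVg mul1g.
Qed.

Section Moves.
Local Open Scope ring_scope.
Variables (K : comNzRingType) (y y' : K).

(** An isomorphism is treated as an erasure with no crossing erased. *)
Lemma isomorphic_bracket (D D' : motif) : isomorphic D D' -> bracket y y' D' = bracket y y' D.
Proof.
case=> i [i' ii' i'i] [inx ied iov].
have erD : erased D (fun _ : D' => False).
  exists i; split=> [|||c|] //; last by exists 0%N; rewrite /= ied.
  by split=> [|z]; [apply: can_inj ii' | split=> [_ []|_]; exists (i' z)].
have -> : bracket y y' D' = \sum_(s in smoothings D' | predT s) weight y y' D' s.
  by apply: eq_bigl => s; rewrite andbT.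
rewrite -[RHS]mul1r -[1](expr0 y).
apply: (@erased_bracket _ _ _ _ _ _ pred0 pred0 _ erD _ _ _ _ (fun=> false)) => //=.
- by rewrite (_ : [set z | _] = set0) ?cards0 //; apply/setP=> z; rewrite !inE.
- by move=> G psi cpsi; exists psi.
- by move=> G F H1 H2 _; exists F => //; split=> //; split=> // z; [apply: H2 | apply: H1].
- by move=> G psi xi s _ _ _ h1 _ h2; exists xi => //; split=> d; [apply: h1 | apply: h2].
by move=> s f g _ _ _ _ H; apply/ffunP=> z; apply: H.
Qed.

End Moves.

(** * The first two moves *)

Lemma star_neq (T : finType) (M : diagram T) x :
  [/\ [/\ x != nx M x, x != nx M (nx M x) & x != nx M (nx M (nx M x))],
      nx M x != nx M (nx M x), nx M x != nx M (nx M (nx M x))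
    & nx M (nx M x) != nx M (nx M (nx M x))].
Proof.
have := star_uniq M x; rewrite /= !inE !negb_or.
by case/and4P=> /and3P[-> -> ->] /andP[-> ->] ->.
Qed.

Lemma star_disjoint (T : finType) (M : diagram T) x w z : ~ same_crossing M x w ->
  z \in star M x -> z \in star M w -> False.
Proof.
move=> xw zx /starP[i ei]; apply/xw/starP.
have <- : iter (4 * i - i) (nx M) z = w.
  rewrite -ei -iterD subnK; last by rewrite leq_pmull.
  by elim: (i) => // k IHk; rewrite mulnS /= nx4.
by elim: (4 * i - i) => [|k IHk] //=; rewrite star_nx IHk.
Qed.

Lemma star_cross (T : finType) (M : diagram T) x w : ~ same_crossing M x w ->
  all (fun a => all (fun b => a != b)
         [:: w; nx M w; nx M (nx M w); nx M (nx M (nx M w))])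
    [:: x; nx M x; nx M (nx M x); nx M (nx M (nx M x))].
Proof.
move=> xw; apply/allP=> a ax; apply/allP=> b bw; apply/eqP=> ab.
by apply: (@star_disjoint _ M x w a xw); rewrite inE // ab.
Qed.

Ltac neqs := repeat match goal with
  | H : is_true (?a != ?b) |- context [?a == ?b] => rewrite (negbTE H)
  | H : is_true (?a != ?b) |- context [?b == ?a] => rewrite (eq_sym b a) (negbTE H)
  end.

Section FirstMove.
Variables (K : comNzRingType) (y y' : K) (D D' : motif) (x : D').
Hypotheses (yy' : (y * y' = 1)%R) (ex : ed D' x = nx D' x).
Hypothesis erD : erased D (same_crossing D' x).

Let outer z := (z == nx D' (nx D' x)) || (z == nx D' (nx D' (nx D' x))).
Let inner z := (z == x) || (z == nx D' x).
Let pat z := (z == nx D' x) || (z == nx D' (nx D' (nx D' x))).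

Lemma R1_gone z : (z \in star D' x) = outer z || inner z.
Proof. by rewrite starE /outer /inner; do 4!case: eqP. Qed.

Lemma R1_ed_nx : ed D' (nx D' x) = x.
Proof. by rewrite -ex ed_invol. Qed.

Lemma R1_through : through D' (nx D' (nx D' x)) = nx D' (nx D' (nx D' x)).
Proof. by rewrite /through nx4 ex. Qed.

Lemma R1_not_inner_ed z : ~~ inner z -> (ed D' z == x) || (ed D' z == nx D' x) = false.
Proof.
move=> nz; apply/negP=> /orP[]/eqP e; move: nz; rewrite /inner -[z](ed_invol D') e.
  by rewrite ex eqxx orbT.
by rewrite R1_ed_nx eqxx.
Qed.

(** When [x] is not joined to [nx x], the smoothed strand enters at one outer dart, runs round the
    loop and leaves at the other, as [through] does. The exponent is 1 exactly when this is the
    A-smoothing. *)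
Lemma R1_erased_sum :
  (\sum_(s in smoothings D' | ~~ s x) weight y y' D' s = y ^+ (~~ over D' x) * bracket y y' D)%R.
Proof.
have [[n01 n02 n03] n12 n13 n23] := star_neq D' x.
have inner_x : inner x by rewrite /inner eqxx.
have inner_nx : inner (nx D' x) by rewrite /inner eqxx orbT.
have outer_2 : ~~ inner (nx D' (nx D' x)) by rewrite /inner; neqs.
have outer_3 : ~~ inner (nx D' (nx D' (nx D' x))) by rewrite /inner; neqs.
apply: (@erased_bracket _ _ _ _ _ _ outer inner _ erD _ _ _ _ pat).
- by move=> z; rewrite -R1_gone; split=> /starP.
- by rewrite /outer /inner => z /orP[]/eqP->; rewrite ?nx4 eqxx ?orbT.
- by rewrite /outer /inner => z /orP[]/eqP->; rewrite ?nx4 eqxx ?orbT.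
- by rewrite /inner => z /orP[]/eqP->; rewrite ?ex ?R1_ed_nx eqxx ?orbT.
- by rewrite /outer => z /orP[]/eqP->.
- move=> z; rewrite -R1_gone starE /pat.
  by case/or4P=> /eqP->; rewrite ?nx4 ?(inj_eq (@nx_inj _ D')) ?eqxx; neqs; rewrite ?eqxx ?orbT.
- move=> s sP; split=> [sx z|H]; last first.
    by rewrite H ?inner_x ?orbT // /pat; neqs.
  rewrite -R1_gone starE /pat => /or4P[]/eqP->; rewrite ?sP ?eqxx; neqs; rewrite ?orbT ?negbK //;
    exact: negbTE.
- case: (boolP (over D' x)) => ox /=.
    apply/eqP; rewrite cards_eq0; apply/eqP/setP=> z; rewrite !inE -R1_gone starE /pat.
    apply/negP=> /andP[/or4P[]/eqP->]; rewrite ?eqxx; neqs; by rewrite ?orbT ?over_nx ox.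
  rewrite muln1 -(card_star D' x); apply: eq_card => z; rewrite !inE -R1_gone -starE andb_idr //.
  rewrite starE /pat => /or4P[]/eqP->; rewrite ?eqxx; neqs;
    by rewrite ?orbT ?over_nx ?(negbTE ox).
(* The two ends of the loop carry inverse and adjacent factors in the relation at the crossing, so
   the given connection already has inverse values on the two outer darts. *)
- move=> G psi cpsi; exists psi => //; split=> //.
  have [c1 c2] := cpsi; have e1 : psi (nx D' x) = (psi x)^-1%g by rewrite -ex c1.
  have /mulg1_eq e : (psi (nx D' (nx D' (nx D' x))) * psi (nx D' (nx D' x)) = 1)%g.
    by rewrite -(c2 x) e1 mulgVK.
  rewrite /outer => z /orP[]/eqP->; first by rewrite R1_through -e invgK.
  by rewrite -{1}R1_through throughK e.
- move=> G F c1 c2 c3.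
  (* The value on the loop is a choice of frame in the monogon: it cancels in the relation at the
     crossing. *)
  pose psi z := if z == x then (F (nx D' (nx D' x)))^-1%g
                else if z == nx D' x then F (nx D' (nx D' x)) else F z.
  have psiF z : ~~ inner z -> psi z = F z by rewrite /psi /inner; do 2!case: eqP.
  exists psi; last by move=> z; rewrite negb_or => /andP[_ /psiF].
  have psix : psi x = (F (nx D' (nx D' x)))^-1%g by rewrite /psi eqxx.
  have psi1 : psi (nx D' x) = F (nx D' (nx D' x)) by rewrite /psi; neqs; rewrite eqxx.
  split; [split|].
  + move=> z; case: (boolP (inner z)) => [/orP[]/eqP->|nz].
    * by rewrite ex psi1 psix invgK.
    * by rewrite R1_ed_nx psi1 psix.
    by rewrite !psiF ?c2 // /inner R1_not_inner_ed.
  + move=> z; case: (boolP (outer z || inner z)) => gz.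
      rewrite -R1_gone in gz; apply: (connection_same_crossing (starP _ _ _ gz)).
      rewrite psix psi1 !psiF // -R1_through c3 /outer ?eqxx //.
      by rewrite mulVg mul1g mulgV.
    have nx_gone w : outer (nx D' w) || inner (nx D' w) = outer w || inner w.
      by rewrite -!R1_gone star_nx.
    have ni w : ~~ (outer w || inner w) -> ~~ inner w by rewrite negb_or => /andP[].
    by rewrite !psiF ?c1 //; apply: ni; rewrite ?nx_gone.
  have outN w : outer w -> ~~ inner w by case/orP=> /eqP->.
  have outT w : outer w -> outer (through D' w).
    by rewrite /outer => /orP[]/eqP->; rewrite -?R1_through ?throughK eqxx ?orbT.
  by move=> z oz; rewrite !psiF ?c3 //; [apply: outN | apply/outN/outT].
- move=> G psi xi s sP sx [[c1 c2] tpsi] [h1 h2].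
  have s1 : s (nx D' x) by rewrite sP.
  have s3 : s (nx D' (nx D' (nx D' x))) by rewrite smoothing3.
  have e3 : xi (nx D' (nx D' (nx D' x))) = xi (nx D' x).
    have := h2 _ s3; rewrite nx4 h1 ex => /mulgI ->; by [].
  have e2 : xi (nx D' (nx D' x)) = (psi (nx D' (nx D' x)) * xi (nx D' (nx D' (nx D' x))))%g.
    by rewrite h2 // e3.
  rewrite /outer => z /orP[]/eqP->; first by rewrite R1_through.
  rewrite -{2 3}R1_through throughK e2 tpsi ?mulKg // /outer eqxx //.
- move=> G psi xi s sP sx [[c1 c2] tpsi] h1 h2 h3.
  pose xi' z := if z == x then (psi x * xi (nx D' (nx D' (nx D' x))))%g
                else if z == nx D' x then xi (nx D' (nx D' (nx D' x))) else xi z.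
  have xiF z : ~~ inner z -> xi' z = xi z by rewrite /xi' /inner; do 2!case: eqP.
  have xix : xi' x = (psi x * xi (nx D' (nx D' (nx D' x))))%g by rewrite /xi' eqxx.
  have xi1 : xi' (nx D' x) = xi (nx D' (nx D' (nx D' x))) by rewrite /xi'; neqs; rewrite eqxx.
  exists xi'; last by move=> z; rewrite negb_or => /andP[_ /xiF].
  split=> z.
    case: (boolP (inner z)) => [/orP[]/eqP->|nz].
    * by rewrite ex xi1 xix.
    * by rewrite R1_ed_nx xi1 xix -ex c1 mulKg.
    rewrite (xiF z nz) xiF; first exact: h1.
    by rewrite /inner R1_not_inner_ed.
  case: (boolP (outer z || inner z)) => gz sz.
    move: gz sz; rewrite -R1_gone starE => /or4P[]/eqP->; rewrite ?sP ?(negbTE sx) // => _.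
      by rewrite xiF // xi1 h2 ?R1_through // /outer eqxx.
    by rewrite nx4 xix xiF.
  have nx_gone w : outer (nx D' w) || inner (nx D' w) = outer w || inner w.
    by rewrite -!R1_gone star_nx.
  have ni w : ~~ (outer w || inner w) -> ~~ inner w by rewrite negb_or => /andP[].
  rewrite (xiF z (ni z gz)) xiF; first exact: h3.
  by apply: ni; rewrite nx_gone.
move=> s f g sP sx fs gs H; apply/ffunP=> z.
have [_ f2] := coloringsP fs; have [_ g2] := coloringsP gs.
have s1 : s (nx D' x) by rewrite sP.
have s3 : s (nx D' (nx D' (nx D' x))) by rewrite smoothing3.
case: (boolP (inner z)) => [/orP[]/eqP->|/H//].
  by rewrite -[x in LHS](nx4 D') -[x in RHS](nx4 D') f2 // g2 // H.
by rewrite -f2 // -g2 // H.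
Qed.

Lemma R1_loop (s : {ffun D' -> bool}) : smoothing D' s -> s x ->
  (flat D' s <-> flat D' (flip D' x s)) /\
  circles D' s = (circles D' (flip D' x s)).+1.
Proof.
move=> sP sx; have [[n01 n02 n03] n12 n13 n23] := star_neq D' x.
have C1 d : inner (ed D' d) = inner d.
  have H z : inner z -> inner (ed D' z).
    by rewrite /inner => /orP[]/eqP->; rewrite ?ex ?R1_ed_nx eqxx ?orbT.
  by apply/idP/idP => /H //; rewrite ed_invol.
have C2 d : s d -> inner (nx D' d) = inner d.
  move=> sd; rewrite /inner (inj_eq (@nx_inj _ D')) orbC; congr (_ || _).
  have -> : (nx D' d == x) = (d == nx D' (nx D' (nx D' x))).
    by rewrite -[RHS](inj_eq (@nx_inj _ D')) nx4.
  by apply/eqP/eqP=> e; move: sd; rewrite e ?smoothing3 ?sP ?sx.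
have Cx : inner x by rewrite /inner eqxx.
have Cn : ~~ inner (nx D' (nx D' x)) by rewrite /inner; neqs.
have loop (G : groupType) (psi xi : D' -> G) : connection D' psi ->
    horizontal D' (flip D' x s) psi xi -> join D' psi xi x.
  move=> [c1 _] [h1 _]; rewrite /join (h1 x) ex.
  by rewrite (_ : psi (nx D' x) = (psi x)^-1)%g ?mulKg // -ex c1.
split; first exact: flat_flip_loop C1 C2 Cx Cn loop.
exact: circles_flip_loop C1 C2 Cx Cn loop.
Qed.

(** Joining [x] to [nx x] splits off the loop as one more circle. With d the value of a circle, the
    two smoothings of the kink together contribute y d + 1 = -y^2 times the weight of the state
    without this circle, or d/y + 1 = -1/y^2 times it, according to [over D' x]. *)
Lemma R1_bracket : bracket_equiv y y' D D'.
Proof.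
have flip_sum : (\sum_(s in smoothings D' | s x) weight y y' D' s
    = \sum_(s in smoothings D' | ~~ s x) weight y y' D' (flip D' x s))%R.
  rewrite (reindex_inj (inv_inj (flipK D' x))) /=; apply: eq_bigl => s.
  by rewrite flip_smoothings flipE star_id.
have sumE : (bracket y y' D' = \sum_(s in smoothings D' | ~~ s x)
    (weight y y' D' (flip D' x s) + weight y y' D' s))%R.
  by rewrite /bracket (bigID (fun s : {ffun _ -> _} => s x)) /= flip_sum big_split.
have step (s : {ffun D' -> bool}) : s \in smoothings D' -> ~~ s x ->
    (if over D' x then weight y y' D' (flip D' x s) + weight y y' D' s = - y ^+ 2 * weight y y' D' s
    else y ^+ 2 * (weight y y' D' (flip D' x s) + weight y y' D' s) = - weight y y' D' s)%R.
  move=> /smoothingsP sP sx; have tP := flip_smoothing x sP.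
  have tx : flip D' x s x by rewrite flipE star_id.
  have [fl ci] := R1_loop tP tx; rewrite flipK in fl ci.
  have lE := loop_valueE yy'.
  case: ifP => ox; rewrite /weight (asbool_equiv_eq fl); case: asboolP => _;
    rewrite ?(mulr0, addr0, oppr0) // ci.
    rewrite (a_count_flip (x := x) tP) ?flipK ?tx ?ox //.
    rewrite [in LHS]exprS [(loop_value _ _ ^+ _.+1)%R]exprS.
    have -> : (forall a b : K, y * a * (loop_value y y' * b) + a * b
      = (y * loop_value y y' + 1) * (a * b))%R by move=> a b; ring.
    by rewrite lE; ring.
  rewrite (a_count_flip (x := x) sP) ?ox; last by apply/negbTE.
  rewrite [(loop_value _ _ ^+ _.+1)%R]exprS [(y ^+ (a_count D' _).+1)%R]exprS.
  have -> : (forall a b : K, y ^+ 2 * (a * (loop_value y y' * b) + y * a * b)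
      = (y * loop_value y y' + y ^+ 2) * (y * a * b))%R by move=> a b; ring.
  by rewrite lE; ring.
case: (boolP (over D' x)) => ox.
  exists true, 2, 0; rewrite sumE.
  rewrite (eq_bigr (fun s => - y ^+ 2 * weight y y' D' s)%R) => [|s /andP[sS sx]].
    by rewrite -big_distrr /= R1_erased_sum ox !expr0 !mul1r expr1; ring.
  by have := step s sS sx; rewrite ox.
exists true, 1, 2; have : (y ^+ 2 * bracket y y' D' = - (y * bracket y y' D))%R.
  rewrite sumE big_distrr /=.
  rewrite (eq_bigr (fun s => - weight y y' D' s)%R) => [|s /andP[sS sx]].
    by rewrite sumrN R1_erased_sum ox.
  by have := step s sS sx; rewrite (negbTE ox).
by rewrite !expr1 mulN1r => ->; rewrite opprK.
Qed.

End FirstMove.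

Section SecondMove.
Variables (K : comNzRingType) (y y' : K) (g : nat) (D D' : motif) (x w : D').
Hypotheses (yy' : (y * y' = 1)%R) (onD : on_surface g D) (onD' : on_surface g D').
Hypotheses (xw : ~ same_crossing D' x w) (ex : ed D' x = w)
  (ex3 : ed D' (nx D' (nx D' (nx D' x))) = nx D' w) (overw : over D' w = over D' x).
Hypothesis erD : erased D (fun z => same_crossing D' x z \/ same_crossing D' w z).

Local Notation nx1 z := (nx D' z).
Local Notation nx2 z := (nx D' (nx D' z)).
Local Notation nx3 z := (nx D' (nx D' (nx D' z))).

Let outer z := [|| z == nx1 x, z == nx2 x, z == nx2 w | z == nx3 w].
Let inner z := [|| z == x, z == nx3 x, z == w | z == nx1 w].
Let pat z := [|| z == x, z == nx2 x, z == nx1 w | z == nx3 w].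

Lemma R2_disjoint z : z \in star D' x -> z \in star D' w -> False.
Proof. exact: star_disjoint. Qed.

Ltac R2_facts :=
  have [[? ? ?] ? ? ?] := star_neq D' x; have [[? ? ?] ? ? ?] := star_neq D' w;
  have := star_cross xw; rewrite /= !andbT;
  case/and4P=> /and4P[? ? ? ?] /and4P[? ? ? ?] /and4P[? ? ? ?] /and4P[? ? ? ?].

Lemma R2_gone z : outer z || inner z = (z \in star D' x) || (z \in star D' w).
Proof. by rewrite !starE /outer /inner; do 8!case: (_ == _). Qed.

Lemma R2_ew : ed D' w = x.
Proof. by rewrite -ex ed_invol. Qed.

Lemma R2_ew1 : ed D' (nx1 w) = nx3 x.
Proof. by rewrite -ex3 ed_invol. Qed.

Lemma R2_through1 : through D' (nx1 x) = nx3 w.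
Proof. by rewrite /through ex3. Qed.

Lemma R2_through2 : through D' (nx2 x) = nx2 w.
Proof. by rewrite /through nx4 ex. Qed.

Lemma R2_through3 : through D' (nx2 w) = nx2 x.
Proof. by rewrite -R2_through2 throughK. Qed.

Lemma R2_through4 : through D' (nx3 w) = nx1 x.
Proof. by rewrite -R2_through1 throughK. Qed.

Lemma R2_inner_ed z : inner z -> inner (ed D' z).
Proof.
by rewrite /inner => /or4P[]/eqP->; rewrite ?ex ?ex3 ?R2_ew ?R2_ew1 eqxx ?orbT.
Qed.

Lemma R2_outer_through z : outer z -> outer (through D' z).
Proof.
by rewrite /outer => /or4P[]/eqP->;
  rewrite ?R2_through1 ?R2_through2 ?R2_through3 ?R2_through4 eqxx ?orbT.
Qed.

Lemma R2_outerN z : outer z -> ~~ inner z.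
Proof. by R2_facts; rewrite /outer /inner => /or4P[]/eqP->; neqs. Qed.

Lemma R2_outer_nx2 z : outer z -> inner (nx2 z).
Proof. by rewrite /outer /inner => /or4P[]/eqP->; rewrite ?nx4 eqxx ?orbT. Qed.

Lemma R2_inner_nx2 z : inner z -> outer (nx2 z).
Proof. by rewrite /outer /inner => /or4P[]/eqP->; rewrite ?nx4 eqxx ?orbT. Qed.

Lemma R2_not_inner_ed z : ~~ inner z -> ~~ inner (ed D' z).
Proof. by apply: contra => /R2_inner_ed; rewrite ed_invol. Qed.

Lemma R2_gone_nx z : outer (nx1 z) || inner (nx1 z) = outer z || inner z.
Proof. by rewrite !R2_gone !star_nx. Qed.

Lemma R2_kept_inner z : ~~ (outer z || inner z) -> ~~ inner z.
Proof. by rewrite negb_or => /andP[]. Qed.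

Lemma R2_erased_gone z : same_crossing D' x z \/ same_crossing D' w z <-> outer z || inner z.
Proof.
rewrite R2_gone; split=> [[]/starP->|/orP[]/starP]; rewrite ?orbT //; by [left | right].
Qed.

(* If the regions between the two strands before and after the bigon were the
   same region of [D'], the second move would raise the Euler characteristic. *)
Lemma R2_regions : ~~ fconnect (fc D') (nx2 w) (nx1 x).
Proof.
apply/negP=> conn.
have [i [[i_inj ik] inx _ ip ix]] := erased_path R2_erased_gone erD.
have fcE z (u : D' -> 'F_2) : (forall z, u (fc D' z) = u z) -> u (ed D' (nx1 z)) = u z.
  by move=> uP; rewrite -uP fc_ed_nx.
pose swap (a : 'F_2 * 'F_2) := (a.2, a.1).
have swapK : involutive swap by case.
(* The values on the two sides of an edge; a function on the regions of [D'] passes to [D] when they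
   match across the tangle, and [conn] provides the match. *)
pose F (u : D' -> 'F_2) z := (u z, u (ed D' z)).
have F1 u z : F u (ed D' z) = swap (F u z) by rewrite /F /swap ed_invol.
have F2 u : (forall z, u (fc D' z) = u z) ->
    forall z, outer z -> F u (through D' z) = swap (F u z).
  move=> uP.
  have ux : u (nx2 w) = u (nx1 x).
    by apply: (fconnect_invariant (k := u)) conn => z; apply/eqP; rewrite uP.
  have uw : u (nx3 w) = u x by rewrite -(uP x) /fc ex.
  have uw1 : u (nx1 w) = u (nx2 x) by rewrite -(uP (nx1 w)) /fc R2_ew1 nx4.
  by rewrite /outer => z /or4P[]/eqP->; rewrite ?R2_through1 ?R2_through2 ?R2_through3
    ?R2_through4 /F /swap /= !fcE // ?ux ?uw ?uw1.
pose A := [set u : {ffun D' -> 'F_2} | [forall z, u (fc D' z) == u z]].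
pose B := [set u : {ffun D -> 'F_2} | [forall z, u (fc D z) == u z]].
(* The dart [nx3 x] borders the bigon. Under [conn], a function on the regions is determined by its
   restriction to [D] and its value on the bigon, which is set to 0 here. *)
pose N := [set u in A | u (nx3 x) == 0%R].
have AP (u : {ffun D' -> 'F_2}) : u \in A -> forall z, u (fc D' z) = u z.
  by rewrite inE => /forallP H z; apply/eqP.
have leAN : #|A| <= 2 * #|N|.
  apply: leq_card_half => f h fA fN hA hN; rewrite !inE.
  have f0 : f (nx3 x) != 0%R by move: fN; rewrite inE fA.
  have h0 : h (nx3 x) != 0%R by move: hN; rewrite inE hA.
  apply/andP; split.
    by apply/forallP=> z; rewrite !ffunE !AP.
  rewrite !ffunE; have [/eqP|->] := F2_cases (f (nx3 x)); first by rewrite (negbTE f0).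
  have [/eqP|->] := F2_cases (h (nx3 x)); first by rewrite (negbTE h0).
  by rewrite subrr.
pose r (u : {ffun D' -> 'F_2}) := [ffun c => u (i c)].
have ir (u : {ffun D' -> 'F_2}) c : u \in A -> F u (i (ed D c)) = swap (F u (i c)).
  move=> uA; apply: (restrict_ed ik ip R2_outer_nx2 R2_inner_nx2 (@R2_inner_ed) R2_outerN swapK).
    by move=> z _; apply: F1.
  exact/F2/AP.
have r_inj : {in N &, injective r}.
  move=> u v; rewrite inE => /andP[uA /eqP u0]; rewrite inE => /andP[vA /eqP v0] /ffunP uv.
  have uvi c : u (i c) = v (i c) by have := uv c; rewrite !ffunE.
  have uvF c : F u (i c) = F v (i c).
    have ed3 (f : {ffun D' -> 'F_2}) : f \in A -> f (ed D' (i c)) = f (i (nx D (nx D (nx D c)))).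
      by move=> fA; rewrite -[in LHS](nx4 D' (i c)) fcE ?inx //; apply: AP.
    by rewrite /F uvi !ed3 // uvi.
  have uvo z : outer z -> F u z = F v z.
    move=> oz; have nz := R2_outerN oz.
    have [c Hc] := first_exists ik ix R2_outer_nx2 R2_inner_nx2 (@R2_inner_ed) R2_outerN oz.
    apply: (can_inj swapK).
    have val (f : {ffun D' -> 'F_2}) : f \in A -> F f (i c) = swap (F f z).
      move=> fA; apply: (first_value R2_outer_nx2 R2_inner_nx2 (@R2_inner_ed) R2_outerN swapK) => //.
      exact/F2/AP.
    by rewrite -!val.
  have o1 : outer (nx1 x) by rewrite /outer eqxx.
  have o2 : outer (nx2 x) by rewrite /outer eqxx orbT.
  apply/ffunP=> z; case: (boolP (outer z)) => [/uvo[]//|noz].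
  case: (boolP (inner z)) => [|niz]; last first.
    have /ik[c <-] : ~~ (outer z || inner z) by rewrite negb_or noz.
    exact: uvi.
  have uw (f : {ffun D' -> 'F_2}) : f \in A -> f w = f (nx3 x).
    by move=> fA; rewrite -(AP f fA (nx3 x)) /fc ex3 nx4.
  have uw1 (f : {ffun D' -> 'F_2}) : f \in A -> f (nx1 w) = f (nx2 x).
    by move=> fA; rewrite -(AP f fA (nx1 w)) /fc R2_ew1 nx4.
  rewrite /inner => /or4P[]/eqP->; rewrite ?uw ?uw1 ?u0 ?v0 //; last by have [] := uvo _ o2.
  have [_] := uvo _ o1.
  by rewrite !fcE //; apply: AP.
have leNB : #|N| <= #|B|.
  rewrite -(card_in_imset r_inj); apply/subset_leq_card/fintype.subsetP=> f.
  case/imsetP=> u; rewrite inE => /andP[uA _] ->; rewrite inE; apply/forallP=> c.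
  have [_ e] := ir u c uA; rewrite !ffunE /fc !inx -e.
  by rewrite -[in X in _ == X](nx4 D' (i (ed D c))) fcE //; apply: AP.
(* At most one region is lost by the erasure, whereas the loss of two crossings and four edges at
   constant genus requires a loss of two. *)
have := leq_trans leAN (leq_mul (leqnn 2) leNB).
rewrite !card_finvariants -?expnS; try exact: fc_inj.
rewrite leq_exp2l // => leF.
have cardD' : #|D'| = #|D| + 8.
  rewrite -(cardC (mem (codom i))) (card_codom i_inj); congr (_ + _).
  have -> : #|[predC mem (codom i)]| = #|star D' x :|: star D' w|.
    apply: eq_card => z; rewrite !inE -!starE -R2_gone.
    apply/idP/idP => [zi|gz].
      by apply: contraT => /ik[c e]; rewrite -e codom_f in zi.
    by apply/negP=> /codomP[c e]; move: gz; rewrite e; apply/negP/ik; exists c.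
  rewrite cardsU !card_star (_ : _ :&: _ = set0) ?cards0 //.
  apply/setP=> z; rewrite in_set0 in_setI; apply/negP=> /andP[]; exact: R2_disjoint.
have [_ _ e1] := onD; have [_ _ e2] := onD'.
have v1 : fcard (nx D) predT * 4 = #|D| by apply: card_crossings.
have v2 : fcard (nx D') predT * 4 = #|D'| by apply: card_crossings.
have d1 : fcard (ed D) predT * 2 = #|D| := card_edges D.
have d2 : fcard (ed D') predT * 2 = #|D'| := card_edges D'.
have f12 : fcard (fc D') predT <= (fcard (fc D) predT).+1 := leF.
rewrite {}cardD' in v2 d2; move: e1 e2 v1 v2 d1 d2 f12.
do 6!move: (fcard _ _); move: #|D|; lia.
Qed.

(** Erasing the bigon unites the regions on the left of [nx1 x] and of [nx2 w], whose frames must be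
    matched; as they are distinct by [R2_regions], one frame can be changed alone. The element [m]
    measures how far the two ends of the strand of [nx2 x] are from carrying inverse values. *)
Lemma R2_gauge (G : groupType) (psi : D' -> G) : connection D' psi ->
  exists2 psi', through_connection D' outer psi' &
    forall s, (exists xi : D' -> G, horizontal D' s psi' xi) ->
      exists xi : D' -> G, horizontal D' s psi xi.
Proof.
move=> cpsi; have [c1 c2] := cpsi.
have [m mE] : exists m, m = (psi (nx2 w) * psi (nx2 x))%g by eexists.
pose gam d := if fconnect (fc D') (nx2 w) d then m^-1%g else 1%g.
have gamfc d : gam (fc D' d) = gam d.
  by rewrite /gam -(same_fconnect1_r (@fc_inj _ D')).
have [cpsi' back] := gauge_connection gamfc cpsi.
exists (fun d => gam d * psi d * (gam (ed D' d))^-1)%g => //; split=> //.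
have ged d : gam (ed D' (nx1 d)) = gam d by rewrite -gamfc fc_ed_nx.
have gm : gam (nx2 w) = m^-1%g by rewrite /gam connect0.
have g1 : gam (nx1 x) = 1%g by rewrite /gam (negbTE R2_regions).
have gx : gam (nx3 w) = gam x by rewrite -(gamfc x) /fc ex.
have gw : gam (nx1 w) = gam (nx2 x) by rewrite -(gamfc (nx1 w)) /fc R2_ew1 nx4.
have e1 : psi (nx1 w) = (psi (nx3 x))^-1%g by rewrite -ex3 c1.
have e2 : psi w = (psi x)^-1%g by rewrite -ex c1.
have t2 : (gam (nx2 w) * psi (nx2 w) * (gam (ed D' (nx2 w)))^-1 =
   (gam (nx2 x) * psi (nx2 x) * (gam (ed D' (nx2 x)))^-1)^-1)%g.
  rewrite !ged gw gm g1 invg1 mulg1 mE !invMg -!mulgA.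
  by rewrite mulKg.
(* Multiplying the relations at the two crossings eliminates the edges of the bigon and shows that
   the same [m] corrects the other strand. *)
have t1 : (gam (nx3 w) * psi (nx3 w) * (gam (ed D' (nx3 w)))^-1 =
   (gam (nx1 x) * psi (nx1 x) * (gam (ed D' (nx1 x)))^-1)^-1)%g.
  rewrite !ged gx gm g1 mul1g !invMg invgK invgK -mulgA; congr (_ * _)%g.
  have /eqP := c2 w; rewrite e1 e2 mulg_eq1 invgK divg_eq => /eqP e3.
  by apply/eqP; rewrite -mulg_eq1 mE mulgA e3; have := c2 (nx1 x); rewrite nx4 => ->.
by rewrite /outer => z /or4P[]/eqP->; rewrite ?R2_through1 ?R2_through2 ?R2_through3
  ?R2_through4 ?t1 ?t2 ?invgK.
Qed.

(** In these states each side of the bigon is followed by one arc, and the two arcs have the same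
    ends as the two strands. Since [over D' w = over D' x], exactly one of the crossings is
    A-smoothed, hence the factor [y]. *)
Lemma R2_erased_sum :
  (\sum_(s in smoothings D' | ~~ s (nx3 x) && ~~ s w) weight y y' D' s = y * bracket y y' D)%R.
Proof.
R2_facts.
rewrite -[X in (X * bracket _ _ _)%R]expr1.
apply: (@erased_bracket _ _ _ _ _ _ outer inner R2_erased_gone erD _ _ _ _ pat).
- exact: R2_outer_nx2.
- exact: R2_inner_nx2.
- exact: R2_inner_ed.
- exact: R2_outerN.
- move=> z; rewrite R2_gone !starE /pat.
  case/orP=> /or4P[]/eqP->; rewrite ?nx4 ?eqxx; neqs; by rewrite ?orbT ?orbF.
- move=> s sP; split=> [/andP[sx sw] z|H].
    rewrite R2_gone !starE /pat; rewrite smoothing3 ?negbK // in sx.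
    case/orP=> /or4P[]/eqP->; rewrite ?(smoothing3 _ sP) ?(smoothing2 _ sP) ?(sP x) ?(sP w) ?sx ?eqxx //; neqs;
      by rewrite ?orbT ?negbK ?sx ?(negbTE sw).
  by rewrite !H /pat ?R2_gone ?starE ?eqxx ?orbT //; neqs.
- case: (boolP (over D' x)) => ox.
    rewrite muln1 -(card_star D' x); apply: eq_card => z; rewrite inE R2_gone.
    case: (boolP (z \in star D' x)) => [zx|nzx] /=; last first.
      apply/negP=> /andP[]; rewrite starE /pat.
      by case/or4P=> /eqP->; rewrite ?eqxx; neqs; rewrite ?over_nx overw ox.
    by move: zx; rewrite starE /pat => /or4P[]/eqP->; rewrite ?eqxx; neqs; rewrite ?orbT ?over_nx ox.
  rewrite muln1 -(card_star D' w); apply: eq_card => z; rewrite inE R2_gone orbC.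
  case: (boolP (z \in star D' w)) => [zw|nzw] /=; last first.
    apply/negP=> /andP[]; rewrite starE /pat.
    by case/or4P=> /eqP->; rewrite ?eqxx; neqs; rewrite ?orbT ?over_nx (negbTE ox).
  by move: zw; rewrite starE /pat => /or4P[]/eqP->; rewrite ?eqxx; neqs;
    rewrite ?orbT ?over_nx overw (negbTE ox).
- exact: R2_gauge.
- move=> G F c1 c2 c3.
  (* The value on one side of the bigon is a choice of frame in it; the relation at the crossing of
     [x] then forces the conjugate of [b] on the other side. *)
  pose a := F (nx2 x); pose b := F (nx1 x).
  pose psi z := if z == x then a^-1%g else if z == nx3 x then (a * b * a^-1)^-1%g
                else if z == w then a else if z == nx1 w then (a * b * a^-1)%g else F z.
  have psiF z : ~~ inner z -> psi z = F z by rewrite /psi /inner; do 4!case: eqP.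
  have psi0 : psi x = a^-1%g by rewrite /psi eqxx.
  have psi3 : psi (nx3 x) = (a * b * a^-1)^-1%g by rewrite /psi; neqs; rewrite eqxx.
  have psiw : psi w = a by rewrite /psi; neqs; rewrite eqxx.
  have psiw1 : psi (nx1 w) = (a * b * a^-1)%g by rewrite /psi; neqs; rewrite eqxx.
  have o1 : outer (nx1 x) by rewrite /outer eqxx.
  have o2 : outer (nx2 x) by rewrite /outer eqxx orbT.
  have F3w : F (nx3 w) = b^-1%g by rewrite -R2_through1 c3.
  have F2w : F (nx2 w) = a^-1%g by rewrite -R2_through2 c3.
  exists psi; last by move=> z /R2_kept_inner/psiF.
  split; [split|].
  + move=> z; case: (boolP (inner z)) => [|nz].
      by rewrite /inner => /or4P[]/eqP->;
        rewrite ?ex ?ex3 ?R2_ew ?R2_ew1 ?psi0 ?psi3 ?psiw ?psiw1 ?invgK.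
    by rewrite !psiF ?c2 // R2_not_inner_ed.
  + move=> z; case: (boolP (outer z || inner z)) => gz.
      move: gz; rewrite R2_gone => /orP[]/starP sc; apply: (connection_same_crossing sc).
        rewrite psi0 psi3 !psiF ?R2_outerN // -/a -/b !invMg invgK !mulgA.
        by rewrite !mulgVK mulgV.
      rewrite psiw psiw1 !psiF ?F3w ?F2w ?R2_outerN // /outer ?eqxx ?orbT //.
      by rewrite !mulgA !mulgVK mulVg.
    by rewrite !psiF ?c1 //; apply: R2_kept_inner; rewrite ?R2_gone_nx.
  by move=> z oz; rewrite !psiF ?c3 ?R2_outerN ?R2_outer_through.
- move=> G psi xi s sP /andP[sx sw] [[c1 c2] tpsi] [h1 h2].
  have {}sx : s x by move: sx; rewrite smoothing3 // negbK.
  have j0 := h2 x sx.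
  have j2 : xi (nx3 x) = (psi (nx3 x) * xi (nx2 x))%g by rewrite h2 // smoothing2.
  have k1 : xi (nx2 w) = (psi (nx2 w) * xi (nx1 w))%g by rewrite h2 // sP.
  have k3 : xi w = (psi w * xi (nx3 w))%g by have := h2 (nx3 w); rewrite nx4 smoothing3 // => ->.
  have ew : psi w = (psi x)^-1%g by rewrite -ex c1.
  have P1 : xi (nx1 x) = (psi (nx1 x) * xi (nx3 w))%g.
    by rewrite j0 (h1 x) ex k3 ew mulKVg.
  have P2 : xi (nx2 x) = (psi (nx2 x) * xi (nx2 w))%g.
    have e : xi (nx2 x) = xi (nx1 w) by apply: (@mulgI _ (psi (nx3 x))); rewrite -j2 (h1 (nx3 x)) ex3.
    by rewrite e k1 -R2_through2 tpsi ?mulKVg // /outer eqxx orbT.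
  rewrite /outer => z /or4P[]/eqP->.
  + by rewrite R2_through1.
  + by rewrite R2_through2.
  + by rewrite R2_through3 P2 -R2_through2 tpsi ?mulKg // /outer eqxx orbT.
  by rewrite R2_through4 P1 -R2_through1 tpsi ?mulKg // /outer eqxx.
- move=> G psi xi s sP /andP[sx sw] [[c1 c2] tpsi] h1 h2 h3.
  have {}sx : s x by move: sx; rewrite smoothing3 // negbK.
  pose xi' z := if z == x then ((psi (nx1 x))^-1 * xi (nx1 x))%g
    else if z == nx3 x then (psi (nx3 x) * xi (nx2 x))%g
    else if z == w then (psi w * xi (nx3 w))%g
    else if z == nx1 w then ((psi (nx2 w))^-1 * xi (nx2 w))%g else xi z.
  have xiF z : ~~ inner z -> xi' z = xi z by rewrite /xi' /inner; do 4!case: eqP.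
  have xi0 : xi' x = ((psi (nx1 x))^-1 * xi (nx1 x))%g by rewrite /xi' eqxx.
  have xi3 : xi' (nx3 x) = (psi (nx3 x) * xi (nx2 x))%g by rewrite /xi'; neqs; rewrite eqxx.
  have xiw : xi' w = (psi w * xi (nx3 w))%g by rewrite /xi'; neqs; rewrite eqxx.
  have xiw1 : xi' (nx1 w) = ((psi (nx2 w))^-1 * xi (nx2 w))%g by rewrite /xi'; neqs; rewrite eqxx.
  have o1 : outer (nx1 x) by rewrite /outer eqxx.
  have o2 : outer (nx2 x) by rewrite /outer eqxx orbT.
  have o3 : outer (nx2 w) by rewrite /outer eqxx !orbT.
  have o4 : outer (nx3 w) by rewrite /outer eqxx !orbT.
  have P1 := h2 _ o1; have P2 := h2 _ o2; rewrite R2_through1 in P1; rewrite R2_through2 in P2.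
  have ew : psi w = (psi x)^-1%g by rewrite -ex c1.
  have ew1 : psi (nx1 w) = (psi (nx3 x))^-1%g by rewrite -ex3 c1.
  have e0 : xi' x = (psi x * xi' w)%g by rewrite xi0 P1 mulKg xiw ew mulKVg.
  have e3 : xi' (nx3 x) = (psi (nx3 x) * xi' (nx1 w))%g.
    by rewrite xi3 P2 xiw1 -R2_through2 tpsi // invgK.
  exists xi'; last by move=> z /R2_kept_inner/xiF.
  split=> z.
    case: (boolP (inner z)) => [|nz].
      rewrite /inner => /or4P[]/eqP->; rewrite ?ex ?ex3 ?R2_ew ?R2_ew1 //.
        by rewrite e0 ew mulKg.
      by rewrite e3 ew1 mulKg.
    by rewrite (xiF z nz) xiF; [apply: h1 | apply: R2_not_inner_ed].
  case: (boolP (outer z || inner z)) => gz sz.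
    move: gz sz; rewrite R2_gone !starE => /orP[]/or4P[]/eqP->;
      rewrite ?(smoothing3 _ sP) ?(smoothing2 _ sP) ?(sP x) ?(sP w) ?sx ?(negbTE sw) // => _; rewrite ?nx4.
    * by rewrite xi0 xiF ?mulKVg ?R2_outerN.
    * by rewrite xi3 xiF ?R2_outerN.
    * by rewrite xiw1 xiF ?mulKVg ?R2_outerN.
    by rewrite xiw xiF ?R2_outerN.
  rewrite (xiF z (R2_kept_inner gz)) xiF; first exact: h3.
  by apply: R2_kept_inner; rewrite R2_gone_nx.
move=> s f h sP /andP[sx sw] fs hs H; apply/ffunP=> z.
have {}sx : s x by move: sx; rewrite smoothing3 // negbK.
have [_ f2] := coloringsP fs; have [_ h2] := coloringsP hs.
case: (boolP (inner z)) => [|/H//].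
have s2 : s (nx2 x) by rewrite smoothing2.
have sw1 : s (nx1 w) by rewrite sP.
have sw3 : s (nx3 w) by rewrite smoothing3.
rewrite /inner => /or4P[]/eqP->.
- by rewrite -(f2 x) // -(h2 x) // H // R2_outerN // /outer eqxx.
- by rewrite f2 // h2 // H // R2_outerN // /outer eqxx orbT.
- have := f2 _ sw3; have := h2 _ sw3; rewrite nx4 => -> ->.
  by rewrite H // R2_outerN // /outer eqxx !orbT.
by rewrite -f2 // -h2 // H // R2_outerN // /outer eqxx !orbT.
Qed.

(** The inner darts form the circle inside the bigon. After either flip, the equation lost at one
    crossing is recovered by going round the bigon through the other. *)
Lemma R2_loops (s : {ffun D' -> bool}) : smoothing D' s -> s (nx3 x) -> s w ->
  ((flat D' s <-> flat D' (flip D' (nx3 x) s)) /\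
   circles D' s = (circles D' (flip D' (nx3 x) s)).+1) /\
  ((flat D' s <-> flat D' (flip D' w s)) /\
   circles D' s = (circles D' (flip D' w s)).+1).
Proof.
move=> sP sx sw; R2_facts.
have C1 d : inner (ed D' d) = inner d.
  by apply/idP/idP => /R2_inner_ed //; rewrite ed_invol.
have C2 d : s d -> inner (nx1 d) = inner d.
  have i1 : (nx1 d == x) = (d == nx3 x) by rewrite -[RHS](inj_eq (@nx_inj _ D')) nx4.
  have i2 : (nx1 d == w) = (d == nx3 w) by rewrite -[RHS](inj_eq (@nx_inj _ D')) nx4.
  move=> sd; rewrite /inner !(inj_eq (@nx_inj _ D')) i1 i2.
  have sx0 : s x = false by move: sx; rewrite smoothing3 //; case: (s x).
  have n1 : (d == nx2 x) = false by apply/eqP=> e; rewrite e smoothing2 // sx0 in sd.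
  have n2 : (d == nx3 w) = false by apply/eqP=> e; rewrite e smoothing3 // sw in sd.
  have n3 : (d == x) = false by apply/eqP=> e; rewrite e sx0 in sd.
  have n4 : (d == nx1 w) = false by apply/eqP=> e; rewrite e sP sw in sd.
  by rewrite n1 n2 n3 n4 /= orbF.
have Cx : inner (nx3 x) by rewrite /inner eqxx orbT.
have Cw : inner w by rewrite /inner eqxx !orbT.
have Nx : ~~ inner (nx2 (nx3 x)) by rewrite nx4 R2_outerN // /outer eqxx.
have Nw : ~~ inner (nx2 w) by rewrite R2_outerN // /outer eqxx !orbT.
have loopx (G : groupType) (psi xi : D' -> G) : connection D' psi ->
    horizontal D' (flip D' (nx3 x) s) psi xi -> join D' psi xi (nx3 x).
  move=> [c1 _] [h1 h2].
  have fw : flip D' (nx3 x) s w.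
    rewrite flipE sw !star_nxl addbT; apply/negP=> /R2_disjoint; apply; exact: star_id.
  have ew1 : psi (nx1 w) = (psi (nx3 x))^-1%g by rewrite -ex3 c1.
  have := h2 _ fw; rewrite /join nx4 (h1 x) (h1 (nx3 x)) ex ex3 => ->.
  by rewrite ew1 mulKVg.
have loopw (G : groupType) (psi xi : D' -> G) : connection D' psi ->
    horizontal D' (flip D' w s) psi xi -> join D' psi xi w.
  move=> [c1 _] [h1 h2].
  have fx : flip D' w s (nx3 x).
    rewrite flipE sx !star_nx addbT; apply/negP; apply: R2_disjoint; exact: star_id.
  have ew1 : psi (nx1 w) = (psi (nx3 x))^-1%g by rewrite -ex3 c1.
  have := h2 _ fx; rewrite nx4 (h1 x) ex => /mulgI e.
  by rewrite /join e (h1 (nx3 x)) ex3 ew1 mulKg.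
split; split.
- exact: flat_flip_loop C1 C2 Cx Nx loopx.
- exact: circles_flip_loop C1 C2 Cx Nx loopx.
- exact: flat_flip_loop C1 C2 Cw Nw loopw.
exact: circles_flip_loop C1 C2 Cw Nw loopw.
Qed.

(** Of the four smoothings of the two crossings, the one closing the bigon cancels against the two
    at one flip from it; the fourth lets the strands pass. *)
Lemma R2_bracket : bracket_equiv y y' D D'.
Proof.
exists false, 1, 0; rewrite expr1 expr0 !mul1r -R2_erased_sum.
have wx : w \notin star D' (nx3 x).
  by rewrite !star_nxl; apply/negP=> /R2_disjoint; apply; apply: star_id.
have xw' : nx3 x \notin star D' w.
  by rewrite !star_nx; apply/negP; apply: R2_disjoint; apply: star_id.
rewrite (@bracket_cancel _ _ _ _ D' predT (nx3 x) w) //.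
move=> s sP _ sx sw; have [[? ?] [? ?]] := R2_loops sP sx sw.
by apply: weight_flip_loops => //; rewrite sx sw !over_nx overw; case: (over D' x).
Qed.

End SecondMove.

(** * The third move *)

Definition triangle (T : Type) (M : diagram T) (t0 t1 t2 : T) : Prop :=
  [/\ ed M t0 = nx M t1, ed M t1 = nx M t2, ed M t2 = nx M t0 &
    [/\ ~ same_crossing M t0 t1, ~ same_crossing M t1 t2 & ~ same_crossing M t2 t0]].

Lemma triangle_rot (T : Type) (M : diagram T) t0 t1 t2 :
  triangle M t0 t1 t2 -> triangle M t1 t2 t0.
Proof. by case=> ? ? ? [? ? ?]; split=> //; split. Qed.

Section TriangleLoops.
Local Open Scope group_scope.
Variables (T : finType) (M : diagram T).

Definition sides (t0 t1 t2 z : T) :=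
  [|| z == t0, z == t1, z == t2, z == nx M t0, z == nx M t1 | z == nx M t2].

Lemma sides_rot t0 t1 t2 z : sides t1 t2 t0 z = sides t0 t1 t2 z.
Proof. by rewrite /sides; do 6!case: (_ == _). Qed.

Lemma sides_ed t0 t1 t2 z : triangle M t0 t1 t2 -> sides t0 t1 t2 (ed M z) = sides t0 t1 t2 z.
Proof.
case=> e0 e1 e2 _.
have H w : sides t0 t1 t2 w -> sides t0 t1 t2 (ed M w).
  have [f0 f1 f2] : [/\ ed M (nx M t1) = t0, ed M (nx M t2) = t1 & ed M (nx M t0) = t2].
    by rewrite -e0 -e1 -e2 !ed_invol.
  by rewrite /sides => /or4P[| | |/or3P[]]/eqP->;
    rewrite ?e0 ?e1 ?e2 ?f0 ?f1 ?f2 ?eqxx ?orbT.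
by apply/idP/idP => /H; rewrite ?ed_invol.
Qed.

(** The triangle lies on the left of the three darts, and the equations at [t1] and [t2] say that
    the section has the same value there along all three sides. *)
Lemma triangle_join (G : groupType) (psi xi : T -> G) t0 t1 t2 : triangle M t0 t1 t2 ->
  connection M psi -> (forall d, xi d = psi d * xi (ed M d)) ->
  join M psi xi t1 -> join M psi xi t2 -> join M psi xi t0.
Proof.
case=> e0 e1 e2 _ [c1 _] h1 j1 j2.
have k0 : psi (nx M t1) = (psi t0)^-1 by rewrite -e0 c1.
have k1 : psi (nx M t2) = (psi t1)^-1 by rewrite -e1 c1.
have k2 : psi (nx M t0) = (psi t2)^-1 by rewrite -e2 c1.
have x01 : xi t0 = xi t1 by rewrite (h1 t0) e0 j1 k0 mulKVg.
have x12 : xi t1 = xi t2 by rewrite (h1 t1) e1 j2 k1 mulKVg.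
by rewrite /join x01 x12 k2 (h1 t2) e2 mulKg.
Qed.

Lemma triangle_loop t0 t1 t2 (s : {ffun T -> bool}) : triangle M t0 t1 t2 ->
  smoothing M s -> s t0 -> s t1 -> s t2 ->
  (flat M s <-> flat M (flip M t0 s)) /\ circles M s = (circles M (flip M t0 s)).+1.
Proof.
move=> tri sP s0 s1 s2; have [e0 e1 e2 [n01 n12 n20]] := tri.
have [[? ? ?] ? ? ?] := star_neq M t0; have := star_cross n01; rewrite /= !andbT.
case/and4P=> _ _ /and4P[? ? _ _] _.
have := star_cross n20; rewrite /= !andbT => /and4P[/and4P[_ _ ? _] /and4P[_ _ ? _] _ _].
have C1 d := sides_ed d tri.
have C2 d : s d -> sides t0 t1 t2 (nx M d) = sides t0 t1 t2 d.
  move=> sd; rewrite /sides !(inj_eq (@nx_inj _ M)).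
  have nt t : s t -> (nx M d == t) = false.
    by move=> st; apply/eqP=> e; move: st; rewrite -e sP sd.
  have nnt t : s t -> (d == nx M t) = false.
    by move=> st; apply/eqP=> e; move: sd; rewrite e sP st.
  by rewrite !nt // !nnt //; do 3!case: (_ == _).
have Cx : sides t0 t1 t2 t0 by rewrite /sides eqxx.
have Cn : ~~ sides t0 t1 t2 (nx M (nx M t0)) by rewrite /sides; neqs.
have loop (G : groupType) (psi xi : T -> G) : connection M psi ->
    horizontal M (flip M t0 s) psi xi -> join M psi xi t0.
  move=> cpsi [h1 h2]; apply: (triangle_join tri) => //; apply: h2; rewrite flipE ?s1 ?s2.
    by rewrite addbT; apply/starP.
  by rewrite addbT; apply/negP; apply: (star_disjoint n20 (star_id M t2)).
split; first exact: flat_flip_loop C1 C2 Cx Cn loop.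
exact: circles_flip_loop C1 C2 Cx Cn loop.
Qed.

Section Cancel.
Variables (K : comNzRingType) (y y' : K).
Hypothesis yy' : (y * y' = 1)%R.

(** Among the states joining [t2] to [nx M t2], those closing the triangle into a circle cancel
    against those obtained by one flip at [t0] or [t1]. The condition on [over] makes these flips
    change the A-count in opposite directions. *)
Lemma triangle_bracket t0 t1 t2 : triangle M t0 t1 t2 -> over M t0 != over M t1 ->
  bracket y y' M
  = (\sum_(s in smoothings M | s t2 ==> ~~ s t0 && ~~ s t1) weight y y' M s)%R.
Proof.
move=> tri o01; have [_ _ _ [n01 n12 n20]] := tri.
have dis a b : ~ same_crossing M a b -> (b \notin star M a) /\ (a \notin star M b).
  move=> ab; split; apply/negP=> H.
    exact: (star_disjoint ab H (star_id M b)).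
  exact: (star_disjoint ab (star_id M a) H).
have [d1 d2] := dis _ _ n01; have [d3 d4] := dis _ _ n12; have [d5 d6] := dis _ _ n20.
rewrite (@bracket_cancel _ y y' _ M (fun s => s t2) t0 t1) //.
- by move=> s; rewrite flipE (negbTE d6).
- by move=> s; rewrite flipE (negbTE d3).
move=> s sP s2 s0 s1.
have [f0 c0] := triangle_loop tri sP s0 s1 s2.
have [f1 c1] := triangle_loop (triangle_rot tri) sP s1 s2 s0.
by apply: weight_flip_loops => //; rewrite s0 s1; case: (over M t0) (over M t1) o01 => -[].
Qed.
End Cancel.
End TriangleLoops.

(** * Moving a strand across a triangle *)

Section Slide.
Local Open Scope group_scope.
Variables (T : finType) (M N : diagram T) (t0 t1 t2 : T).
Local Notation nx1 z := (nx M z).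
Local Notation nx2 z := (nx M (nx M z)).
Local Notation nx3 z := (nx M (nx M (nx M z))).
Local Notation side := (sides M t0 t1 t2).

(** An outer dart opposite to a side of the triangle is sent to the far end of that side, where the
    edge coming from outside is attached in [N]. [unslid] goes back, from the darts outside the
    triangle of [N] to those outside the triangle of [M]. *)
Definition slid z := if side (nx2 z) then ed M (nx2 z) else z.
Definition unslid z := if side z then ed N (nx2 z) else z.

Hypotheses (nxE : forall d, nx N d = nx M d) (triM : triangle M t0 t1 t2)
  (triN : triangle N (nx2 t0) (nx2 t1) (nx2 t2))
  (slid_ed : forall z, ~~ side z -> ed N (slid z) = slid (ed M z)).

Ltac triangle_facts :=
  have [_ _ _ [n01 n12 n20]] := triM;
  have [[? ? ?] ? ? ?] := star_neq M t0; have [[? ? ?] ? ? ?] := star_neq M t1;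
  have [[? ? ?] ? ? ?] := star_neq M t2;
  have := star_cross n20; have := star_cross n12; have := star_cross n01;
  rewrite /= !andbT;
  case/and4P=> /and4P[? ? ? ?] /and4P[? ? ? ?] /and4P[? ? ? ?] /and4P[? ? ? ?];
  case/and4P=> /and4P[? ? ? ?] /and4P[? ? ? ?] /and4P[? ? ? ?] /and4P[? ? ? ?];
  case/and4P=> /and4P[? ? ? ?] /and4P[? ? ? ?] /and4P[? ? ? ?] /and4P[? ? ? ?].

Lemma side_nx2 z : side z -> ~~ side (nx2 z).
Proof.
triangle_facts.
by rewrite /sides => /or4P[| | |/or3P[]]/eqP->; neqs.
Qed.

Lemma edM : [/\ ed M t0 = nx1 t1, ed M t1 = nx1 t2, ed M t2 = nx1 t0 &
  [/\ ed M (nx1 t1) = t0, ed M (nx1 t2) = t1 & ed M (nx1 t0) = t2]].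
Proof. by case: triM => e0 e1 e2 _; split=> //; rewrite -e0 -e1 -e2 !ed_invol. Qed.

Lemma edN : [/\ ed N (nx2 t0) = nx3 t1, ed N (nx2 t1) = nx3 t2, ed N (nx2 t2) = nx3 t0 &
  [/\ ed N (nx3 t1) = nx2 t0, ed N (nx3 t2) = nx2 t1 & ed N (nx3 t0) = nx2 t2]].
Proof.
case: triN => e0 e1 e2 _; rewrite !nxE in e0 e1 e2.
by split=> //; rewrite -e0 -e1 -e2 !ed_invol.
Qed.

Lemma side_edN z : side z -> side (nx2 (ed N (nx2 z))).
Proof.
have [f0 f1 f2 [f3 f4 f5]] := edN.
by rewrite /sides => /or4P[| | |/or3P[]]/eqP->;
  rewrite ?f0 ?f1 ?f2 ?f3 ?f4 ?f5 ?nx4 eqxx ?orbT.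
Qed.

Lemma unslidK z : side z -> ed M (nx2 (ed N (nx2 z))) = z.
Proof.
have [f0 f1 f2 [f3 f4 f5]] := edN; have [e0 e1 e2 [e3 e4 e5]] := edM.
by rewrite /sides => /or4P[| | |/or3P[]]/eqP->;
  rewrite ?f0 ?f1 ?f2 ?f3 ?f4 ?f5 nx4 ?e0 ?e1 ?e2 ?e3 ?e4 ?e5.
Qed.

Lemma slid_not_side z : ~~ side z -> ~~ side (nx2 (slid z)).
Proof.
rewrite /slid; case: (boolP (side (nx2 z))) => [s2 _|//].
by apply: side_nx2; rewrite (sides_ed _ triM).
Qed.

Lemma unslid_not_side z : ~~ side (nx2 z) -> ~~ side (unslid z).
Proof.
rewrite /unslid; case: (boolP (side z)) => [sz _|//].
by apply: contraL (side_edN sz) => /side_nx2.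
Qed.

Lemma unslid_slid z : ~~ side z -> unslid (slid z) = z.
Proof.
rewrite /slid /unslid => nz; case: (boolP (side (nx2 z))) => sz; last by rewrite (negbTE nz).
rewrite (sides_ed _ triM) sz.
have [f0 f1 f2 [f3 f4 f5]] := edN; have [e0 e1 e2 [e3 e4 e5]] := edM.
rewrite -[RHS](nx4 M); move: sz; rewrite /sides => /or4P[| | |/or3P[]]/eqP->;
  by rewrite ?e0 ?e1 ?e2 ?e3 ?e4 ?e5 ?f0 ?f1 ?f2 ?f3 ?f4 ?f5.
Qed.

Lemma slid_unslid z : ~~ side (nx2 z) -> slid (unslid z) = z.
Proof.
rewrite /unslid => nz; case: (boolP (side z)) => sz; last by rewrite /slid (negbTE nz).
by rewrite /slid side_edN // unslidK.
Qed.

Lemma unslid_ed z : ~~ side (nx2 z) -> unslid (ed N z) = ed M (unslid z).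
Proof.
move=> nz; have nu := unslid_not_side nz.
rewrite -{1}(slid_unslid nz) slid_ed // unslid_slid //.
by rewrite (sides_ed _ triM).
Qed.

Section Connection.
Variables (G : groupType) (psi : T -> G).
Let a0 := psi (nx2 t0). Let a1 := psi (nx2 t1). Let a2 := psi (nx2 t2).
Let b0 := psi (nx3 t0). Let b1 := psi (nx3 t1). Let b2 := psi (nx3 t2).
Let e0 := psi t0. Let e1 := psi t1. Let e2 := psi t2.

(* The transport around each crossing determines the values on the sides of the
   new triangle, up to the choice of a frame in it. *)
Definition slid_connection z : G :=
  if side (nx2 z) then
    if z == nx2 t0 then (a2 * b1)^-1 else if z == nx3 t1 then a2 * b1
    else if z == nx2 t1 then a1 * b0 else if z == nx3 t2 then (a1 * b0)^-1 else 1
  else psi (unslid z).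

Hypothesis cpsi : connection M psi.

Lemma slid_values : [/\ [/\ slid_connection t0 = b1, slid_connection t1 = b2 & slid_connection t2 = b0],
  [/\ slid_connection (nx1 t1) = a0, slid_connection (nx1 t2) = a1 & slid_connection (nx1 t0) = a2],
  [/\ slid_connection (nx2 t0) = (a2 * b1)^-1, slid_connection (nx2 t1) = a1 * b0
    & slid_connection (nx2 t2) = 1]
  & [/\ slid_connection (nx3 t1) = a2 * b1, slid_connection (nx3 t2) = (a1 * b0)^-1
    & slid_connection (nx3 t0) = 1]].
Proof.
have [f0 f1 f2 [f3 f4 f5]] := edN.
have s t : [|| t == t0, t == t1 | t == t2] -> side t /\ side (nx1 t).
  by rewrite /sides => /or3P[]/eqP->; rewrite !eqxx ?orbT.
have [s0 s0'] : side t0 /\ side (nx1 t0) by apply: s; rewrite eqxx.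
have [s1 s1'] : side t1 /\ side (nx1 t1) by apply: s; rewrite eqxx orbT.
have [s2 s2'] : side t2 /\ side (nx1 t2) by apply: s; rewrite eqxx !orbT.
triangle_facts.
by rewrite /slid_connection /unslid !nx4 s0 s1 s2 s0' s1' s2' !(negbTE (side_nx2 _)) //
  f0 f1 f2 f3 f4 f5 !eqxx; split; split=> //; neqs.
Qed.

(** Solving the relations at the three crossings for the [b] leaves only the [a] and the [e], and
    the later identities reduce to cancellations. *)
Lemma vertex_values : [/\ b0 = e0^-1 * e2 * a0^-1, b1 = e1^-1 * e0 * a1^-1
  & b2 = e2^-1 * e1 * a2^-1].
Proof.
have [c1 c2] := cpsi; have [d0 d1 d2 [d3 d4 d5]] := edM.
have k1 : psi (nx1 t1) = e0^-1 by rewrite -d0 c1.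
have k2 : psi (nx1 t2) = e1^-1 by rewrite -d1 c1.
have k0 : psi (nx1 t0) = e2^-1 by rewrite -d2 c1.
have sol (p q r u : G) : p * q * r^-1 * u = 1 -> p = u^-1 * r * q^-1.
  by move=> /eqP; rewrite mulg_eq1 divg_eq => /eqP <-; rewrite mulgK.
have := c2 t0; have := c2 t1; have := c2 t2; rewrite k0 k1 k2 => /sol v2 /sol v1 /sol v0.
by split.
Qed.

Lemma slid_connectionP : connection N slid_connection.
Proof.
have [[v0 v1 v2] [v3 v4 v5] [v6 v7 v8] [v9 v10 v11]] := slid_values.
have [w0 w1 w2] := vertex_values; have [f0 f1 f2 [f3 f4 f5]] := edN.
have [c1 c2] := cpsi; split=> z.
  case: (boolP (side (nx2 z))) => sz.
    rewrite -(nx4 M z); move: sz; rewrite /sides => /or4P[| | |/or3P[]]/eqP->;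
    by rewrite ?f0 ?f1 ?f2 ?f3 ?f4 ?f5 ?v6 ?v7 ?v8 ?v9 ?v10 ?v11 ?invgK ?invg1.
  have nez : ~~ side (nx2 (ed N z)).
    by apply: contra sz => /side_edN; rewrite nx4 ed_invol.
  by rewrite /slid_connection (negbTE sz) (negbTE nez) unslid_ed.
rewrite !nxE; case: (boolP [|| z \in star M t0, z \in star M t1 | z \in star M t2]) => sz.
  have rot a b : b \in star M a ->
    slid_connection (nx3 a) * slid_connection (nx2 a) * slid_connection (nx1 a)
      * slid_connection a = 1 ->
    slid_connection (nx3 b) * slid_connection (nx2 b) * slid_connection (nx1 b)
      * slid_connection b = 1.
    by move/starP=> ab; apply: connection_same_crossing.
  case/or3P: sz => /rot; apply; rewrite ?v0 ?v1 ?v2 ?v3 ?v4 ?v5 ?v6 ?v7 ?v8 ?v9 ?v10 ?v11;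
    rewrite ?w0 ?w1 ?w2 ?invMg ?invgK ?mulgA ?mul1g ?mulg1 ?(mulgVK, mulgK, mulVg, mulgV) //.
have sside d : side d -> [|| d \in star M t0, d \in star M t1 | d \in star M t2].
  by rewrite /sides !starE => /or4P[| | |/or3P[]] ->; rewrite ?orbT.
have out d : [|| d \in star M t0, d \in star M t1 | d \in star M t2] = false ->
    slid_connection d = psi d.
  move=> nd; rewrite /slid_connection /unslid.
  have -> : side (nx2 d) = false by apply: contraFF nd => /sside; rewrite !star_nx.
  by have -> : side d = false by apply: contraFF nd => /sside.
by rewrite !out ?star_nx ?(negbTE sz).
Qed.

(* The values on the sides of the triangle of [M]: [u i] on the side leaving
   [t i], [v i] on the one arriving at [nx t i]. *)
Lemma fill_triangle (s : {ffun T -> bool}) (xi : T -> G) (u0 u1 u2 v0 v1 v2 : G) :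
  smoothing M s -> (forall z, ~~ side z -> xi z = psi z * xi (ed M z)) ->
  (forall z, ~~ [|| z \in star M t0, z \in star M t1 | z \in star M t2] ->
     s z -> xi (nx1 z) = psi (nx1 z) * xi z) ->
  [/\ u0 = e0 * v1, u1 = e1 * v2 & u2 = e2 * v0] ->
  (if s t0 then v0 = e2^-1 * u0 /\ xi (nx3 t0) = b0 * xi (nx2 t0)
   else xi (nx2 t0) = a0 * v0 /\ u0 = e0 * xi (nx3 t0)) ->
  (if s t1 then v1 = e0^-1 * u1 /\ xi (nx3 t1) = b1 * xi (nx2 t1)
   else xi (nx2 t1) = a1 * v1 /\ u1 = e1 * xi (nx3 t1)) ->
  (if s t2 then v2 = e1^-1 * u2 /\ xi (nx3 t2) = b2 * xi (nx2 t2)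
   else xi (nx2 t2) = a2 * v2 /\ u2 = e2 * xi (nx3 t2)) ->
  exists2 xi', horizontal M s psi xi' & forall z, ~~ side z -> xi' z = xi z.
Proof.
move=> sP h1 h2 [g0 g1 g2] j0 j1 j2.
pose xi' z := if z == t0 then u0 else if z == t1 then u1 else if z == t2 then u2
  else if z == nx1 t0 then v0 else if z == nx1 t1 then v1 else if z == nx1 t2 then v2
  else xi z.
have xiF z : ~~ side z -> xi' z = xi z.
  by rewrite /xi' /sides; do 6!case: (_ == _).
have [d0 d1 d2 [d3 d4 d5]] := edM; have [c1 c2] := cpsi.
have k1 : psi (nx1 t1) = e0^-1 by rewrite -d0 c1.
have k2 : psi (nx1 t2) = e1^-1 by rewrite -d1 c1.
have k0 : psi (nx1 t0) = e2^-1 by rewrite -d2 c1.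
have [x0 x1 x2 [x3 x4 x5]] : [/\ xi' t0 = u0, xi' t1 = u1, xi' t2 = u2
    & [/\ xi' (nx1 t0) = v0, xi' (nx1 t1) = v1 & xi' (nx1 t2) = v2]].
  by triangle_facts; rewrite /xi' !eqxx; split; [| | | split]; neqs.
have s_t t : [|| t == t0, t == t1 | t == t2] -> ~~ side (nx2 t) /\ ~~ side (nx3 t).
  by move=> tt; split; apply: side_nx2; rewrite /sides; case/or3P: tt => /eqP->;
    rewrite !eqxx ?orbT.
have [y0 z0] : ~~ side (nx2 t0) /\ ~~ side (nx3 t0) by apply: s_t; rewrite eqxx.
have [y1 z1] : ~~ side (nx2 t1) /\ ~~ side (nx3 t1) by apply: s_t; rewrite eqxx orbT.
have [y2 z2] : ~~ side (nx2 t2) /\ ~~ side (nx3 t2) by apply: s_t; rewrite eqxx !orbT.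
exists xi' => //; split=> z.
  case: (boolP (side z)) => sz; last first.
    by rewrite !xiF ?(sides_ed _ triM) //; apply: h1.
  move: sz; rewrite /sides => /or4P[| | |/or3P[]]/eqP->;
    rewrite ?d0 ?d1 ?d2 ?d3 ?d4 ?d5 ?x0 ?x1 ?x2 ?x3 ?x4 ?x5 ?k0 ?k1 ?k2 //.
  - by rewrite g2 mulKg.
  - by rewrite g0 mulKg.
  by rewrite g1 mulKg.
have crossing t u v a b e p : xi' t = u -> xi' (nx1 t) = v -> xi' (nx2 t) = xi (nx2 t) -> xi' (nx3 t) = xi (nx3 t) ->
  psi (nx1 t) = p^-1 -> psi (nx2 t) = a -> psi (nx3 t) = b -> psi t = e ->
  (if s t then v = p^-1 * u /\ xi (nx3 t) = b * xi (nx2 t)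
   else xi (nx2 t) = a * v /\ u = e * xi (nx3 t)) ->
  z \in star M t -> s z -> xi' (nx1 z) = psi (nx1 z) * xi' z.
  move=> w0 w1 w2 w3 q1 q2 q3 q0; case: ifP => st [r1 r2]; rewrite starE.
    by case/or4P=> /eqP->; rewrite ?(smoothing3 _ sP) ?(smoothing2 _ sP) ?sP ?st // => _;
      rewrite ?nx4 ?w0 ?w1 ?w2 ?w3 ?q0 ?q1 ?q2 ?q3.
  by case/or4P=> /eqP->; rewrite ?(smoothing3 _ sP) ?(smoothing2 _ sP) ?sP ?st // => _;
    rewrite ?nx4 ?w0 ?w1 ?w2 ?w3 ?q0 ?q1 ?q2 ?q3.
case: (boolP [|| z \in star M t0, z \in star M t1 | z \in star M t2]) => [/or3P[]|nz sz].
- by apply: (crossing t0 u0 v0 a0 b0 e0 e2); rewrite // xiF.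
- by apply: (crossing t1 u1 v1 a1 b1 e1 e0); rewrite // xiF.
- by apply: (crossing t2 u2 v2 a2 b2 e2 e1); rewrite // xiF.
have sside d : side d -> [|| d \in star M t0, d \in star M t1 | d \in star M t2].
  by rewrite /sides !starE => /or4P[| | |/or3P[]] ->; rewrite ?orbT.
rewrite !xiF; first exact: h2.
  by apply: contra nz => /sside.
by apply: contra nz => /sside; rewrite !star_nx.
Qed.

End Connection.

(* The strand through [t0] is moved across the crossing of [t2]; when the latter
   is smoothed so as to let it pass, it meets the two other strands in the
   opposite order. *)
Definition slid_state (s : {ffun T -> bool}) :=
  if s t2 || (s t0 != s t1) then s else flip M t0 (flip M t1 s).

(** Five smoothings of the triangle are left: one with [s t2], four without. In each, the section of
    [N] is kept on the edges coming from outside and refilled on the sides of the triangle of [M];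
    the equations that remain compare transports on the two sides of the moved strand. *)
Lemma slid_horizontal (G : groupType) (psi xi : T -> G) (s : {ffun T -> bool}) :
  connection M psi -> smoothing M s -> (s t2 ==> ~~ s t0 && ~~ s t1) ->
  horizontal N (slid_state s) (slid_connection psi) xi ->
  exists2 xi', horizontal M s psi xi' & forall z, ~~ side z -> xi' z = xi (slid z).
Proof.
move=> cpsi sP good [h1 h2].
have [[v0 v1 v2] [v3 v4 v5] [v6 v7 v8] [v9 v10 v11]] := slid_values psi.
have [f0 f1 f2 [f3 f4 f5]] := edN; have [w0 w1 w2] := vertex_values cpsi.
have [d0 d1 d2 [d3 d4 d5]] := edM.
have tP : smoothing M (slid_state s).
  by rewrite /slid_state; case: ifP => // _; do 2!apply: flip_smoothing.
have t_out z : ~~ [|| z \in star M t0, z \in star M t1 | z \in star M t2] ->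
    slid_state s z = s z.
  rewrite /slid_state; case: ifP => // _; rewrite !negb_or => /and3P[z0 z1 z2].
  by rewrite !flipE (negbTE z0) (negbTE z1).
have sside d : side d -> [|| d \in star M t0, d \in star M t1 | d \in star M t2].
  by rewrite /sides !starE => /or4P[| | |/or3P[]] ->; rewrite ?orbT.
have psi_slid z : ~~ side z -> slid_connection psi (slid z) = psi z.
  by move=> nz; rewrite /slid_connection (negbTE (slid_not_side nz)) unslid_slid.
have H1 z : ~~ side z -> xi (slid z) = psi z * xi (slid (ed M z)).
  by move=> nz; rewrite h1 slid_ed // psi_slid.
have slid_out z : ~~ [|| z \in star M t0, z \in star M t1 | z \in star M t2] -> slid z = z.
  move=> nz; rewrite /slid; case: ifP => // /sside; rewrite !star_nx => nz'.
  by rewrite nz' in nz.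
have H2 z : ~~ [|| z \in star M t0, z \in star M t1 | z \in star M t2] ->
     s z -> xi (slid (nx1 z)) = psi (nx1 z) * xi (slid z).
  move=> nz sz; have nz1 : ~~ [|| nx1 z \in star M t0, nx1 z \in star M t1 | nx1 z \in star M t2].
    by rewrite !star_nx.
  rewrite -psi_slid; last by apply: contra nz1 => /sside.
  by rewrite !slid_out // -nxE h2 // t_out.
have sl t : [|| t == t0, t == t1 | t == t2] -> slid (nx2 t) = ed M t /\
    slid (nx3 t) = ed M (nx1 t).
  move=> tt; have [st st1] : side t /\ side (nx1 t).
    by rewrite /sides; case/or3P: tt => /eqP->; rewrite !eqxx ?orbT.
  by rewrite /slid !nx4 st st1.
have [A0 B0] : slid (nx2 t0) = nx1 t1 /\ slid (nx3 t0) = t2.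
  by have := sl t0; rewrite eqxx d0 d5; apply.
have [A1 B1] : slid (nx2 t1) = nx1 t2 /\ slid (nx3 t1) = t0.
  by have := sl t1; rewrite eqxx orbT d1 d3; apply.
have [A2 B2] : slid (nx2 t2) = nx1 t0 /\ slid (nx3 t2) = t1.
  by have := sl t2; rewrite eqxx !orbT d2 d4; apply.
have fill u0 u1 u2 u3 u4 u5 := @fill_triangle G psi cpsi s (xi \o slid) u0 u1 u2 u3 u4 u5 sP H1 H2.
rewrite /= A0 A1 A2 B0 B1 B2 in fill.
have g0 := h1 (nx2 t0); have g1 := h1 (nx2 t1); have g2 := h1 (nx2 t2).
rewrite f0 v6 in g0; rewrite f1 v7 in g1; rewrite f2 v8 mul1g in g2.
have joins t : if slid_state s t then
     xi (nx1 t) = slid_connection psi (nx1 t) * xi t /\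
     xi (nx3 t) = slid_connection psi (nx3 t) * xi (nx2 t)
   else xi (nx2 t) = slid_connection psi (nx2 t) * xi (nx1 t) /\
     xi t = slid_connection psi t * xi (nx3 t).
  have J d : slid_state s d -> xi (nx1 d) = slid_connection psi (nx1 d) * xi d.
    by move=> /h2; rewrite nxE.
  case: ifP => st; split; try by apply: J; rewrite ?(smoothing2 _ tP) ?(tP t) ?st.
  by have := J (nx3 t); rewrite nx4; apply; rewrite (smoothing3 _ tP) st.
have := joins t0; have := joins t1; have := joins t2; rewrite v0 v1 v2 v3 v4 v5 v6 v7 v8 v9 v10 v11 !mul1g.
have dis a b : ~ same_crossing M a b -> (b \notin star M a) /\ (a \notin star M b).
  move=> ab; split; apply/negP=> H.
    exact: (star_disjoint ab H (star_id M b)).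
  exact: (star_disjoint ab (star_id M a) H).
have [_ _ _ [/dis[m01 m10] /dis[m12 m21] /dis[m20 m02]]] := triM.
have st0 : slid_state s t0 = if s t2 || (s t0 != s t1) then s t0 else ~~ s t0.
  by rewrite /slid_state; case: ifP; rewrite // !flipE star_id (negbTE m10).
have st1 : slid_state s t1 = if s t2 || (s t0 != s t1) then s t1 else ~~ s t1.
  by rewrite /slid_state; case: ifP; rewrite // !flipE star_id (negbTE m01).
have st2 : slid_state s t2 = s t2.
  by rewrite /slid_state; case: ifP; rewrite // !flipE (negbTE m02) (negbTE m12).
rewrite st0 st1 st2; move: good fill; clear - w0 w1 w2 g0 g1 g2.
have norm := (@mulgA G, @mulgVK G, @mulgK G, @mulVg G, @mulgV G, @mul1g G, @mulg1 G, @invMg G, @invgK G).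
case: (s t2) => /= [/andP[/negbTE-> /negbTE->]|_] fill.
  move=> [p2 q2] [p1 q1] [p0 q0].
  have k1 : xi (nx3 t1) = xi (nx1 t0) by apply: (@mulgI _ ((psi (nx2 t2) * psi (nx3 t1))^-1)); rewrite -g0 p0.
  have k2 : xi (nx3 t2) = xi (nx1 t1) by apply: (@mulgI _ (psi (nx2 t1) * psi (nx3 t0))); rewrite -g1 p1.
  (* Here and below, each value on a side is read either on an outer edge, through the smoothing, or
     at the other end of the side. *)
  apply: (fill (psi t0 * xi t2) (psi t1 * xi t0) (psi t2 * ((psi (nx2 t0))^-1 * xi (nx1 t1)))
    ((psi (nx2 t0))^-1 * xi (nx1 t1)) (xi t2) (xi t0)); split=> //; rewrite ?mulKVg //.
    by rewrite q0 -g2 -k2 q2 w0 w1 !norm.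
  by rewrite q1 k1.
case: (s t0) fill; case: (s t1) => /= fill [p2 q2] [p1 q1] [p0 q0].
- have k1 : xi (nx3 t1) = xi (nx1 t0) by apply: (@mulgI _ ((psi (nx2 t2) * psi (nx3 t1))^-1)); rewrite -g0 p0.
  have k2 : xi (nx3 t2) = xi (nx1 t1) by apply: (@mulgI _ (psi (nx2 t1) * psi (nx3 t0))); rewrite -g1 p1.
  have k0 : xi (nx3 t0) = xi (nx1 t2) by rewrite -g2 p2.
  apply: (fill (psi t2 * xi t1) (psi t1 * ((psi (nx2 t2))^-1 * xi (nx1 t0))) (psi t2 * xi t1)
    (xi t1) ((psi t0)^-1 * (psi t2 * xi t1)) ((psi (nx2 t2))^-1 * xi (nx1 t0))); split=> //;
    rewrite ?mulKVg ?mulKg //.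
  + by rewrite q2 k2.
  + by rewrite q1 k1 w2 !norm.
  by rewrite q0 k0.
- have k2 : xi (nx3 t2) = xi (nx1 t1) by apply: (@mulgI _ (psi (nx2 t1) * psi (nx3 t0))); rewrite -g1 p1.
  apply: (fill (psi t0 * ((psi (nx2 t1))^-1 * xi (nx1 t2))) (psi t1 * xi t0) (psi t2 * xi t1)
    (xi t1) ((psi (nx2 t1))^-1 * xi (nx1 t2)) ((psi (nx2 t2))^-1 * xi (nx1 t0))); split=> //;
    rewrite ?mulKVg //.
  + by rewrite p0 mulKg.
  + by rewrite q1 -p2 g2 q0 g0 w1 w2 !norm.
  by rewrite q2 k2.
- have k1 : xi (nx3 t1) = xi (nx1 t0) by apply: (@mulgI _ ((psi (nx2 t2) * psi (nx3 t1))^-1)); rewrite -g0 p0.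
  have k0 : xi (nx3 t0) = xi (nx1 t2) by rewrite -g2 p2.
  apply: (fill (psi t0 * xi t2) (psi t1 * ((psi (nx2 t2))^-1 * xi (nx1 t0))) (psi t2 * xi t1)
    ((psi (nx2 t0))^-1 * xi (nx1 t1)) (xi t2) ((psi (nx2 t2))^-1 * xi (nx1 t0))); split=> //;
    rewrite ?mulKVg //.
  + by rewrite p1 mulKg.
  + by rewrite q2 -k1 q1 g1 w0 w1 !norm.
  by rewrite q0 k0.
apply: (fill (psi t0 * xi t2) (psi t1 * xi t0) (psi t2 * xi t1) ((psi (nx2 t0))^-1 * xi (nx1 t1))
  ((psi (nx2 t1))^-1 * xi (nx1 t2)) ((psi (nx2 t2))^-1 * xi (nx1 t0))); split=> //;
  rewrite ?mulKVg //.
- by rewrite -p2 g2 q0 g0 q1 mulKg g1 q2 w0 !norm.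
- by rewrite p0 mulKg.
by rewrite p1 mulKg.
Qed.

Lemma slid_connection1 (G : groupType) z : slid_connection (fun=> 1 : G) z = 1.
Proof. by rewrite /slid_connection !(mulg1, invg1) !if_same. Qed.

Lemma slid_state_values (s : {ffun T -> bool}) :
  [/\ slid_state s t0 = (if s t2 || (s t0 != s t1) then s t0 else ~~ s t0),
      slid_state s t1 = (if s t2 || (s t0 != s t1) then s t1 else ~~ s t1)
    & slid_state s t2 = s t2].
Proof.
have dis a b : ~ same_crossing M a b -> (b \notin star M a) /\ (a \notin star M b).
  move=> ab; split; apply/negP=> H.
    exact: (star_disjoint ab H (star_id M b)).
  exact: (star_disjoint ab (star_id M a) H).
have [_ _ _ [/dis[m01 m10] /dis[m12 m21] /dis[m20 m02]]] := triM.
rewrite /slid_state; case: ifP => //= _.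
by rewrite !flipE !star_id (negbTE m10) (negbTE m01) (negbTE m02) (negbTE m12).
Qed.

Lemma slid_state_smoothing (s : {ffun T -> bool}) : smoothing M s -> smoothing M (slid_state s).
Proof. by rewrite /slid_state; case: ifP => // _ sP; do 2!apply: flip_smoothing. Qed.

Lemma slid_flat (s : {ffun T -> bool}) : smoothing M s -> (s t2 ==> ~~ s t0 && ~~ s t1) ->
  flat N (slid_state s) -> flat M s.
Proof.
move=> sP good fN G psi cpsi; have [xi Hxi] := fN G _ (slid_connectionP cpsi).
by have [xi'] := slid_horizontal cpsi sP good Hxi; exists xi'.
Qed.

(** Colorings of [N] are determined outside its triangle: [det] holds at a crossing that joins the
    sides to outer edges, and is passed on around the triangle through the others. The reverse
    inequality comes from sliding back. *)
Lemma slid_circles (s : {ffun T -> bool}) : smoothing M s -> (s t2 ==> ~~ s t0 && ~~ s t1) ->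
  circles N (slid_state s) <= circles M s.
Proof.
move=> sP good; rewrite -(leq_exp2l _ _ (isT : 1 < 2)) -!card_col.
have tP := slid_state_smoothing sP.
have /choice[r rP] (f : {ffun T -> 'F_2}) : exists h : {ffun T -> 'F_2},
    f \in colorings N (slid_state s) ->
    h \in colorings M s /\ forall z, ~~ side z -> h z = f (slid z).
  case: (boolP (f \in colorings N (slid_state s))) => [|_]; last by exists f.
  move/col_horizontal => [h1 h2].
  have Hf : horizontal N (slid_state s) (slid_connection (fun=> 1 : 'F_2)) f.
    by split=> d; rewrite slid_connection1; [apply: h1 | apply: h2].
  have [xi [k1 k2] e] := slid_horizontal (connection1 M 'F_2) sP good Hf.
  exists [ffun z => xi z] => _; split=> [|z /e]; last by rewrite ffunE.
  by apply/col_horizontal; split=> d; rewrite !ffunE; [apply: k1 | apply: k2].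
have r_inj : {in colorings N (slid_state s) &, injective r}.
  move=> f g fN gN rfg; have [_ ef] := rP f fN; have [_ eg] := rP g gN.
  have out z : ~~ side (nx2 z) -> f z = g z.
    by move=> nz; rewrite -(slid_unslid nz) -ef ?rfg ?eg // unslid_not_side.
  have [f1 f2] := coloringsP fN; have [g1 g2] := coloringsP gN.
  have {}f2 d : slid_state s d -> f (nx1 d) = f d by rewrite -nxE; apply: f2.
  have {}g2 d : slid_state s d -> g (nx1 d) = g d by rewrite -nxE; apply: g2.
  have [k0 k1 k2 [k3 k4 k5]] := edN.
  pose det t := f (nx2 t) = g (nx2 t) /\ f (nx3 t) = g (nx3 t).
  have st t : [|| t == t0, t == t1 | t == t2] -> side t /\ side (nx1 t).
    by rewrite /sides => /or3P[]/eqP->; rewrite !eqxx ?orbT.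
  have base t : [|| t == t0, t == t1 | t == t2] -> ~~ slid_state s t -> det t.
    move=> /st[st0 st1] nt.
    have n1 : slid_state s (nx1 t) by rewrite tP.
    have n3 : slid_state s (nx3 t) by rewrite (smoothing3 _ tP).
    split; first by rewrite f2 // g2 // out // side_nx2.
    by have := f2 _ n3; have := g2 _ n3; rewrite nx4 => <- <-; rewrite out // side_nx2.
  have step t u : [|| t == t0, t == t1 | t == t2] -> ed N (nx2 t) = nx3 u -> det u -> det t.
    move=> tt e [_ d3]; case: (boolP (slid_state s t)) => nt; last exact: base.
    have x : f (nx2 t) = g (nx2 t) by rewrite f1 g1 e.
    have n2 : slid_state s (nx2 t) by rewrite (smoothing2 _ tP).
    by split; rewrite // f2 // g2.
  have [q0 q1 q2] : [/\ [|| t0 == t0, t0 == t1 | t0 == t2], [|| t1 == t0, t1 == t1 | t1 == t2]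
      & [|| t2 == t0, t2 == t1 | t2 == t2]] by rewrite !eqxx ?orbT.
  have [p0 p1 p2] : [/\ det t0, det t1 & det t2].
    have [e0 e1 e2] := slid_state_values s.
    case: (boolP (slid_state s t2)) => n2.
      have d0 : det t0.
        apply: base => //; rewrite e0 -e2 n2 /=.
        by move: good; rewrite -e2 n2 => /andP[].
      have d2 : det t2 by apply: (step _ t0).
      by split=> //; apply: (step _ t2).
    have d2 : det t2 by apply: base.
    have d1 : det t1 by apply: (step _ t2).
    by split=> //; apply: (step _ t1).
  apply/ffunP=> z; case: (boolP (side (nx2 z))) => [sz|/out//].
  rewrite -(nx4 M z); move: sz; rewrite /sides => /or4P[| | |/or3P[]]/eqP->;
    by [case: p0 | case: p1 | case: p2].
rewrite -(card_in_imset r_inj); apply/subset_leq_card/fintype.subsetP=> h.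
by case/imsetP=> f /rP[? _] ->.
Qed.

Lemma slid_triangle : triangle M (nx N (nx N (nx2 t0))) (nx N (nx N (nx2 t1)))
  (nx N (nx N (nx2 t2))).
Proof. by rewrite !nxE !nx4. Qed.

Lemma sides_slid z : sides N (nx2 t0) (nx2 t1) (nx2 t2) z = side (nx2 z).
Proof.
have nx2E a b : (nx2 a == b) = (a == nx2 b).
  by rewrite -[RHS](inj_eq (@nx_inj _ M)) -[RHS](inj_eq (@nx_inj _ M)) nx4.
by rewrite /sides !nxE !nx2E.
Qed.

End Slide.

Section SlideBracket.
Variables (T : finType) (M N : diagram T) (t0 t1 t2 : T).
Variables (K : comNzRingType) (y y' : K).
Hypothesis yy' : (y * y' = 1)%R.
Local Notation nx2 z := (nx M (nx M z)).
Implicit Types s u : {ffun T -> bool}.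
Hypotheses (nxE : forall d, nx N d = nx M d) (overE : forall d, over N d = over M d)
  (triM : triangle M t0 t1 t2) (triN : triangle N (nx2 t0) (nx2 t1) (nx2 t2))
  (slid_edM : forall z, ~~ sides M t0 t1 t2 z ->
     ed N (slid M t0 t1 t2 z) = slid M t0 t1 t2 (ed M z))
  (over01 : over M t0 != over M t1).

Let good (s : {ffun T -> bool}) := s t2 ==> ~~ s t0 && ~~ s t1.
Let mv (s : {ffun T -> bool}) := slid_state M t0 t1 t2 s.

Lemma smoothing_slide (s : {ffun T -> bool}) : smoothing N s <-> smoothing M s.
Proof. by split=> H d; rewrite -H nxE. Qed.

Lemma star_slide x : star N x = star M x.
Proof. by apply/setP=> z; rewrite !starE !nxE. Qed.

Lemma slid_state_swap s : smoothing M s ->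
  slid_state N (nx2 t0) (nx2 t1) (nx2 t2) s = mv s.
Proof.
move=> sP; rewrite /mv /slid_state !(smoothing2 _ sP); case: ifP => // _.
by apply/ffunP=> z; rewrite !flipE !star_slide !star_nxl.
Qed.

Lemma slid_stateK s : mv (mv s) = s.
Proof.
have [e0 e1 e2] := slid_state_values triM s.
have c : mv s t2 || (mv s t0 != mv s t1) = s t2 || (s t0 != s t1).
  by rewrite /mv e0 e1 e2; case: (s t2); case: (s t0); case: (s t1).
rewrite {1}/mv {1}/slid_state c; case: ifP => cs; rewrite /mv /slid_state cs //.
by apply/ffunP=> z; rewrite !flipE; case: (z \in _); case: (z \in _); case: (s z).
Qed.

Lemma good_slid_state s : good s -> good (mv s).
Proof.
rewrite /good /mv; have [-> -> ->] := slid_state_values triM s.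
by case: (s t2).
Qed.

(** The slide from [N] back to [M] is of the same kind, from the opposite darts, and acts on states
    by the same involution, so that one implication gives both. *)
Lemma slid_flat_iff s : smoothing M s -> good s -> flat M s <-> flat N (mv s).
Proof.
move=> sP gs; split; last exact: slid_flat.
have mP : smoothing M (mv s) by apply: slid_state_smoothing.
rewrite -{1}(slid_stateK s) -{1}(slid_state_swap mP).
apply: (@slid_flat _ N M); rewrite ?(smoothing2 _ mP) //.
- exact: slid_triangle.
- by move=> z; rewrite sides_slid // => /(unslid_ed nxE triM triN slid_edM) e;
    rewrite /slid !sides_slid // !nxE !nx4.
- exact/smoothing_slide.
exact: good_slid_state.
Qed.

Lemma slid_circles_eq s : smoothing M s -> good s -> circles M s = circles N (mv s).
Proof.
move=> sP gs; apply/eqP; rewrite eqn_leq; apply/andP; split; last first.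
  exact: (slid_circles nxE triM triN slid_edM sP gs).
have mP : smoothing M (mv s) by apply: slid_state_smoothing.
rewrite -{1}(slid_stateK s) -{1}(slid_state_swap mP).
apply: (@slid_circles _ N M); rewrite ?(smoothing2 _ mP) //.
- exact: slid_triangle.
- by move=> z; rewrite sides_slid // => /(unslid_ed nxE triM triN slid_edM) e;
    rewrite /slid !sides_slid // !nxE !nx4.
- exact/smoothing_slide.
exact: good_slid_state.
Qed.

(** When [s t2] is false, the pair (a, b) of smoothings at [t0] and [t1] becomes (~~ b, ~~ a). As
    [over] differs at [t0] and [t1], this exchanges the two crossings as far as being A-smoothed is
    concerned. *)
Lemma a_count_slid s : smoothing M s -> a_count N (mv s) = a_count M s.
Proof.
move=> sP; have aE u : a_count N u = a_count M u.
  by congr (_ %/ 4); apply: eq_card => z; rewrite !inE overE.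
rewrite aE /mv /slid_state; case: ifP => // /negbT; rewrite negb_or negbK => /andP[_ /eqP s01].
have n01 : t1 \notin star M t0.
  by apply/negP=> /starP; case: triM => _ _ _ [].
have n10 : t0 \notin star M t1.
  apply/negP=> H; case: triM => _ _ _ [H' _ _].
  exact: (star_disjoint H' (star_id M t0) H).
have uP := flip_smoothing t1 sP; have vP := flip_smoothing t0 sP.
have flipC : flip M t0 (flip M t1 s) = flip M t1 (flip M t0 s).
  by apply/ffunP=> z; rewrite !flipE addbCA.
case: (boolP (s t0 == over M t0)) => [/eqP s0|s0].
  rewrite flipC (a_count_flip (x := t0) sP s0) (a_count_flipN (x := t1) vP) //.
  by rewrite flipE (negbTE n01) -s01 s0; case: (over M t0) (over M t1) over01 => -[].
have {}s0 : s t0 = ~~ over M t0 by case: (s t0) (over M t0) s0 => -[].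
rewrite (a_count_flipN (x := t0) uP); last by rewrite flipE (negbTE n10).
rewrite -(a_count_flip (x := t1) sP) // -s01 s0.
by case: (over M t0) (over M t1) over01 => -[].
Qed.

Lemma slide_bracket : bracket y y' M = bracket y y' N.
Proof.
have overN01 : over N (nx2 t0) != over N (nx2 t1).
  by rewrite !overE !over_nx !negbK.
rewrite (triangle_bracket yy' triM over01) (triangle_bracket yy' triN overN01).
rewrite (reindex_onto mv mv) /=; last by move=> s _; apply: slid_stateK.
have smE s : (s \in smoothings N) = (s \in smoothings M).
  by apply/smoothingsP/smoothingsP => /smoothing_slide.
apply: eq_big => [s|s].
  rewrite slid_stateK eqxx andbT smE.
  have -> : (mv s \in smoothings M) = (s \in smoothings M).
    apply/smoothingsP/smoothingsP => [/(slid_state_smoothing t0 t1 t2)|].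
      by rewrite -/(mv _) slid_stateK.
    exact: slid_state_smoothing.
  case: (boolP (s \in smoothings M)) => //= /smoothingsP sP; rewrite !(smoothing2 _ sP).
  rewrite -/(good s) -/(good (mv s)); apply/idP/idP => /good_slid_state //.
  by rewrite slid_stateK.
case/andP=> /andP[/smoothingsP mP gm] _.
rewrite -{2}(slid_stateK s) /weight -(asbool_equiv_eq (slid_flat_iff mP gm)).
by rewrite -(slid_circles_eq mP gm) a_count_slid.
Qed.

End SlideBracket.

Section ThirdMove.
Variables (K : comNzRingType) (y y' : K).
Hypothesis yy' : (y * y' = 1)%R.

(** Pulling the edges of [D'] back along [h] gives a diagram [N] on the darts and crossings of [D]
    itself. Since [over] is not constant on the triangle, a rotation makes its first two darts
    differ. *)
Lemma R3_bracket (D D' : motif) : R3 D D' -> bracket_equiv y y' D D'.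
Proof.
case=> t [h []]; set t1 := fc D t; set t2 := fc D t1; set I := [:: _; _; _; _; _; _].
case=> t3 [n01 n12 n20] nover [h' hK h'K] [hnx hover hed].
pose e c := h' (ed D' (h c)).
have eK d : e (e d) = d by rewrite /e h'K ed_invol hK.
have eN d : e d <> d by move/(congr1 h); rewrite /e h'K; apply: ed_neq.
pose N := Diagram (nx4 D) (@nx2_neq _ D) eK eN (over_nx D).
have isoN : isomorphic (Motif N) D'.
  exists h; first by exists h'.
  by split=> d /=; rewrite ?hnx ?hover // /e h'K.
have [e0 e1 e2] : [/\ ed D t = nx D t1, ed D t1 = nx D t2 & ed D t2 = nx D t].
  by split; rewrite -nx_fc ?t3.
have triM : triangle D t t1 t2 by split.
have IE c : (c \in I) = sides D t t1 t2 c.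
  rewrite !inE -/t1 -/t2 e0 e1 e2 /sides.
  by do 6!case: (_ == _).
have slideE c : ~~ sides D t t1 t2 c -> slide I c = slid D t t1 t2 c.
  by rewrite /slide /slid !IE => /negbTE->.
have edN c : e (slide I c) = slide I (ed D c) by rewrite /e hed hK.
have slid_edM c : ~~ sides D t t1 t2 c ->
    ed N (slid D t t1 t2 c) = slid D t t1 t2 (ed D c).
  by move=> nc; rewrite -!slideE ?(sides_ed _ triM) //; apply: edN.
have sE c : c \in I -> e (nx D (nx D c)) = nx D (nx D (ed D c)).
  move=> cI; have cI' : ed D c \in I by move: cI; rewrite !IE (sides_ed _ triM).
  by have := edN c; rewrite /slide cI cI'.
have sameN a b : same_crossing N a b -> same_crossing D (nx D (nx D a)) (nx D (nx D b)).
  by case=> i <-; exists i; elim: i => //= i ->.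
have triN : triangle N (nx D (nx D t)) (nx D (nx D t1)) (nx D (nx D t2)).
  split; rewrite /= ?sE ?inE ?eqxx ?orbT // -/t1 -/t2 ?e0 ?e1 ?e2 //.
  by split=> /sameN; rewrite !nx4.
have eqN : bracket y y' D = bracket y y' N.
  have H o0 o1 o2 : triangle D o0 o1 o2 ->
      triangle N (nx D (nx D o0)) (nx D (nx D o1)) (nx D (nx D o2)) ->
      (forall c, sides D o0 o1 o2 c = sides D t t1 t2 c) -> over D o0 != over D o1 ->
      bracket y y' D = bracket y y' N.
    move=> tM tN sd oo; apply: (slide_bracket yy' _ _ tM tN) => // c nc.
    have slE d : slid D o0 o1 o2 d = slid D t t1 t2 d by rewrite /slid !sd.
    by rewrite !slE slid_edM // -sd.
  case: (boolP (over D t == over D t1)) => [/eqP o01|]; last exact: (H t t1 t2).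
  apply: (H t1 t2 t); [exact: triangle_rot | exact: triangle_rot | |].
    by move=> c; rewrite sides_rot.
  by apply/eqP=> o12; apply: nover.
exists false, 0, 0; rewrite !expr0 !mul1r eqN.
exact/esym/(isomorphic_bracket y y' isoN).
Qed.

End ThirdMove.

(** * Circles of two null-homotopic states *)

Section Orthogonality.
Local Open Scope ring_scope.

Lemma leq_card_fibers (V W : finType) (f : V -> W) (A : {set V}) n :
  (forall a, a \in A -> #|[set b in A | f b == f a]| <= n)%N -> (#|A| <= #|f @: A| * n)%N.
Proof.
move=> fib; rewrite -sum1_card (partition_big_imset f) /= -sum_nat_const leq_sum // => w.
case/imsetP=> a aA ->; rewrite sum1dep_card.
by apply: leq_trans (fib a aA); apply/subset_leq_card/fintype.subsetP=> b; rewrite !inE.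
Qed.

Variable E : finType.
Implicit Types (A B : {set {ffun E -> 'F_2}}) (x a : {ffun E -> 'F_2}).

Definition pairing a x : 'F_2 := \sum_i a i * x i.
Definition sgn2 (u : 'F_2) : int := if u == 0 then 1 else -1.

Lemma pairingDl a b x : pairing (a + b) x = pairing a x + pairing b x.
Proof. by rewrite -big_split; apply: eq_bigr => i _; rewrite ffunE mulrDl. Qed.

Lemma pairingC a x : pairing a x = pairing x a.
Proof. by apply: eq_bigr => i _; rewrite mulrC. Qed.

Lemma sgn2D1 u : sgn2 (u + 1) = - sgn2 u.
Proof. by case: (F2_cases u) => ->. Qed.

Lemma sum_sgn2 A x a : (forall b, (b + a \in A) = (b \in A)) -> pairing a x = 1 ->
  \sum_(b in A) sgn2 (pairing b x) = 0.
Proof.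
move=> aA ax; set S := LHS.
have : S = - S.
  rewrite {1}/S (reindex_inj (addIr a)) /= -sumrN; apply: eq_big => [b|b _]; first exact: aA.
  by rewrite pairingDl ax sgn2D1.
move/eqP; rewrite -addr_eq0 -mulr2n -mulr_natl mulf_eq0 => /orP[|/eqP//].
by [].
Qed.

(** A character sum replaces dimensions. Summed over x first, the signs of [pairing a x] cancel
    unless a = 0, so S is at most 2^|E|. Summed over [A] first, they give a nonnegative number for
    every x, because [A] is closed under addition, and |A| for x in [B]. *)
Lemma leq_card_orthogonal A B : (forall a b, a \in A -> b \in A -> a + b \in A) ->
  (forall a b, a \in A -> b \in B -> pairing a b = 0) -> (#|A| * #|B| <= 2 ^ #|E|)%N.
Proof.
move=> addA ortho.
have char2 (a : {ffun E -> 'F_2}) : a + a = 0.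
  by apply/ffunP=> i; rewrite !ffunE -{2}[a i]F2_opp subrr.
pose S := \sum_(x : {ffun E -> 'F_2}) \sum_(a in A) sgn2 (pairing a x).
have leS : S <= (2 ^ #|E|)%N%:R.
  rewrite /S exchange_big /=.
  have sum0 a : a != 0 -> \sum_x sgn2 (pairing a x) = 0.
    move=> a0; have [i ai] : exists i, a i = 1.
      move/eqP: a0 => a0; case: (pickP (fun i => a i == 1)) => [i /eqP|na]; first by exists i.
      case: a0; apply/ffunP=> i; rewrite ffunE.
      by have [//|ai] := F2_cases (a i); have := na i; rewrite ai eqxx.
    pose d : {ffun E -> 'F_2} := [ffun j => (j == i)%:R].
    rewrite -[RHS](@sum_sgn2 setT a d).
    - by apply: eq_big => x; rewrite ?inE // => _; rewrite pairingC.
    - by move=> b; rewrite !inE.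
    rewrite /pairing (bigD1 i) //= ffunE eqxx mul1r ai big1 ?addr0 // => j ji.
    by rewrite ffunE (negbTE ji) mul0r.
  have [A0|A0] := boolP (0 \in A).
    rewrite (bigD1 (0 : {ffun E -> 'F_2})) //= [X in _ + X]big1 ?addr0; last by move=> a /andP[_ /sum0].
    have -> : \sum_(x : {ffun E -> 'F_2}) sgn2 (pairing 0 x) = \sum_(x : {ffun E -> 'F_2}) 1.
      by apply: eq_bigr => x _; rewrite /pairing big1 // => i _; rewrite ffunE mul0r.
    by rewrite sumr_const card_ffun card_Fp.
  rewrite big1 // => a aA; apply: sum0; apply: contraNneq A0 => <-; exact: aA.
have geS : (#|A| * #|B|)%N%:R <= S.
  have pos x : 0 <= \sum_(a in A) sgn2 (pairing a x).
    case: (pickP (fun a => (a \in A) && (pairing a x == 1))) => [a /andP[aA /eqP ax]|na].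
      rewrite (@sum_sgn2 A x a) // => b; apply/idP/idP => [|bA]; last exact: addA.
      by move/addA/(_ aA); rewrite -addrA char2 addr0.
    apply: sumr_ge0 => a aA; have := na a; rewrite aA /= => /negbT.
    by have [->|->] := F2_cases (pairing a x).
  rewrite /S (bigID (fun x => x \in B)) /=.
  apply: ler_wpDr; first by apply: sumr_ge0.
  have -> : (#|A| * #|B|)%N%:R = \sum_(x in B) (#|A|%:R : int).
    by rewrite sumr_const mulrnA.
  rewrite ler_sum // => x xB; rewrite -sumr_const ler_sum // => a aA.
  by rewrite ortho.
by have := le_trans geS leS; rewrite ler_nat.
Qed.

End Orthogonality.

Lemma sum_transversal (T : finType) (P : pred T) (t : T -> T) (h : T -> 'F_2) :
  injective t -> (forall d, P (t d) = ~~ P d) ->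
  (\sum_(d | P d) (h d + h (t d)) = \sum_d h d)%R.
Proof.
move=> t_inj Pt; rewrite [RHS](bigID P) /= big_split /=; congr (_ + _)%R.
rewrite [RHS](reindex_inj t_inj) /=; apply: eq_bigl => d.
by rewrite Pt negbK.
Qed.

(** * Pairing of circles with cocycles mod 2 *)

Section StateBound.
Local Open Scope ring_scope.
Variables (T : finType) (M : diagram T).
Local Notation chain := {ffun T -> 'F_2}.
Implicit Types (s : {ffun T -> bool}) (f h theta : chain).

Let R : {set T} := [set d | enum_rank d < enum_rank (ed M d)]%N.
Let E := {d | d \in R}.
Let rho f : {ffun E -> 'F_2} := [ffun e => f (val e)].

Lemma transversal_ed d : (ed M d \in R) = (d \notin R).
Proof.
rewrite !inE ed_invol -leqNgt [RHS]leq_eqVlt orb_idl // => /eqP/val_inj/enum_rank_inj e.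
by case: (@ed_neq _ M d).
Qed.

Lemma card_transversal : #|{: E}| = fcard (ed M) T.
Proof.
apply/eqP; rewrite -(eqn_pmul2r (isT : 0 < 2)%N) card_edges card_sig muln2 -addnn.
rewrite -(cardC (mem R)); apply/eqP; congr (_ + _)%N.
rewrite -(card_imset _ (@ed_inj _ M)); apply: eq_card => d; apply/imsetP/idP.
  by case=> e eR ->; rewrite -topredE /= transversal_ed negbK.
by rewrite -topredE /= => dR; exists (ed M d); rewrite ?ed_invol // -topredE /= transversal_ed.
Qed.

Lemma rho_inj f h : (forall d, f (ed M d) = f d) -> (forall d, h (ed M d) = h d) ->
  rho f = rho h -> f = h.
Proof.
move=> fe he /ffunP fh; apply/ffunP=> d.
case: (boolP (d \in R)) => dR; first by have := fh (exist (fun d => d \in R) d dR); rewrite !ffunE.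
by rewrite -transversal_ed in dR; have := fh (exist (fun d => d \in R) _ dR); rewrite !ffunE /= fe he.
Qed.

Lemma pairing_rho f h : pairing (rho f) (rho h) = \sum_(d in R) f d * h d.
Proof.
rewrite big_sub; apply: eq_bigr => e _; rewrite !ffunE //.
Qed.

Lemma leq_card_kernel (f : chain -> chain) (A B : {set chain}) :
  (forall a b, a \in A -> b \in A -> f b = f a -> b - a \in B) ->
  (#|A| <= #|f @: A| * #|B|)%N.
Proof.
move=> AB; apply: leq_card_fibers => a aA.
rewrite -(card_imset _ (@addIr _ (- a))); apply/subset_leq_card/fintype.subsetP=> c.
by case/imsetP=> b; rewrite inE => /andP[bA /eqP fb] ->; apply: AB.
Qed.

(** [theta] lives on the corners, that of [d] being between [d] and [nx d]. Its differences
    [theta d + theta (fc (ed d))] between adjacent corners satisfy the relation at each crossing;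
    [bnd] vanishes when they agree at the two ends of every edge, i.e. form a connection. [phi] then
    compares the local primitives at the two ends of an edge: a cellular 1-cocycle of the
    surface. *)
Let bnd theta : chain :=
  [ffun d => theta d + theta (ed M d) + (theta (fc M d) + theta (fc M (ed M d)))].
Let cocycles : {set chain} := [set theta | bnd theta == 0].
Let phi theta : chain := [ffun d => theta d + theta (fc M d)].

Lemma char2 (a : 'F_2) : a + a = 0.
Proof. by rewrite -{2}[a]F2_opp subrr. Qed.

(** In the sum of [bnd theta] over all edges each value of [theta] occurs twice, so the image is
    orthogonal to the constant chain 1. *)
Lemma leq_card_bnd (d0 : T) : (2 * #|bnd @: setT| <= 2 ^ #|{: E}|)%N.
Proof.
pose one : {ffun E -> 'F_2} := [ffun=> 1].
have bnd_ed theta d : bnd theta (ed M d) = bnd theta d.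
  by rewrite !ffunE ed_invol (addrC (theta (ed M d))) (addrC (theta (fc M (ed M d)))).
have rho_bnd_inj : {in bnd @: setT &, injective rho}.
  move=> f h /imsetP[a _ ->] /imsetP[b _ ->]; apply: rho_inj; exact: bnd_ed.
pose zero : {ffun E -> 'F_2} := [ffun=> 0].
have card2 : #|[set zero; one]| = 2%N.
  rewrite cards2; suff -> : zero != one by [].
  have [e _] : exists e : E, true.
    case: (boolP (d0 \in R)) => dR; first by exists (exist (fun d => d \in R) _ dR).
    by rewrite -transversal_ed in dR; exists (exist (fun d => d \in R) _ dR).
  by apply/eqP=> /ffunP/(_ e); rewrite !ffunE.
rewrite -(card_in_imset rho_bnd_inj) mulnC.
suff : (#|rho @: (bnd @: setT)| * #|[set zero; one]| <= 2 ^ #|{: E}|)%N by rewrite card2.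
apply: leq_card_orthogonal.
  move=> a b /imsetP[f /imsetP[h _ ->] ->] /imsetP[f' /imsetP[h' _ ->] ->].
  apply/imsetP; exists (bnd (h + h')); first exact: imset_f.
  by apply/ffunP=> e; rewrite !ffunE addrACA; congr (_ + _); rewrite addrACA.
move=> a b /imsetP[f /imsetP[h _ ->] ->]; rewrite inE => /orP[]/set1P->.
  by rewrite /pairing big1 // => e _; rewrite [zero _]ffunE mulr0.
have -> : one = rho [ffun=> 1] by apply/ffunP=> e; rewrite !ffunE.
rewrite pairing_rho.
under eq_bigr => d _ do rewrite !ffunE mulr1.
rewrite big_split /=.
have sumR (u : T -> 'F_2) : \sum_(d in R) (u d + u (ed M d)) = \sum_d u d.
  by apply: sum_transversal; [exact: ed_inj | exact: transversal_ed].
rewrite (sumR h) (sumR (h \o fc M)) /= [X in X + _](reindex_inj (@fc_inj _ M)) /=.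
exact: char2.
Qed.

Lemma card_cocycles (d0 : T) : (2 ^ (fcard (ed M) T).+1 <= #|cocycles|)%N.
Proof.
have ker a b : a \in setT -> b \in setT -> bnd b = bnd a -> b - a \in cocycles.
  move=> _ _ /ffunP e; rewrite inE; apply/eqP/ffunP=> d; have := e d.
  rewrite !ffunE => /eqP; rewrite -subr_eq0 => /eqP <-.
  by rewrite !opprD !addrA; ring.
have := leq_card_kernel ker; rewrite cardsT card_ffun card_Fp // => le1.
have le2 := leq_card_bnd d0; rewrite card_transversal in le2.
have cardT : #|T| = (fcard (ed M) T + fcard (ed M) T)%N by rewrite addnn -muln2 card_edges.
have pos : (0 < #|bnd @: setT|)%N.
  by apply/card_gt0P; exists (bnd 0); apply: imset_f.
have : (2 ^ fcard (ed M) T * #|bnd @: setT| * 2 ^ (fcard (ed M) T).+1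
        <= 2 ^ fcard (ed M) T * #|bnd @: setT| * #|cocycles|)%N.
  rewrite -!mulnA leq_mul2l; apply/orP; right.
  apply: leq_trans le1; rewrite expnS mulnA (mulnC _ 2) cardT expnD.
  by rewrite leq_mul2r le2 orbT.
by rewrite leq_mul2l -leqn0 leqNgt muln_gt0 expn_gt0 pos.
Qed.

Lemma phi_ed theta d : theta \in cocycles -> phi theta (ed M d) = phi theta d.
Proof.
rewrite inE => /eqP/ffunP/(_ d); rewrite !ffunE => e.
apply/eqP; rewrite -subr_eq0 -e F2_opp; apply/eqP; ring.
Qed.

(** Two [theta] with the same image differ by a function constant on regions. *)
Lemma card_phi : (#|cocycles| <= #|phi @: cocycles| * 2 ^ fcard (fc M) T)%N.
Proof.
rewrite -(card_finvariants (@fc_inj _ M)); apply: leq_card_kernel => a b _ _ /ffunP e.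
rewrite inE; apply/forallP=> d; have := e d; rewrite !ffunE => {}e.
have e' : b (fc M d) = a d + a (fc M d) - b d by rewrite -e; ring.
by rewrite e' -[X in _ == X]F2_opp; apply/eqP; ring.
Qed.

(** Null-homotopic circles are null-homologous. Adding a horizontal section to [theta] gives [eta],
    which is constant across the joins and jumps by [phi theta] along edges; the sum over edges
    becomes a sum over darts, in which joined darts cancel. *)
Lemma flat_orthogonal s f theta : smoothing M s -> flat M s -> f \in colorings M s ->
  theta \in cocycles -> \sum_(d in R) f d * phi theta d = 0.
Proof.
move=> sP fs fcol tc; have [f1 f2] := coloringsP fcol.
pose psi d := theta d + theta (fc M (ed M d)).
have cpsi : connection M (psi : T -> 'F_2).
  split=> d.
    rewrite FinRing.zmodVgE F2_opp /psi ed_invol.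
    move: tc; rewrite inE => /eqP/ffunP/(_ d); rewrite !ffunE => e.
    by apply/eqP; rewrite -subr_eq0 -e F2_opp; apply/eqP; ring.
  rewrite !FinRing.zmodMgE FinRing.zmod1gE /psi !fc_ed !nx4.
  rewrite -[RHS](char2 (theta d + theta (nx M d) + theta (nx M (nx M d)) + theta (nx M (nx M (nx M d))))).
  ring.
have [xi [h1 h2]] := fs _ psi cpsi.
pose eta d := theta d + xi d.
have eta_nx d : s d -> eta (nx M d) = eta d.
  move=> sd; rewrite /eta h2 // FinRing.zmodMgE /psi fc_ed nx4 !addrA char2 add0r.
  by [].
have eta_ed d : eta d + eta (ed M d) = phi theta d.
  rewrite -phi_ed // ffunE /eta h1 FinRing.zmodMgE /psi.
  rewrite -[RHS]addr0 -[in RHS](char2 (theta d + xi (ed M d))); ring.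
transitivity (\sum_(d in R) (f d * eta d + f (ed M d) * eta (ed M d))).
  by apply: eq_bigr => d _; rewrite -eta_ed mulrDr -f1.
rewrite (@sum_transversal _ (fun d => d \in R) (ed M) (fun d => f d * eta d)); first last.
- exact: transversal_ed.
- exact: ed_inj.
rewrite -(@sum_transversal _ (fun d => s d) (nx M)); [| exact: nx_inj | exact: sP].
by apply: big1 => d sd; rewrite f2 // eta_nx // char2.
Qed.

Variables (s s' : {ffun T -> bool}).
Hypotheses (sP : smoothing M s) (s'P : smoothing M s').
Let W : {set chain} := [set f | [exists a, exists b,
  [&& a \in colorings M s, b \in colorings M s' & f == a + b]]].

Lemma card_sum_colorings :
  (#|colorings M s| * #|colorings M s'| <= #|W| * #|colorings M s :&: colorings M s'|)%N.
Proof.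
pose A := setX (colorings M s) (colorings M s'); pose add (u : chain * chain) := u.1 + u.2.
rewrite -cardsX -/A; have sub : add @: A \subset W.
  apply/fintype.subsetP=> f /imsetP[[a b]]; rewrite inE => /andP[aS bS] ->.
  by rewrite inE; apply/existsP; exists a; apply/existsP; exists b; rewrite aS bS eqxx.
apply: leq_trans (leq_mul (subset_leq_card sub) (leqnn _)).
apply: leq_card_fibers => -[a b]; rewrite inE /= => /andP[aS bS].
have inj : {in [set u in A | add u == add (a, b)] &, injective (fun u => u.1 - a)}.
  move=> [a1 b1] [a2 b2]; rewrite !inE /add /= => /andP[_ /eqP e1] /andP[_ /eqP e2].
  move/addIr=> e; rewrite e in e1 *; congr (_, _).
  by apply: (addrI a2); rewrite e1 e2.
rewrite -(card_in_imset inj); apply/subset_leq_card/fintype.subsetP=> f.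
case/imsetP=> -[a1 b1]; rewrite inE /A in_setX /add => /andP[/andP[a1S b1S] /eqP /= e] ->.
have sub_col t u v : u \in colorings M t -> v \in colorings M t -> u - v \in colorings M t.
  move=> /coloringsP[u1 u2] /coloringsP[v1 v2]; apply/coloringsP.
  by split=> [d|d sd]; rewrite !ffunE -?u1 -?v1 ?u2 ?v2.
have ea : a1 - a = b - b1.
  have -> : a1 = a + b - b1 by rewrite -e addrK.
  by rewrite addrAC (addrC a) addrK.
by rewrite in_setI sub_col //= ea sub_col.
Qed.

Lemma card_sum_phi : flat M s -> flat M s' ->
  (#|W| * #|phi @: cocycles| <= 2 ^ fcard (ed M) T)%N.
Proof.
move=> fs fs'; have WP f : f \in W -> exists2 a, a \in colorings M s &
    exists2 b, b \in colorings M s' & f = a + b.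
  by rewrite inE => /existsP[a /existsP[b /and3P[aS bS /eqP ->]]]; exists a => //; exists b.
have W_ed f d : f \in W -> f (ed M d) = f d.
  case/WP=> a /coloringsP[a1 _] [b /coloringsP[b1 _] ->].
  by rewrite !ffunE -a1 -b1.
have rW : {in W &, injective rho}.
  by move=> f h fW hW; apply: rho_inj => d; apply: W_ed.
have rP : {in phi @: cocycles &, injective rho}.
  move=> f h /imsetP[a aC ->] /imsetP[b bC ->]; apply: rho_inj => d; exact: phi_ed.
rewrite -(card_in_imset rW) -(card_in_imset rP) -card_transversal.
apply: leq_card_orthogonal => [u v /imsetP[f fW ->] /imsetP[h hW ->]|].
  apply/imsetP; exists (f + h); last by apply/ffunP=> e; rewrite !ffunE.
  have [a aS [b bS ->]] := WP f fW; have [a' aS' [b' bS' ->]] := WP h hW.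
  have add_col t (u1 v1 : chain) : u1 \in colorings M t -> v1 \in colorings M t ->
      u1 + v1 \in colorings M t.
    move=> /coloringsP[p1 p2] /coloringsP[q1 q2]; apply/coloringsP.
    by split=> [d|d sd]; rewrite !ffunE -?p1 -?q1 ?p2 ?q2.
  rewrite inE; apply/existsP; exists (a + a'); apply/existsP; exists (b + b').
  by rewrite !add_col //= addrACA.
move=> u v /imsetP[f fW ->] /imsetP[h /imsetP[theta tC ->] ->].
have [a aS [b bS ->]] := WP f fW; rewrite pairing_rho.
under eq_bigr => d _ do rewrite ffunE mulrDl.
by rewrite big_split /= (flat_orthogonal sP fs aS tC) (flat_orthogonal s'P fs' bS tC) addr0.
Qed.

Hypothesis conn : forall d e : T,
  connect (fun a b => (b == nx M a) || (b == ed M a)) d e.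

(** Where the smoothings differ, all four darts get the same colour; where they agree, the
    difference between the two arcs is one free parameter. By connectedness these parameters and the
    value at [d0], which accounts for the successor in the exponent, determine the coloring. *)
Lemma card_common_colorings (d0 : T) :
  (#|colorings M s :&: colorings M s'|
   <= 2 ^ (fcard (nx M) [pred d | s d == s' d]).+1)%N.
Proof.
pose C := {d | froots (nx M) d && (s d == s' d)}.
pose r f : {ffun option C -> 'F_2} := [ffun o : option C =>
  if o is Some c then f (val c) - f (nx M (nx M (val c))) else f d0].
have cardC : #|{: option C}| = (fcard (nx M) [pred d | s d == s' d]).+1.
  by rewrite card_option card_sig; congr _.+1; apply: eq_card => d; rewrite !inE.
have sub_col t (u v : chain) : u \in colorings M t -> v \in colorings M t ->
    u - v \in colorings M t.
  move=> /coloringsP[u1 u2] /coloringsP[v1 v2]; apply/coloringsP.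
  by split=> [d|d sd]; rewrite !ffunE -?u1 -?v1 ?u2 ?v2.
have r_inj : {in colorings M s :&: colorings M s' &, injective r}.
  move=> f h; rewrite !in_setI => /andP[fs fs'] /andP[hs hs'] /ffunP rfh.
  apply/eqP; rewrite -subr_eq0; apply/eqP; set u := f - h.
  have us : u \in colorings M s by apply: sub_col.
  have us' : u \in colorings M s' by apply: sub_col.
  have [u1 u2] := coloringsP us; have [_ u2'] := coloringsP us'.
  have u0 : u d0 = 0 by have := rfh None; rewrite !ffunE => ->; rewrite subrr.
  have uC d : froots (nx M) d -> s d == s' d -> u (nx M (nx M d)) = u d.
    move=> rd sd; have dC : froots (nx M) d && (s d == s' d) by rewrite rd.
    have := rfh (Some (exist (fun d => froots (nx M) d && (s d == s' d)) d dC)).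
    rewrite !ffunE /= => e; apply/eqP; rewrite -subr_eq0; apply/eqP.
    have -> : f (nx M (nx M d)) = f d - (h d - h (nx M (nx M d))) by rewrite -e; ring.
    by ring.
  have u_nx d : u (nx M d) = u d.
    case: (boolP (s d)) => [/u2//|sd]; case: (boolP (s' d)) => [/u2'//|sd'].
    have agree e : e \in star M d -> s e == s' e.
      by rewrite starE => /or4P[]/eqP->; rewrite ?sP ?s'P (negbTE sd) (negbTE sd').
    set e := froot (nx M) d.
    have de : e \in star M d.
      apply/starP; exists (findex (nx M) d e); apply: iter_findex; exact: connect_root.
    have re : u (nx M (nx M e)) = u e.
      by apply: uC (agree e de); apply: roots_root; apply: fconnect_sym; exact: nx_inj.
    have d12 : u (nx M (nx M d)) = u (nx M d) by rewrite u2 // sP sd.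
    have d30 : u d = u (nx M (nx M (nx M d))).
      by have := u2 (nx M (nx M (nx M d))); rewrite nx4; apply; rewrite (smoothing3 _ sP).
    move: de re; rewrite starE => /or4P[]/eqP->; rewrite ?nx4 => re.
    - by rewrite -d12.
    - by rewrite d30.
    - by rewrite re.
    by rewrite re -d30.
  have uconst d e : u d = u e.
    have /connectP[p pp ->] := conn d e.
    by elim: p d pp => //= c p IHp d /andP[/orP[]/eqP e' /IHp <-]; rewrite e' ?u_nx -?u1.
  by apply/ffunP=> d; rewrite [RHS]ffunE -u0.
rewrite -cardC -(card_in_imset r_inj) (leq_trans (max_card _)) //.
by rewrite card_ffun card_Fp.
Qed.

(** In dimensions, with E edges: the sum of the two spaces of colorings has at least n + n' - (a +
    1), the image of the cocycles at least E + 1 - F, and the two are orthogonal in a space of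
    dimension E. *)
Lemma flat_circles_bound (d0 : T) : flat M s -> flat M s' ->
  (circles M s + circles M s'
   <= fcard (nx M) [pred d | s d == s' d] + fcard (fc M) T)%N.
Proof.
move=> fs fs'; have := card_sum_colorings; rewrite !card_col => le1.
have le2 := card_common_colorings d0; have le3 := card_sum_phi fs fs'.
have le4 := card_cocycles d0; have le5 := card_phi.
set nE := fcard (ed M) T in le3 le4; set a := fcard (nx M) _ in le2 *; set F := fcard (fc M) T in le5 *.
set n := circles M s in le1 *; set n' := circles M s' in le1 *.
have : (2 ^ (n + n' + nE.+1) <= 2 ^ (a.+1 + F + nE))%N.
  rewrite !expnD.
  apply: leq_trans (leq_mul (leqnn _) (leq_trans le4 le5)) _.
  apply: leq_trans (leq_mul (leq_trans le1 (leq_mul (leqnn _) le2)) (leqnn _)) _.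
  rewrite [X in (X <= _)%N](_ : _ = #|W| * #|phi @: cocycles| * (2 ^ a.+1 * 2 ^ F))%N; last by ring.
  by rewrite [X in (_ <= X)%N]mulnC leq_mul2r le3 orbT.
by rewrite leq_exp2l //; lia.
Qed.

End StateBound.

(** * Connections from the universal cover *)

Section Bijections.
Variable Y : Type.

(** The permutations of the fibre of the universal cover, which may be infinite; the inverse is part
    of the data, so that the group operations are computed. *)
Record bij := Bij { bfun :> Y -> Y; binv : Y -> Y; bfunK : cancel bfun binv; binvK : cancel binv bfun }.

Lemma bij_eq (a b : bij) : a =1 b -> a = b.
Proof.
case: a b => f f' fK f'K [g g' gK g'K] /= /funext fg; case: _ / fg in gK g'K *.
have e : f' = g' by apply: funext => y; rewrite -{1}(g'K y) fK.
by case: _ / e in gK g'K *; congr Bij; apply: Prop_irrelevance.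
Qed.

HB.instance Definition _ := gen_eqMixin bij.
HB.instance Definition _ := gen_choiceMixin bij.

Definition bij1 : bij := @Bij id id (fun=> erefl) (fun=> erefl).
Definition bijV (a : bij) : bij := Bij (@binvK a) (@bfunK a).
Definition bijM (a b : bij) : bij :=
  Bij (can_comp (@bfunK a) (@bfunK b)) (can_comp (@binvK b) (@binvK a)).

Lemma bijA : associative bijM. Proof. by move=> a b c; apply: bij_eq. Qed.
Lemma bij1M : left_id bij1 bijM. Proof. by move=> a; apply: bij_eq. Qed.
Lemma bijM1 : right_id bij1 bijM. Proof. by move=> a; apply: bij_eq. Qed.
Lemma bijVM : left_inverse bij1 bijV bijM.
Proof. by move=> a; apply: bij_eq => y /=; apply: bfunK. Qed.
Lemma bijMV : right_inverse bij1 bijV bijM.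
Proof. by move=> a; apply: bij_eq => y /=; apply: binvK. Qed.

HB.instance Definition _ := isGroup.Build bij bijA bij1M bijM1 bijVM bijMV.

End Bijections.

Section CoverConnection.
Local Open Scope group_scope.
Variables (T : finType) (N : diagram T) (U : Type) (M : diagram U) (p : U -> T).
Hypotheses (p_nx : forall u, p (nx M u) = nx N (p u)) (p_ed : forall u, p (ed M u) = ed N (p u))
  (p_surj : forall d, exists u, p u = d)
  (p_faces : forall u k, iter k (fc N) (p u) = p u -> iter k (fc M) u = u)
  (conn : forall d e : T, connect (fun a b => (b == nx N a) || (b == ed N a)) d e).
Variable x : T.

Let Y := {u : U | p u = x}.

Lemma p_fc u : p (fc M u) = fc N (p u).
Proof. by rewrite /fc !p_nx p_ed. Qed.

Lemma p_iter_fc k u : p (iter k (fc M) u) = iter k (fc N) (p u).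
Proof. by elim: k => //= k <-; rewrite p_fc. Qed.

Lemma iter_fc_inj (V : Type) (L : diagram V) k : injective (iter k (fc L)).
Proof. by elim: k => // k IHk a b /= e; apply: IHk; apply: (@fc_inj _ L). Qed.

Lemma fibers_equiv d : exists f g : U -> U,
  [/\ cancel f g, cancel g f & forall u, p (f u) = d <-> p u = x].
Proof.
have /connectP[q qp ->] := conn x d; elim/last_ind: q qp => [|q e IHq].
  by move=> _; exists id, id; split.
rewrite rcons_path last_rcons => /andP[/IHq[f [g [fK gK fP]]] /orP[]/eqP->].
  exists (nx M \o f), (g \o (fun u => nx M (nx M (nx M u)))); split=> [u|u|u] /=.
  - by rewrite nx4 fK.
  - by rewrite gK nx4.
  by rewrite p_nx; split=> [e1|/fP-> //]; apply/fP; apply: (@nx_inj _ N).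
exists (ed M \o f), (g \o ed M); split=> [u|u|u] /=.
- by rewrite ed_invol fK.
- by rewrite gK ed_invol.
by rewrite p_ed; split=> [e1|/fP-> //]; apply/fP; apply: (@ed_inj _ N).
Qed.

(* Identifies the fibres over the darts of a region, hence all of them, with
   that over [x]. *)
Lemma region_frame : exists b : U -> Y,
  [/\ forall u, b (fc M u) = b u,
      forall u v, p u = p v -> b u = b v -> u = v
    & forall d y, exists2 u, p u = d & b u = y].
Proof.
have [F F_ex] := choice fibers_equiv; have [F' FP] := choice F_ex.
(* [r u] is a reference dart on the region below [u], and [rho u] will be the dart over it on the
   region of [u]; it is unique because regions are not branched. *)
pose r u := froot (fc N) (p u).
have fcs := fconnect_sym (@fc_inj _ N).
have rho_ex (u : U) : exists v : U, p v = r u /\ exists k, iter k (fc M) u = v.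
  have c : fconnect (fc N) (p u) (r u) by apply: connect_root.
  exists (iter (findex (fc N) (p u) (r u)) (fc M) u); split; last by eexists.
  by rewrite p_iter_fc iter_findex.
have [rho rhoP] := choice rho_ex.
have rho_unique u v : p v = r u -> (exists k, iter k (fc M) u = v) -> rho u = v.
  have same i j : i <= j -> p (iter i (fc M) u) = p (iter j (fc M) u) ->
      iter i (fc M) u = iter j (fc M) u.
    move=> leij e; rewrite -(subnK leij) iterD; apply/esym/p_faces.
    by rewrite -p_iter_fc -iterD subnK.
  have [pw [j ej]] := rhoP u; move=> pv [k ek]; rewrite -ej -ek.
  have e : p (iter j (fc M) u) = p (iter k (fc M) u) by rewrite ej ek pw pv.
  by case: (leqP j k) => [/same->//|/ltnW/same->].
have r_fc u : r (fc M u) = r u.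
  apply/(fingraph.rootP fcs); rewrite p_fc fcs; exact: fconnect1.
have rho_fc u : rho (fc M u) = rho u.
  apply/esym/rho_unique; have [pv [k ek]] := rhoP (fc M u); first by rewrite pv r_fc.
  by exists k.+1; rewrite iterSr.
have rho_inj u v : p u = p v -> rho u = rho v -> u = v.
  have same a c i j : i <= j -> p a = p c -> iter i (fc M) a = iter j (fc M) c -> a = c.
    move=> leij pac e; apply: (@iter_fc_inj _ M i); rewrite e -(subnK leij) addnC iterD.
    congr (iter _ _ _); apply: p_faces; apply: (@iter_fc_inj _ N i).
    by rewrite -iterD subnKC // -!p_iter_fc -e p_iter_fc pac p_iter_fc.
  have [_ [i ei]] := rhoP u; have [_ [j ej]] := rhoP v; rewrite -ei -ej => puv e.
  case: (leqP i j) => [/same H|/ltnW/same H]; first exact: H.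
  by apply/esym/H.
have rho_surj d v : p v = froot (fc N) d -> exists2 u, p u = d & rho u = v.
  move=> pv; have c : fconnect (fc N) (froot (fc N) d) d by rewrite fcs connect_root.
  pose k := findex (fc N) (froot (fc N) d) d.
  exists (iter k (fc M) v); first by rewrite p_iter_fc pv iter_findex.
  have -> : rho (iter k (fc M) v) = rho v by elim: (k) => //= m; rewrite rho_fc.
  by apply: rho_unique; [rewrite /r pv root_root | exists 0].
have bP u : p (F' (r u) (rho u)) = x.
  have [fK gK fP] := FP (r u); apply/fP; rewrite gK.
  by have [] := rhoP u.
exists (fun u => exist (fun w => p w = x) _ (bP u)); split=> [u|u v puv|d [y py]].
- by apply: eq_exist; rewrite r_fc rho_fc.
- have [fK gK _] := FP (r u).
  move/(congr1 (fun w => sval w)) => /=; have -> : r v = r u by rewrite /r puv.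
  by move/(can_inj gK)/(rho_inj _ _ puv).
have [fK gK fP] := FP (froot (fc N) d).
have [|u pu ru] := rho_surj d (F (froot (fc N) d) y); first exact/fP.
by exists u => //; apply: eq_exist; rewrite ru /r pu fK.
Qed.

(** [psi] is the monodromy: [psi d] sends a lift of the region on the right of [d] to the lift on
    its left adjacent to it along a lift of [d]. The product goes half way round the crossing, from
    the corner of [nx2 x] to that of [x]. Both corners lie in one region below, and a trivial
    product would put their lifts in one region of the cover. *)
Lemma cover_connection k : iter k (fc N) x = nx N (nx N x) ->
  (forall u, p u = x -> iter k (fc M) u <> nx M (nx M u)) ->
  exists psi : T -> bij Y, connection N psi /\ psi x * psi (nx N (nx N (nx N x))) <> 1.
Proof.
move=> kx nnug; have [b [b_fc b_inj b_surj]] := region_frame.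
have /choice[B BP] (dy : T * Y) : exists u, p u = dy.1 /\ b u = dy.2.
  by have [u pu bu] := b_surj dy.1 dy.2; exists u.
have BE u d y : p u = d -> b u = y -> B (d, y) = u.
  by move=> pu bu; have [/= pB bB] := BP (d, y); apply: b_inj; rewrite ?pB ?bB.
pose f d y := b (ed M (B (ed N d, y))).
have fE u d : p u = d -> f d (b (ed M u)) = b u.
  by move=> pu; rewrite /f (BE (ed M u)) ?ed_invol // p_ed pu.
have fK d : cancel (f d) (f (ed N d)).
  move=> y; have [/= pB bB] := BP (ed N d, y).
  rewrite {1}/f ed_invol (BE (ed M (B (ed N d, y)))) ?ed_invol //.
  by rewrite p_ed pB ed_invol.
have fVK d : cancel (f (ed N d)) (f d) by move=> y; rewrite -{1}(ed_invol N d) fK.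
pose psi d := Bij (@fK d) (@fVK d).
have b_ed_nx u : b (ed M (nx M u)) = b u by rewrite -b_fc fc_ed_nx.
have b_ed u : b (ed M u) = b (nx M (nx M (nx M u))) by rewrite -{1}(nx4 M u) b_ed_nx.
exists psi; split; first split=> d.
- by apply: bij_eq.
- apply: bij_eq => y; have [/= pB bB] := BP (ed N d, y).
  set v := B (ed N d, y) in pB bB; set u := ed M v.
  have pu : p u = d by rewrite p_ed pB ed_invol.
  have yu : y = b (ed M u) by rewrite ed_invol.
  rewrite /= {1}yu (fE u) // -(b_ed_nx u) (fE (nx M u)) ?p_nx ?pu //.
  rewrite -(b_ed_nx (nx M u)) (fE (nx M (nx M u))) ?p_nx ?pu //.
  rewrite -(b_ed_nx (nx M (nx M u))) (fE (nx M (nx M (nx M u)))) ?p_nx ?pu //.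
  by rewrite yu b_ed.
move=> e; have [u pu] := p_surj x; have := congr1 (fun a : bij Y => a (b (nx M (nx M u)))) e.
rewrite /= -(b_ed_nx (nx M (nx M u))) (fE (nx M (nx M (nx M u)))) ?p_nx ?pu //.
rewrite -b_ed (fE u) // b_ed_nx => bu; apply: (nnug u pu).
apply: b_inj; first by rewrite p_iter_fc !p_nx pu.
by rewrite -bu; elim: (k) => //= m; rewrite b_fc.
Qed.

End CoverConnection.

(** * Reduced alternating diagrams *)

Section Adequacy.
Variables (D : motif) (g : nat) (o : {ffun D -> bool}).
Hypotheses (onD : on_surface g D) (redD : reduced D) (oP : smoothing D o)
  (o_ed : forall d, o (ed D d) = ~~ o d).

Local Notation nx2 z := (nx D (nx D z)).
Local Notation nx3 z := (nx D (nx D (nx D z))).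

(** With [o_ed], this is the checkerboard colouring of the regions of an alternating diagram. *)
Lemma o_fc d : o (fc D d) = o d.
Proof. by apply: (can_inj negbK); rewrite -oP nx_fc o_ed. Qed.

(* The circles of [o] bound the regions on the left of the darts in [o]. *)
Lemma flat_boundary : flat D o.
Proof.
move=> G psi [c1 _]; exists (fun d => if o d then 1%g else psi d); split=> d.
  by rewrite o_ed c1; case: (o d); rewrite /= ?mulgV ?mulg1.
by move=> od; rewrite oP od mulg1.
Qed.

Lemma reduced_connection x k : iter k (fc D) x = nx2 x ->
  exists (G : groupType) (psi : D -> G), connection D psi /\ (psi x * psi (nx3 x) <> 1)%g.
Proof.
move=> kx; case: redD => U [M [p [[[p_nx p_ed _] p_surj p_faces _ _] nnug]]].
have [_ conn _] := onD.
have [|psi H] := cover_connection p_nx p_ed p_surj p_faces conn kx.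
  by move=> u _ ku; apply: (nnug u); exists 0, 2; split=> //; exists k.
by exists (bij {u | p u = x}), psi.
Qed.

(** The boundary of the region on the left of [x] is followed until it first comes back to the
    crossing along this region. If it comes back at [x], the flipped smoothing connects the two arcs
    that [f] distinguishes. If it comes back opposite to [x], the flipped circle closes up along a
    path with the nontrivial holonomy of [reduced_connection]. *)
Lemma boundary_flip_not_split x (f : {ffun D -> 'F_2}) : o x -> flat D (flip D x o) ->
  f \in colorings D (flip D x o) -> f (nx2 x) != f x -> False.
Proof.
move=> ox fs fcol fx; set s := flip D x o in fs fcol.
have ex_k : exists k, (0 < k) && ((iter k (fc D) x == x) || (iter k (fc D) x == nx2 x)).
  exists (fingraph.order (fc D) x); rewrite fingraph.order_gt0 fingraph.iter_order ?eqxx //; exact: fc_inj.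
have [k /andP[k_gt0 kx] kmin] := ex_minnP ex_k.
have o_iter j : o (iter j (fc D) x) by elim: j => //= j; rewrite o_fc.
have s1 : s (nx D x) by rewrite flipE star_nx star_id oP ox.
have s3 : s (nx3 x) by rewrite flipE !star_nx star_id (smoothing3 _ oP) ox.
pose d := iter k.-1 (fc D) x.
have fcd : fc D d = iter k (fc D) x by rewrite -[k in RHS]prednK.
(* Before step [k] the flipped crossing is not met, so the circle stays along the region and the
   section keeps its value there. *)
have along (G : groupType) (psi xi : D -> G) : connection D psi -> horizontal D s psi xi ->
    xi d = xi x.
  move=> [c1 _] [h1 h2]; rewrite /d; have : k.-1 < k by rewrite prednK.
  elim: (k.-1) => // j IHj ltjk; rewrite -IHj ?(ltnW ltjk) //=.
  set e := iter j (fc D) x.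
  have se : s (fc D e).
    rewrite flipE o_fc o_iter addbT; apply/negP; rewrite starE.
    have /negP oe : ~~ ~~ o (fc D e) by rewrite negbK o_fc o_iter.
    have nk : ~~ ((iter j.+1 (fc D) x == x) || (iter j.+1 (fc D) x == nx2 x)).
      by apply: contraL ltjk => H; rewrite -leqNgt kmin.
    rewrite /= -/e negb_or in nk; case/andP: nk => /negbTE-> /negbTE->.
    by case/or4P=> // /eqP e'; apply: oe; rewrite e' ?(smoothing3 _ oP) ?oP ox.
  have := h2 _ se; rewrite nx_fc => e1.
  by rewrite (h1 e) e1 c1 mulVKg.
have [f1 f2] := coloringsP fcol.
have fd : f d = f x.
  by apply: (along _ _ _ (connection1 D 'F_2)); apply/col_horizontal.
have edd : ed D d = nx D (iter k (fc D) x) by rewrite -fcd nx_fc.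
case/orP: kx => /eqP kx; rewrite kx in edd.
  by case/eqP: fx; rewrite f2 // -fd (f1 d) edd.
have [G [psi [cpsi nontriv]]] := reduced_connection kx.
have [xi Hxi] := fs G psi cpsi; have [h1 h2] := Hxi.
apply: nontriv; have [c1 _] := cpsi.
have e3 : psi d = (psi (nx3 x))^-1%g by rewrite -edd c1 invgK.
have := along _ _ _ cpsi Hxi; have := h2 _ s3; rewrite nx4 => ->.
by rewrite h1 edd => /mulIg <-; rewrite e3 mulVg.
Qed.

(** Equality means that every flip away from [o] created a circle. Undoing one merges two
    null-homotopic circles into a null-homotopic one, so the state stays extremal, down to a single
    flip, which [boundary_flip_not_split] excludes. *)
Lemma flat_adequate n (s : {ffun D -> bool}) : smoothing D s ->
  #|[set d | s d != o d]| = 4 * n ->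
  circles D s <= circles D o + n /\
  (flat D s -> circles D s = circles D o + n -> n = 0).
Proof.
elim: n s => [|n IHn] s sP.
  rewrite muln0 => /eqP; rewrite cards_eq0 => /eqP/setP e; split=> //.
  suff -> : s = o by rewrite addn0.
  apply/ffunP=> d; have := e d; rewrite !inE => /negbT; rewrite negbK => /eqP //.
move=> cs.
have [x sx] : exists x, s x != o x.
  have /card_gt0P[x] : 0 < #|[set d | s d != o d]| by rewrite cs.
  by rewrite inE => sx; exists x.
wlog ox : x sx / o x => [H|].
  case: (boolP (o x)) => ox; first exact: (H x).
  by apply: (H (nx D x)); rewrite ?sP ?oP //; case: (s x) (o x) sx ox => -[].
set t := flip D x s; have tP : smoothing D t by apply: flip_smoothing.
have st : s = flip D x t by rewrite flipK.
have sstar d : d \in star D x -> s d != o d.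
  rewrite starE => /or4P[]/eqP->; rewrite ?(smoothing3 _ sP) ?(smoothing2 _ sP)
    ?(smoothing3 _ oP) ?(smoothing2 _ oP) ?sP ?oP //; by case: (s x) (o x) sx => -[].
have ct : #|[set d | t d != o d]| = 4 * n.
  apply/eqP; rewrite -(eqn_add2r 4) -mulnSr -cs -(card_star D x).
  rewrite -(cardsID (star D x) [set d | s d != o d]) addnC; apply/eqP; congr (_ + _).
    apply: eq_card => d; rewrite !inE -starE andb_idl //; exact: sstar.
  apply: eq_card => d; rewrite !inE -starE /t flipE.
  by case: (boolP (d \in star D x)) => //= /sstar; case: (s d) (o d) => -[].
have [le1 le2] := IHn t tP ct.
have le3 : circles D s <= (circles D t).+1 by rewrite st circles_flip.
split=> [|fs es].
  by rewrite (leq_trans le3) // addnS ltnS.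
have tx : t x.
  by rewrite /t flipE star_id; case: (s x) (o x) sx ox => -[].
have ctn : circles D t = circles D o + n.
  by apply/eqP; rewrite eqn_leq le1 -ltnS -addnS -es le3.
have [|f fcol fx] := circles_flip_max tP tx; first by rewrite -st es ctn addnS.
rewrite -st in fcol.
have [n0|n_gt0] := posnP n.
  have to : t = o.
    apply/ffunP=> d; apply/eqP; move: ct; rewrite n0 muln0 => /eqP.
    by rewrite cards_eq0 => /eqP/setP/(_ d); rewrite !inE => /negbT; rewrite negbK.
  by case: (@boundary_flip_not_split x f); rewrite // -to -st.
suff ft : flat D t by have := le2 ft ctn; lia.
have sx' : s x = false by move: sx; rewrite ox; case: (s x).
have snx : s (nx D x) by rewrite sP sx'.
have [f1 f2] := coloringsP fcol.
have -> : t = flip D (nx D x) s by apply: flip_star; rewrite star_nxl.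
have e1 : f (nx2 x) = f (nx D x) by apply: f2.
have e2 : f (nx3 x) = f x.
  by have := f2 (nx3 x); rewrite nx4 => <- //; rewrite (smoothing3 _ sP) sx'.
(* A colour class of [f] contains one of the two arcs at the crossing and not the other. *)
apply: (@flat_flip_separated _ _ _ _ [pred d | f d == f (nx D x)]) => // [d|d sd||] /=.
- by rewrite -f1.
- by rewrite f2.
- exact: eqxx.
by rewrite e2 -e1 eq_sym.
Qed.

(** [left] and [right] read, on each edge, the value on the adjacent region of either colour of the
    checkerboard: a function on regions becomes a pair of colorings. *)
Lemma regions_le_circles (o' : {ffun D -> bool}) : (forall d, o' d = ~~ o d) ->
  fcard (fc D) D <= circles D o + circles D o'.
Proof.
move=> oo'; suff: #|[set h : {ffun D -> 'F_2} | [forall d, h (fc D d) == h d]]|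
    <= #|setX (colorings D o) (colorings D o')|.
  by rewrite (card_finvariants (@fc_inj _ D)) cardsX !card_col -expnD leq_exp2l.
pose left (h : {ffun D -> 'F_2}) : {ffun D -> 'F_2} := [ffun d => if o d then h d else h (nx3 d)].
pose right (h : {ffun D -> 'F_2}) : {ffun D -> 'F_2} := [ffun d => if o d then h (nx3 d) else h d].
have inj : injective (fun h => (left h, right h)).
  move=> h h' [/ffunP eo /ffunP eo']; apply/ffunP=> d.
  by have := eo d; have := eo' d; rewrite !ffunE; case: (o d).
rewrite -(card_imset _ inj); apply/subset_leq_card/fintype.subsetP=> _ /imsetP[h hP ->].
have h_fc d : h (fc D d) = h d by move: hP; rewrite inE => /forallP/(_ d)/eqP.
have h_ed d : h (nx3 (ed D d)) = h d by exact: (h_fc d).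
have h_ed' d : h (ed D d) = h (nx3 d) by rewrite -h_ed ed_invol.
rewrite in_setX; apply/andP; split; apply/coloringsP; split=> d; rewrite !ffunE ?o_ed ?oP.
- by case: (o d); rewrite /= ?h_ed ?h_ed'.
- by move=> od; rewrite od /= nx4.
- by case: (o d); rewrite /= ?h_ed ?h_ed'.
by rewrite oo' => /negbTE->; rewrite /= nx4.
Qed.

End Adequacy.

(** * The span of the bracket *)

Lemma same_weave_bracket (K : comNzRingType) (y y' : K) (g : nat) (D D' : motif) :
  (y * y' = 1)%R -> same_weave g D D' -> bracket_equiv y y' D D'.
Proof.
move=> yy'; elim=> {D D'}.
- move=> D D' _ _ /(isomorphic_bracket y y') e.
  by exists false, 0, 0; rewrite !expr0 !mul1r.
- by move=> D D' _ _ [x ex er]; apply: R1_bracket yy' ex er.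
- by move=> D D' onD onD' [x [w [nxw ed1 ed2 ov er]]]; apply: R2_bracket yy' onD onD' _ ed1 _ _ er.
- by move=> D D' _ _; apply: R3_bracket.
- by move=> D D' _; apply: bracket_equiv_sym.
by move=> D D' D'' _ e1 _; apply: bracket_equiv_trans e1.
Qed.

(** * The bracket as a polynomial, and its degrees *)

Section Polynomials.
Local Open Scope ring_scope.
Variables (T : finType) (M : diagram T) (m : nat).
Hypothesis le_m : (#|T| <= m)%N.
Implicit Types s : {ffun T -> bool}.

(** The factor X^m clears the negative powers of [y] in the circle value, as [m] bounds the number
    of circles. *)
Definition state_poly s : {poly int} :=
  (-1) ^+ circles M s * ('X^(a_count M s + (m - circles M s)) * ('X^2 + 1) ^+ circles M s).

(* The bracket at y = X, multiplied by X^m. *)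
Definition bracket_poly : {poly int} :=
  \sum_(s in smoothings M | `[< flat M s >]) state_poly s.

Lemma circles_le s : (circles M s <= m)%N.
Proof. exact: leq_trans (max_card _) le_m. Qed.

Lemma bracket_polyE (y : {fraction {poly int}}) : y = tofrac 'X ->
  tofrac bracket_poly = y ^+ m * bracket y y^-1 M.
Proof.
move=> yE; have y0 : y != 0 by rewrite yE tofrac_eq0 polyX_eq0.
rewrite rmorph_sum mulr_sumr big_mkcondr /=; apply: eq_bigr => s _.
rewrite /weight; case: asboolP => _; last by rewrite mulr0.
rewrite /state_poly !(rmorphM, rmorphXn, rmorphD, rmorph1, rmorphN) /= -yE.
have yy' : y * y^-1 = 1 by rewrite divff.
have e : y ^+ circles M s * loop_value y y^-1 ^+ circles M s
    = (-1) ^+ circles M s * (y ^+ 2 + 1) ^+ circles M s.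
  by rewrite -!exprMn loop_valueE // mulN1r.
rewrite -{2}(subnK (circles_le s)) !exprD.
transitivity ((-1) ^+ circles M s * (y ^+ 2 + 1) ^+ circles M s
  * (y ^+ a_count M s * y ^+ (m - circles M s))); first by ring.
by rewrite -e; ring.
Qed.

Lemma coef_state_poly s i : (state_poly s)`_i =
  (-1) ^+ circles M s * (if (i < a_count M s + (m - circles M s))%N then 0
                         else (('X^2 + 1) ^+ circles M s)`_(i - (a_count M s + (m - circles M s)))).
Proof.
rewrite /state_poly -[(-1) ^+ _ in LHS]signr_odd -[(-1) ^+ _ in RHS]signr_odd.
rewrite -coefXnM; case: (odd _); last by rewrite !expr0 !mul1r.
by rewrite !expr1 !mulN1r coefN.
Qed.

Lemma monic_loop n : (('X^2 + 1) ^+ n : {poly int}) \is monic.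
Proof. by rewrite monic_exp // -['X^2 + 1]/(('X^2 + 1%:P) : {poly int}) monicXnaddC. Qed.

Lemma size_loop n : size (('X^2 + 1) ^+ n : {poly int}) = (2 * n).+1.
Proof.
have s2 : size ('X^2 + 1%:P : {poly int}) = 3 by rewrite size_XnaddC.
rewrite -[LHS]prednK; last by rewrite size_poly_gt0 monic_neq0 ?monic_loop.
by rewrite size_exp s2.
Qed.

Lemma coef_state_poly_range s i : (state_poly s)`_i != 0 ->
  (a_count M s + m <= i + circles M s)%N /\ (i <= a_count M s + m + circles M s)%N.
Proof.
have := circles_le s; rewrite coef_state_poly mulf_eq0 negb_or => len /andP[_].
case: ltnP => [_|le_i]; first by rewrite eqxx.
case: (ltnP (i - (a_count M s + (m - circles M s))) (2 * circles M s).+1) => [|out].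
  by lia.
by rewrite nth_default ?size_loop // eqxx.
Qed.

Lemma coef_state_poly_top s : (state_poly s)`_(a_count M s + m + circles M s) != 0.
Proof.
have len := circles_le s.
rewrite coef_state_poly mulf_eq0 negb_or signr_eq0 /= ifF; last by lia.
have -> : (a_count M s + m + circles M s - (a_count M s + (m - circles M s)) = 2 * circles M s)%N.
  by lia.
by have /monicP := monic_loop (circles M s); rewrite /lead_coef size_loop /= => ->.
Qed.

Lemma coef_state_poly_bottom s : (state_poly s)`_(a_count M s + (m - circles M s)) != 0.
Proof.
rewrite coef_state_poly mulf_eq0 negb_or signr_eq0 /= ltnn subnn.
by rewrite -horner_coef0 !hornerE expr1n.
Qed.

Lemma coef_bracket_poly i : bracket_poly`_i != 0 -> exists s, [/\ smoothing M s, flat M s,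
  (a_count M s + m <= i + circles M s)%N & (i <= a_count M s + m + circles M s)%N].
Proof.
move=> nz; have [s /and3P[/smoothingsP sP /asboolP fs /coef_state_poly_range[le1 le2]]|none] :=
  pickP [pred s | [&& s \in smoothings M, `[< flat M s >] & (state_poly s)`_i != 0]].
  by exists s.
case/eqP: nz; rewrite coef_sum big1 // => s /andP[sP fs].
by have /negbT := none s; rewrite /= sP fs /= negbK => /eqP.
Qed.

Lemma coef_bracket_poly_extreme (o : {ffun T -> bool}) i : smoothing M o -> flat M o ->
  (forall s, smoothing M s -> flat M s -> (a_count M s + m <= i + circles M s)%N ->
     (i <= a_count M s + m + circles M s)%N -> s = o) ->
  (state_poly o)`_i != 0 -> bracket_poly`_i != 0.
Proof.
move=> oP fo only; rewrite coef_sum (bigD1 o) /=; last by apply/andP; split; [apply/smoothingsP|apply/asboolP].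
rewrite big1 ?addr0 // => s /andP[/andP[/smoothingsP sP /asboolP fs]] ne.
apply/eqP; apply: contraR ne => /coef_state_poly_range[le1 le2].
exact/eqP/only.
Qed.

End Polynomials.

Section Counts.
Variables (T : finType) (M : diagram T).
Implicit Types s : {ffun T -> bool}.

Lemma card_agree (s s' : {ffun T -> bool}) : smoothing M s -> smoothing M s' ->
  fcard (nx M) [pred d | s d == s' d] * 4 = #|[set d | s d == s' d]|.
Proof.
move=> sP s'P; rewrite card_crossings; first by apply: eq_card => d; rewrite inE.
by move=> d _ /eqP <-; rewrite !inE sP s'P; case: (s d) (s' d) => -[].
Qed.

Lemma a_countE (s : {ffun T -> bool}) : smoothing M s -> a_count M s * 4 = #|[set d | s d == over M d]|.
Proof.
move=> sP; pose o := finfun (over M); have oP : smoothing M o.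
  by move=> d; rewrite !ffunE over_nx.
have e : [set d | s d == over M d] = [set d | s d == o d].
  by apply/setP=> d; rewrite !inE ffunE.
by rewrite /a_count e -card_agree // mulnK.
Qed.

Lemma card_disagree (s s' : {ffun T -> bool}) : smoothing M s -> smoothing M s' ->
  exists2 k, #|[set d | s d != s' d]| = 4 * k
           & fcard (nx M) [pred d | s d == s' d] + k = fcard (nx M) T.
Proof.
move=> sP s'P; have s''P : smoothing M (finfun (fun d => ~~ s' d)).
  by move=> d; rewrite !ffunE s'P.
exists (fcard (nx M) [pred d | s d == finfun (fun d => ~~ s' d) d]).
  rewrite mulnC card_agree //; apply: eq_card => d; rewrite !inE ffunE.
  by case: (s d) (s' d) => -[].
apply/eqP; rewrite -(eqn_pmul2r (isT : 0 < 4)) mulnDl !card_agree // card_crossings //.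
rewrite -(cardsC [set d | s d == s' d]); apply/eqP; congr (_ + _).
by apply: eq_card => d; rewrite !inE ffunE; case: (s d) (s' d) => -[].
Qed.

End Counts.

Section Extremes.
Variables (D : motif) (g m : nat).
Hypotheses (onD : on_surface g D) (redD : reduced D) (altD : alternating_diagram D)
  (le_m : #|D| <= m).

Definition all_A : {ffun D -> bool} := finfun (over D).
Definition all_B : {ffun D -> bool} := finfun (fun d => ~~ over D d).

Lemma all_A_smoothing : smoothing D all_A.
Proof. by move=> d; rewrite !ffunE over_nx. Qed.

Lemma all_B_smoothing : smoothing D all_B.
Proof. by move=> d; rewrite !ffunE over_nx. Qed.

Lemma all_A_ed d : all_A (ed D d) = ~~ all_A d.
Proof. by rewrite !ffunE altD. Qed.

Lemma all_B_ed d : all_B (ed D d) = ~~ all_B d.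
Proof. by rewrite !ffunE altD. Qed.

(** At [k] crossings from [all_A], the A-count drops by [k], and at most [k] circles are gained; by
    [flat_adequate], a null-homotopic state reaches this degree only for k = 0. *)
Lemma coef_bracket_poly_top :
  ((bracket_poly D m)`_(crossings D + m + circles D all_A) != 0)%R.
Proof.
have aE (s : {ffun D -> bool}) : smoothing D s -> exists2 k, #|[set d | s d != all_A d]| = 4 * k
    & a_count D s + k = crossings D.
  move=> sP; have [k ck ek] := card_disagree sP all_A_smoothing; exists k => //.
  rewrite /crossings -ek; congr (_ + _); apply/eqP; rewrite -(eqn_pmul2r (isT : 0 < 4)).
  rewrite a_countE // (card_agree sP all_A_smoothing); apply/eqP.
  by apply: eq_card => d; rewrite !inE ffunE.
have aA : a_count D all_A = crossings D.
  have [k ck <-] := aE _ all_A_smoothing.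
  suff -> : k = 0 by rewrite addn0.
  apply/eqP; rewrite -(eqn_pmul2l (isT : 0 < 4)) -ck muln0 cards_eq0.
  by apply/eqP/setP=> d; rewrite !inE eqxx.
apply: (@coef_bracket_poly_extreme _ _ m le_m all_A) => //.
- exact: all_A_smoothing.
- exact: flat_boundary all_A_smoothing all_A_ed.
- move=> s sP fs _; have [k ck <-] := aE s sP => le.
  have [le1 le2] := flat_adequate onD redD all_A_smoothing all_A_ed sP ck.
  have k0 : k = 0 by apply: le2 => //; lia.
  apply/ffunP=> d; move/eqP: ck; rewrite k0 muln0 cards_eq0 => /eqP/setP/(_ d).
  by rewrite !inE => /negbT; rewrite negbK => /eqP.
by rewrite -aA coef_state_poly_top.
Qed.

Lemma coef_bracket_poly_bottom : ((bracket_poly D m)`_(m - circles D all_B) != 0)%R.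
Proof.
have aE (s : {ffun D -> bool}) : smoothing D s -> #|[set d | s d != all_B d]| = 4 * a_count D s.
  move=> sP; rewrite mulnC a_countE //; apply: eq_card => d; rewrite !inE ffunE.
  by case: (s d) (over D d) => -[].
have aB : a_count D all_B = 0.
  apply/eqP; rewrite -(eqn_pmul2l (isT : 0 < 4)) -aE ?muln0 ?cards_eq0; last exact: all_B_smoothing.
  by apply/eqP/setP=> d; rewrite !inE eqxx.
apply: (@coef_bracket_poly_extreme _ _ m le_m all_B) => //.
- exact: all_B_smoothing.
- exact: flat_boundary all_B_smoothing all_B_ed.
- move=> s sP fs le _; have ck := aE s sP.
  have [le1 le2] := flat_adequate onD redD all_B_smoothing all_B_ed sP ck.
  have len := circles_le D le_m all_B.
  have k0 : a_count D s = 0 by apply: le2 => //; lia.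
  apply/ffunP=> d; move/eqP: ck; rewrite k0 muln0 cards_eq0 => /eqP/setP/(_ d).
  by rewrite !inE => /negbT; rewrite negbK => /eqP.
by have := coef_state_poly_bottom D m all_B; rewrite aB.
Qed.

End Extremes.

Lemma card_regions (g : nat) (D : motif) : on_surface g D ->
  fcard (fc D) D + 2 * g = crossings D + 2.
Proof.
case=> _ _; rewrite -/(crossings D).
have eV : crossings D * 4 = #|D| by apply: card_crossings.
by have := card_edges D; set E := fcard (ed D) _; set F := fcard (fc D) _; lia.
Qed.

Lemma crossings_le (g : nat) (D D' : motif) : on_surface g D -> on_surface g D' ->
  reduced D -> alternating_diagram D ->
  (forall (K : comNzRingType) (y y' : K), (y * y' = 1)%R -> bracket_equiv y y' D D') ->
  crossings D <= crossings D'.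
Proof.
move=> onD onD' redD altD equivDD'.
pose m := #|D| + #|D'|; have le_m : #|D| <= m by apply: leq_addr.
have le_m' : #|D'| <= m by apply: leq_addl.
pose y : {fraction {poly int}} := tofrac 'X%R.
have y0 : (y != 0)%R by rewrite tofrac_eq0 polyX_eq0.
have [b [j [k e]]] := equivDD' _ y (y^-1)%R (divff y0).
have {}e : ('X^j * bracket_poly D m = (-1) ^+ b * ('X^k * bracket_poly D' m))%R.
  apply/eqP; rewrite -tofrac_eq; apply/eqP.
  rewrite !(rmorphM, rmorphXn, rmorphN, rmorph1) /= -/y.
  rewrite (bracket_polyE D le_m (erefl y)) (bracket_polyE D' le_m' (erefl y)) mulrCA e.
  by ring.
(* The monomials shift all degrees by the same amount, which disappears in the difference between
   the top and the bottom degree. *)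
have coefE i : ((bracket_poly D m)`_i != 0)%R -> exists2 i', ((bracket_poly D' m)`_i' != 0)%R & i + j = i' + k.
  move=> nz; have := congr1 (fun p : {poly int} => p`_(j + i))%R e.
  rewrite /= coefXnM ltnNge leq_addr addKn /= => ei; rewrite {}ei in nz.
  exists (j + i - k); move: nz; case: b {e} => /=; rewrite ?expr1 ?expr0 ?mulN1r ?mul1r ?coefN ?oppr_eq0;
    rewrite coefXnM; case: ltnP => // *; rewrite ?eqxx //; lia.
have [i1 /(coef_bracket_poly le_m')[s1 [s1P f1 _ le1]] e1] := coefE _ (coef_bracket_poly_top onD redD altD le_m).
have [i2 /(coef_bracket_poly le_m')[s2 [s2P f2 le2 _]] e2] := coefE _ (coef_bracket_poly_bottom onD redD altD le_m).
have leB := circles_le D le_m (all_B D).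
have [D'_gt0 conn _] := onD'; have /card_gt0P[d0 _] := D'_gt0.
have le3 := flat_circles_bound s1P s2P conn d0 f1 f2.
have [n cn en] := card_disagree s1P s2P.
have le4 : a_count D' s1 <= a_count D' s2 + n.
  rewrite -(leq_pmul2r (isT : 0 < 4)) mulnDl !a_countE // [n * 4]mulnC -cn.
  apply: leq_trans (leq_card_setU _ _).
  apply/subset_leq_card/fintype.subsetP=> d; rewrite !inE => /eqP ->.
  by rewrite eq_sym; case: eqP.
have le5 : fcard (fc D) D <= circles D (all_A D) + circles D (all_B D).
  apply: regions_le_circles; [exact: all_A_smoothing | exact: all_A_ed |].
  by move=> d; rewrite !ffunE.
have e3 := card_regions onD; have e4 := card_regions onD'.
rewrite -/(crossings D') in en.
lia.
Qed.

(** * Motifs of a weave *)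

Import classical_sets.
Import Defs.

Lemma same_weave_surface (g : nat) (D D' : motif) :
  same_weave g D D' -> on_surface g D /\ on_surface g D'.
Proof.
elim=> {D D'} // [D D' _ []|D D' D'' _ [onD _] _ []] //.
Qed.

Lemma isomorphic_genus (g g' : nat) (D D' : motif) :
  isomorphic D D' -> on_surface g D -> on_surface g' D' -> g = g'.
Proof.
case=> f [f' fK f'K] [f_nx f_ed _] onD onD'.
have f_fc d : f (fc D d) = fc D' (f d) by rewrite /fc !f_nx f_ed.
have f'_fc d : f' (fc D' d) = fc D (f' d) by rewrite -{1}(f'K d) -f_fc fK.
have eF : fcard (fc D) D = fcard (fc D') D'.
  have symD := fconnect_sym (@fc_inj _ D); have symD' := fconnect_sym (@fc_inj _ D').
  have clD : fclosed (fc D) D by [].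
  rewrite (@adjunction_n_comp _ _ f' _ _ symD symD' _ clD); first by apply: eq_n_comp_r.
  apply: (@intro_adjunction _ _ f' _ _ symD' _ clD (fun x _ => f x)) => x _; split.
  - by rewrite fK.
  - by move=> y _ /eqP <-; rewrite f_fc; apply: fconnect1.
  - by rewrite f'K.
  by move=> y /eqP <-; rewrite f'_fc; apply: fconnect1.
have eT : #|D| = #|D'| by apply: (bij_eq_card (f := f)); exists f'.
have := card_regions onD; have := card_regions onD'.
have eV : crossings D * 4 = #|D| by apply: card_crossings.
have eV' : crossings D' * 4 = #|D'| by apply: card_crossings.
rewrite eF; set F := fcard _ _; lia.
Qed.

Section Quotients.
Variables (R : realType) (X : geometry) (W : lifted_link R X) (L : set (point R -> point R)).

Lemma quotient_isomorphic (D D' : motif) (p : wdart W -> D) (p' : wdart W -> D') :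
  quotient L p -> quotient L p' -> isomorphic D D'.
Proof.
move=> [[[p_nx p_ed p_over] /choice[q qK] _ _ _] pL].
move=> [[[p'_nx p'_ed p'_over] /choice[q' q'K] _ _ _] p'L].
have pp' d e : p d = p e -> p' d = p' e by move/pL/p'L.
have p'p d e : p' d = p' e -> p d = p e by move/p'L/pL.
have qE d : p' (q (p d)) = p' d by apply: pp'; rewrite qK.
have q'E d : p (q' (p' d)) = p d by apply: p'p; rewrite q'K.
exists (fun x => p' (q x)).
  by exists (fun x => p (q' x)) => x; rewrite ?q'E ?qE ?qK ?q'K.
split=> x; first by rewrite -{1}(qK x) -p_nx qE p'_nx.

  by rewrite -{1}(qK x) -p_ed qE p'_ed.
by rewrite p'_over -{2}(qK x) p_over.
Qed.

End Quotients.

Section Minimality.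
Variables (R : realType) (X : geometry) (W : lifted_link R X) (g : nat) (D : motif).
Hypotheses (minD : minimal_motif W g D) (redD : reduced D) (altD : alternating_diagram D).

(** Two minimal lattices contain each other, so both motifs represent quotients of [W] by the same
    group; these quotients are isomorphic, hence on surfaces of the same genus. *)
Lemma crossings_minimal (g' : nat) (D' : motif) :
  minimal_motif W g' D' -> crossings D <= crossings D'.
Proof.
case: minD => L [perL minL] [_ _ _ [D0 [p [quot onD0 weave]]]].
case=> L' [perL' minL'] [_ _ _ [D0' [p' [quot' onD0' weave']]]].
have eL : L' = L by apply/seteqP; split; [apply: minL | apply: minL'].
rewrite eL in quot'.
have iso := quotient_isomorphic quot quot'.
have eg := isomorphic_genus iso onD0 onD0'; rewrite -eg in onD0' weave'.
have [_ onD] := same_weave_surface weave; have [_ onD'] := same_weave_surface weave'.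
have DD' : same_weave g D D'.
  by apply: Same_trans (Same_sym weave) (Same_trans (Same_homeo onD0 onD0' iso) weave').
by apply: (crossings_le onD onD' redD altD) => K y y' yy'; apply: same_weave_bracket DD'.
Qed.

End Minimality.

Theorem theorem1p1 (R : realType) (g : nat) (W : lifted_link R (geometry_of g))
    (D : motif) :
  (1 <= g)%N ->
  periodic_weave W ->
  alternating_weave W ->
  minimal_motif W g D ->
  reduced D ->
  alternating_diagram D ->
  crossings D = crossing_number W.
Proof.
move=> _ _ _ minD redD altD; have le := crossings_minimal minD redD altD.
rewrite /crossing_number; apply/esym/xget_unique => [|n [[g' [D' [minD' <-]]] len]].
  by split; [exists g, D | move=> g' D'; apply: le].
by apply/eqP; rewrite eqn_leq (len _ _ minD) (le _ _ minD').
Qed.
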